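(* There is an algorithm that, given a $P_7$-free chordal graph $G$ with $n$ vertices and $m$ edges, enumerates the family $\mathcal{D}_{RN}(G)$ (each member exactly once) with $O(n+m)$ delay, using $O(n^2)$ space and $O(n^2)$ preprocessing time.
   Context: All graphs are finite, simple and undirected. $N[x]$ is the closed neighbourhood of $x$ and $N[X]=\bigcup_{x\in X}N[x]$. A minimal dominating set of $G$ is an inclusion-minimal set $D$ with $N[D]=V(G)$. A vertex $x$ is irredundant if $N[x]$ is inclusion-minimal in $\{N[y]:y\in V(G)\}$, with the convention that among several vertices having the same inclusion-minimal closed neighbourhood exactly one (fixed) is declared irredundant; all other vertices are redundant; $RN(G)$ is the set of redundant vertices. $\mathcal{D}_{RN}(G)=\{D\cap RN(G): D\text{ a minimal dominating set of }G\}$. $P_k$-free means no induced path on $k$ vertices; chordal means no induced cycle of length at least four. The delay is the maximum time before the first output, between consecutive outputs, and after the last output. *)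

(* Defs.v *)
From mathcomp Require Import all_boot.
Set Implicit Arguments.
Unset Strict Implicit.
Unset Printing Implicit Defensive.

(* A finite simple graph is a symmetric irreflexive relation on a finType. *)
Definition simple_graph (T : finType) (e : rel T) : Prop :=
  symmetric e /\ irreflexive e.

Definition edges (T : finType) (e : rel T) : {set {set T}} :=
  [set [set p.1; p.2] | p : T * T & e p.1 p.2].

Definition induced_copy (U T : finType) (h : rel U) (e : rel T) : Prop :=
  exists f : U -> T, injective f /\ forall i j, e (f i) (f j) = h i j.

Definition path_graph (k : nat) : rel 'I_k :=
  fun i j => (i.+1 == j) || (j.+1 == i).

Definition cycle_graph (k : nat) : rel 'I_k :=
  fun i j => (i.+1 %% k == j) || (j.+1 %% k == i).

Definition path_free (k : nat) (T : finType) (e : rel T) : Prop :=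
  ~ induced_copy (@path_graph k) e.

Definition chordal (T : finType) (e : rel T) : Prop :=
  forall k, 4 <= k -> ~ induced_copy (@cycle_graph k) e.

Definition cnbhd (T : finType) (e : rel T) (x : T) : {set T} :=
  [set y | (y == x) || e x y].

Definition cnbhds (T : finType) (e : rel T) (X : {set T}) : {set T} :=
  \bigcup_(x in X) cnbhd e x.

Definition minimal_dominating (T : finType) (e : rel T) (D : {set T}) : bool :=
  minset (fun X : {set T} => cnbhds e X == [set: T]) D.

(* Among the vertices sharing an inclusion-minimal closed neighbourhood, the
   one declared irredundant is the one with the smallest label. *)
Definition irredundant (n : nat) (e : rel 'I_n) (x : 'I_n) : bool :=
  minset (fun A : {set 'I_n} => A \in [set cnbhd e y | y : 'I_n]) (cnbhd e x)
  && [forall y : 'I_n, (cnbhd e y == cnbhd e x) ==> (x <= y)].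

Definition RN (n : nat) (e : rel 'I_n) : {set 'I_n} :=
  [set x | ~~ irredundant e x].

Definition DRN (n : nat) (e : rel 'I_n) : {set {set 'I_n}} :=
  [set D :&: RN e | D : {set 'I_n} & minimal_dominating e D].

(* The model of computation is a unit-cost word RAM, presented as a structured
   imperative language. Memory is split into banks (arrays); the bank of each
   access is a constant of the program, so a given program uses a constant
   number of banks. The semantics is relative to
     S : the number of cells of each bank, and
     W : a strict bound on every value computed (words of log2 W bits);
   a computation that leaves these bounds is stuck. *)
Inductive binop := Add | Sub | Mul | Div | Lt | Eq.

Inductive expr :=
  | Const of nat
  | Fetch of nat & expr
  | Bin of binop & expr & expr.

Inductive cmd :=
  | Skip
  | Store of nat & expr & expr (* Store a i v: bank a, cell i := v *)
  | Comp of cmd & cmd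
  | If of expr & cmd & cmd
  | While of expr & cmd
  | Write of expr  (* appends a vertex to the solution being written *)
  | Emit.          (* completes the solution being written *)

Definition memory := nat -> nat -> nat.

Definition store (s : memory) (a i v : nat) : memory :=
  fun b j => if (b == a) && (j == i) then v else s b j.

Definition binop_eval (o : binop) (x y : nat) : nat :=
  match o with
  | Add => x + y
  | Sub => x - y
  | Mul => x * y
  | Div => x %/ y
  | Lt => x < y
  | Eq => x == y
  end.

Definition guard (B x : nat) : option nat := if x < B then Some x else None.

Fixpoint eval (S W : nat) (s : memory) (t : expr) : option nat :=
  match t with
  | Const k => guard W k
  | Fetch a t1 =>
      obind (fun i => if i < S then guard W (s a i) else None) (eval S W s t1)
  | Bin o t1 t2 =>
      obind (fun x => obind (fun y => guard W (binop_eval o x y))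
                            (eval S W s t2)) (eval S W s t1)
  end.

Fixpoint cost (t : expr) : nat :=
  match t with
  | Const _ => 1
  | Fetch _ t1 => (cost t1).+1
  | Bin _ t1 t2 => (cost t1 + cost t2).+1
  end.

(* Each event of a trace takes one unit of time. *)
Inductive event := Tick | Out of nat | Sep.

Definition trace := seq event.

Definition ticks (k : nat) : trace := nseq k Tick.

(* exec S W c s t s': run from memory s, the command c terminates in memory s'
   with trace t; see exec_det for determinism. *)
Inductive exec (S W : nat) : cmd -> memory -> trace -> memory -> Prop :=
  | ExecSkip s : exec S W Skip s (ticks 1) s
  | ExecStore s a t1 t2 i v :
      eval S W s t1 = Some i -> eval S W s t2 = Some v -> i < S ->
      exec S W (Store a t1 t2) s (ticks (cost t1 + cost t2).+1) (store s a i v)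
  | ExecComp s1 s2 s3 c1 c2 u1 u2 :
      exec S W c1 s1 u1 s2 -> exec S W c2 s2 u2 s3 ->
      exec S W (Comp c1 c2) s1 (u1 ++ u2) s3
  | ExecIf s s' t c1 c2 v u :
      eval S W s t = Some v ->
      exec S W (if v != 0 then c1 else c2) s u s' ->
      exec S W (If t c1 c2) s (ticks (cost t).+1 ++ u) s'
  | ExecWhileStop s t c :
      eval S W s t = Some 0 ->
      exec S W (While t c) s (ticks (cost t).+1) s
  | ExecWhileStep s1 s2 s3 t c v u1 u2 :
      eval S W s1 t = Some v -> v != 0 ->
      exec S W c s1 u1 s2 -> exec S W (While t c) s2 u2 s3 ->
      exec S W (While t c) s1 (ticks (cost t).+1 ++ u1 ++ u2) s3
  | ExecWrite s t v :
      eval S W s t = Some v ->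
      exec S W (Write t) s (ticks (cost t) ++ [:: Out v]) s
  | ExecEmit s : exec S W Emit s [:: Sep] s.

Lemma exec_det S W c s u1 s1 u2 s2 :
  exec S W c s u1 s1 -> exec S W c s u2 s2 -> u1 = u2 /\ s1 = s2.
Proof.
move=> E1; elim: E1 u2 s2 => {c s u1 s1};
  [ move=> s | move=> s a t1 t2 i v e1 e2 _
  | move=> r1 r2 r3 c1 c2 u1 u2 _ IH1 _ IH2
  | move=> s s' t c1 c2 v u e1 _ IH1
  | move=> s t c e1 | move=> r1 r2 r3 t c v u1 u2 e1 v0 _ IH1 _ IH2
  | move=> s t v e1 | move=> s ] => w r E; inversion E; subst => //;
  repeat match goal with
  | A : eval _ _ ?s ?t = Some _, B : eval _ _ ?s ?t = Some _ |- _ =>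
      rewrite A in B; case: B => B; subst
  | IH : (forall u s, exec _ _ ?c ?r u s -> _), A : exec _ _ ?c ?r _ _ |- _ =>
      case: (IH _ _ A) => ? ?; subst; clear A
  end => //.
Qed.

(* The segments of a trace delimited by its Sep events: k Sep events give k+1
   segments, the last one being what follows the last Sep. Each Sep is counted
   in the duration of the segment that it ends. *)
Fixpoint segments (u : trace) : seq trace :=
  match u with
  | [::] => [:: [::]]
  | Sep :: u' => [::] :: segments u'
  | ev :: u' =>
      if segments u' is r :: rs then (ev :: r) :: rs else [:: [:: ev]]
  end.

Definition written (u : trace) : seq nat :=
  pmap (fun ev => if ev is Out v then Some v else None) u.

Definition outputs (u : trace) : seq (seq nat) :=
  [seq written r | r <- take (size (segments u)).-1 (segments u)].

(* The last segment covers the time from the last output to termination, the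
   first one the time before the first output. *)
Definition delay (u : trace) : nat :=
  \max_(r <- segments u) (size r).+1.

(* Nothing is written after the last solution; each member of F is output
   exactly once, as a duplicate-free list of vertices in some order. *)
Definition enumerates (n : nat) (u : trace) (F : {set {set 'I_n}}) : Prop :=
  written (last [::] (segments u)) = [::] /\
  exists As : seq {set 'I_n}, [/\ uniq As, As =i F &
    all2 (fun o (A : {set 'I_n}) => perm_eq o [seq val x | x in A])
         (outputs u) As].

(* Bank 0, cell 0 holds n; bank 1 holds the adjacency matrix, row by row; every
   other cell is 0. *)
Definition input (n : nat) (e : rel 'I_n) : memory :=
  fun b i =>
    match b with
    | 0 => if i == 0 then n else 0
    | 1 => [exists x : 'I_n, exists y : 'I_n, (i == x * n + y) && e x y]
    | _ => 0
    end.

(* Main.v *)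
(** Domination can be checked at the irredundant vertices. In a P_7-free chordal
    graph they induce disjoint cliques, and a set A of redundant vertices is the
    trace of a minimal dominating set iff every x in A has an irredundant
    neighbour y whose clique lies in N[x] and whose only dominator in A is x.
    These facts rest on the following remark: in a chordal graph, a walk in which
    vertices at distance two along the walk are distinct and non-adjacent is an
    induced path, so here it has at most six vertices. The family is thus closed
    under subsets, and its lexicographic depth-first enumeration has linear
    delay: when two vertices b < a have just been removed from the current set,
    a can be added again.

    Redundancy itself is not decided in the O(n^2) preprocessing, since this
    amounts to comparing arbitrary subsets of an n-set. The preprocessing only
    finds, by maximum cardinality search, the simplicial vertices and the set L
    of their non-simplicial neighbours, which are redundant. For adjacent x and z
    outside L, comparing N(z) with N[x] on L is enough, up to comparing degrees.
    This takes one round of linear time for each q in L; as {q} belongs to the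
    family, every second round ends with the output of {q}, which the search
    skips later. *)

Require Import Defs.
From mathcomp Require Import all_boot zify.
Set Implicit Arguments.
Unset Strict Implicit.
Unset Printing Implicit Defensive.

(** * Locally induced walks, redundant vertices and minimal dominating sets *)

(** The degrees carry the test on L. If N[z] is not included in N[x] although |N[z]| <= |N[x]|, both
    differences are nonempty. Outside L such z and x have no simplicial neighbour, so a vertex that
    is simplicial inside N[z] only must have a neighbour outside N[z], and likewise for x: the edge
    zx grows at both ends into a forbidden walk.

    Independence is tested incrementally. A vertex adjacent to exactly one element of the current
    set is credited to that element if its clique lies in the neighbourhood of the element; the set
    is independent when all its elements have been credited. Adding or removing v thus costs O(deg
    v), and a sweep over all candidates O(n+m).

    Only every second singleton of L is output in advance, because the search later passes over
    these in silence: with all of them skipped, a long run of L could be explored without output,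
    whereas now the redundant vertex after a skipped one is never skipped.

    The delay is proved with credits: an output restores P units, and a potential bounds what is
    spent before the next one. *)

Section Chordal.
Variables (T : finType) (e : rel T).
Hypotheses (e_sym : symmetric e) (e_irr : irreflexive e) (e_ch : chordal e).

Local Notation N := (cnbhd e).

Lemma in_cnbhd x y : (y \in N x) = (y == x) || e x y.
Proof. by rewrite inE. Qed.

Lemma cnbhd_refl x : x \in N x.
Proof. by rewrite inE eqxx. Qed.

Lemma cnbhd_sym x y : (y \in N x) = (x \in N y).
Proof. by rewrite !inE eq_sym e_sym. Qed.

Lemma adj_cnbhd x y : e x y -> y \in N x.
Proof. by rewrite inE => ->; rewrite orbT. Qed.

(** By strong induction on [d]. An edge between [v i] and [v (i + d)] would close a cycle on
    [d + 1 >= 4] vertices, chordless because all shorter distances are settled. Equality would make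
    [v (i + d.-1)] a neighbour of [v i], against the induction hypothesis. *)
Lemma locally_induced_path k (v : nat -> T) :
  (forall i, i < k -> e (v i) (v i.+1)) ->
  (forall i, i.+2 <= k -> v i.+2 \notin N (v i)) ->
  forall d i, 2 <= d -> i + d <= k -> v (i + d) \notin N (v i).
Proof.
move=> v1 v2; elim/ltn_ind => d IH i d2 id_k.
have [d3|d3] := leqP 3 d; last first.
  have -> : d = 2 by lia.
  by rewrite addn2 v2 //; lia.
apply/negP; rewrite in_cnbhd => /orP[/eqP E|E].
  have /negP := IH d.-1 ltac:(lia) i ltac:(lia) ltac:(lia); apply.
  rewrite cnbhd_sym -E; apply: adj_cnbhd.
  have := v1 (i + d.-1) ltac:(lia).
  by have -> : (i + d.-1).+1 = i + d by lia.
have far a b : a + 2 <= b -> b <= d -> (a, b) != (0, d) ->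
    v (i + b) \notin N (v (i + a)).
  move=> ab bd nab; have := IH (b - a) _ (i + a).
  have -> : i + a + (b - a) = i + b by lia.
  apply; try lia; have [|]: a != 0 \/ b != d; [|lia|lia].
  by move: nab; rewrite xpair_eqE negb_and => /orP.
have adj a b : a < b -> b <= d ->
    e (v (i + a)) (v (i + b)) = (b == a.+1) || ((a == 0) && (b == d)).
  move=> ab bd; case: eqP => [->|nb] /=.
    by rewrite addnS v1 //; lia.
  case: eqP => [->|na]; case: eqP => [->|nb'] //=; rewrite ?addn0 //.
  - apply/negbTE/negP => /adj_cnbhd; apply/negP.
    by have := far 0 b; rewrite addn0; apply; rewrite ?xpair_eqE; lia.
  - apply/negbTE/negP => /adj_cnbhd; apply/negP.
    by apply: far; rewrite ?xpair_eqE; lia.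
  - apply/negbTE/negP => /adj_cnbhd; apply/negP.
    by apply: far; rewrite ?xpair_eqE; lia.
have neq a b : a < b -> b <= d -> v (i + a) != v (i + b).
  move=> ab bd; apply/eqP => Eab.
  have := adj a b ab bd; rewrite Eab e_irr => /esym/negbT.
  rewrite negb_or => /andP[n1 n2].
  have := far a b ltac:(lia) bd; rewrite Eab cnbhd_refl.
  by rewrite xpair_eqE n2 => /(_ isT).
case: (e_ch (k := d.+1) ltac:(lia)); exists (fun a => v (i + val a)); split.
  move=> a b Eab; apply: val_inj => /=.
  case: (ltngtP a b) => // ab; first have := neq _ _ ab.
    by rewrite Eab eqxx => H; have := H ltac:(have := ltn_ord b; lia).
  have := neq _ _ ab.
  by rewrite Eab eqxx => H; have := H ltac:(have := ltn_ord a; lia).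
have cyc (a b : 'I_d.+1) : a < b ->
    cycle_graph a b = (val b == a.+1) || ((val a == 0) && (val b == d)).
  move=> ab; rewrite /cycle_graph modn_small; last first.
    by have := ltn_ord b; lia.
  rewrite eq_sym; congr orb; have [bd|bd] := eqVneq (val b) d.
    by rewrite bd modnn andbT eq_sym.
  rewrite andbF modn_small; move: bd; have := ltn_ord b; rewrite /=; lia.
move=> a b; case: (ltngtP a b) => ab.
- by rewrite cyc // adj // -ltnS ltn_ord.
- have <- : cycle_graph b a = cycle_graph a b by rewrite /cycle_graph orbC.
  by rewrite e_sym cyc // adj // -ltnS ltn_ord.
- rewrite (val_inj ab) e_irr; apply/esym/negbTE.
  rewrite /cycle_graph orbb; have := ltn_ord b; rewrite ltnS leq_eqVlt.
  case/orP=> [/eqP bd|bd]; first by rewrite bd modnn; lia.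
  by rewrite modn_small; lia.
Qed.

Lemma no_local_path k (v : nat -> T) : path_free k.+1 e ->
  (forall i, i < k -> e (v i) (v i.+1)) ->
  (forall i, i.+2 <= k -> v i.+2 \notin N (v i)) -> False.
Proof.
move=> pk v1 v2; have far := locally_induced_path v1 v2.
have adj (i j : nat) : i < j -> j < k.+1 ->
    e (v i) (v j) = (i.+1 == j) /\ v i != v j.
  move=> ij jk; have [<-|nE] := eqVneq i.+1 j.
    rewrite v1; last lia; split=> //; apply: contraTneq (v1 i ltac:(lia)).
    by move=> ->; rewrite e_irr.
  have := far (j - i) i ltac:(lia) ltac:(lia); rewrite subnKC; last by lia.
  rewrite in_cnbhd negb_or eq_sym => /andP[vij /negbTE ->].
  by rewrite vij.
apply: pk; exists (fun i => v (val i)); split.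
  move=> i j Eij; apply: val_inj => /=; case: (ltngtP i j) => // ij.
    by have [_ /eqP[]] := adj _ _ ij (ltn_ord j).
  by have [_ /eqP[]] := adj _ _ ij (ltn_ord i).
move=> i j; rewrite /path_graph; case: (ltngtP i j) => ij.
- by have [-> _] := adj _ _ ij (ltn_ord j); rewrite (gtn_eqF (leqW ij)) orbF.
- have [E _] := adj _ _ ij (ltn_ord i); rewrite e_sym E.
  by rewrite (gtn_eqF (leqW ij)).
- by rewrite (val_inj ij) e_irr orbb gtn_eqF.
Qed.

Lemma no_local_P7 a b c d f g h : path_free 7 e ->
  e a b -> e b c -> e c d -> e d f -> e f g -> e g h ->
  c \notin N a -> d \notin N b -> f \notin N c -> g \notin N d ->
  h \notin N f -> False.
Proof.
move=> p7 ab bc cd df fg gh ac bd cf dg fh.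
apply: (@no_local_path 6 (nth a [:: a; b; c; d; f; g; h])) => //.
  by do 6 case=> //.
by do 5 case=> //.
Qed.

Definition simplicial (x : T) : bool :=
  [forall a, forall b, [&& e x a, e x b & a != b] ==> e a b].

Lemma simplicialP x :
  reflect (forall a b, e x a -> e x b -> a != b -> e a b) (simplicial x).
Proof.
apply: (iffP forallP) => [H a b xa xb ab|H a].
  by have /forallP/(_ b) := H a; rewrite xa xb ab.
by apply/forallP => b; apply/implyP => /and3P[]; apply: H.
Qed.

Definition near_simplicial : {set T} :=
  [set x | ~~ simplicial x && [exists y, e x y && simplicial y]].

Lemma near_simplicialI x y : e x y -> simplicial y -> ~~ simplicial x ->
  x \in near_simplicial.
Proof. by move=> xy sy nsx; rewrite inE nsx; apply/existsP; exists y; rewrite xy. Qed.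

Lemma simplicial_cnbhd s z : simplicial s -> e s z -> N s \subset N z.
Proof.
move=> /simplicialP ss sz; apply/subsetP => a; rewrite !in_cnbhd.
case/orP=> [/eqP ->|sa]; first by rewrite e_sym sz orbT.
by have [//|az] := eqVneq a z; apply: ss => //; rewrite eq_sym.
Qed.

(** * Maximum cardinality search, perfect elimination and far simplicial vertices *)

Section MaxCardinalitySearch.
Variable rank : T -> nat.
Hypothesis rank_inj : injective rank.
Hypothesis mcs : forall b c, rank b < rank c ->
  #|[set a | (rank a < rank b) && e c a]| <=
  #|[set a | (rank a < rank b) && e b a]|.

(** Smaller ranks are visited first. When [b] was preferred to [c], the visited neighbour [a] of [c]
    that [b] lacks had to be made up for by a visited neighbour of [b] that [c] lacks. *)
Lemma mcs_neighbour a b c : rank a < rank b -> rank b < rank c ->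
  e c a -> ~~ e b a -> exists d, [/\ rank d < rank b, e b d & ~~ e c d].
Proof.
move=> ab bc ca nba.
have /subsetPn[d] : ~~ ([set a | (rank a < rank b) && e b a] \subset
                        [set a | (rank a < rank b) && e c a]).
  apply/negP => sub; have := mcs bc; rewrite leqNgt => /negP; apply.
  apply: proper_card; rewrite properE sub; apply/subsetPn; exists a.
    by rewrite inE ab.
  by rewrite inE ab.
by rewrite !inE => /andP[db bd]; rewrite db => /= ncd; exists d.
Qed.

(** Induction on the larger rank of the two ends. With [v 0] the earlier end, [v r] was visited
    before [v 1] although only [v 1] sees [v 0]; this yields [d], visited before [v r], adjacent to
    [v r] and not to [v 1]. Cutting the path at its first vertex after [v 0] adjacent to [d] and
    going on to [d] gives a path of the same kind whose ends are both visited before [v r]. *)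
Lemma mcs_no_path r (v : nat -> T) : 2 <= r ->
  (forall i, i < r -> e (v i) (v i.+1)) ->
  (forall i, i.+2 <= r -> v i.+2 \notin N (v i)) ->
  (forall i, 0 < i < r -> maxn (rank (v 0)) (rank (v r)) < rank (v i)) ->
  False.
Proof.
have [m] := ubnP (maxn (rank (v 0)) (rank (v r))).
elim: m r v => // m IH r v.
wlog lt0r : v / rank (v 0) < rank (v r).
  move=> W bm r2 v1 v2 inner; case: (ltngtP (rank (v 0)) (rank (v r))) => H.
  - exact: (W v).
  - apply: (W (fun i => v (r - i))); rewrite ?subn0 ?subnn //.
    + by rewrite maxnC.
    + move=> i ir; rewrite e_sym; have := v1 (r - i.+1) ltac:(lia).
      by have -> : (r - i.+1).+1 = r - i by lia.
    + move=> i ir; rewrite cnbhd_sym; have := v2 (r - i.+2) ltac:(lia).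
      by have -> : (r - i.+2).+2 = r - i by lia.
    + by move=> i ir; rewrite maxnC inner //; lia.
  - have := locally_induced_path v1 v2 (i := 0) r2 (leqnn _).
    by rewrite add0n (rank_inj H) cnbhd_refl.
move=> bm r2 v1 v2 inner.
have v1r : rank (v r) < rank (v 1) by have := inner 1; lia.
have nr0 : ~~ e (v r) (v 0).
  have := locally_induced_path v1 v2 (i := 0) r2 (leqnn _).
  by rewrite add0n in_cnbhd e_sym => /norP[].
have [d [dr rd n1d]] := mcs_neighbour lt0r v1r
  ltac:(by rewrite e_sym v1 //; lia) nr0.
(* An edge between [v 0] and [d] is harmless: only vertices two steps apart have to be compared, and
   [i >= 2]. *)
have exi : exists i, (0 < i <= r) && e (v i) d.
  by exists r; rewrite rd andbT; lia.
case: (ex_minnP exi) => i /andP[i0r id] imin.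
have i1 : i != 1 by apply: contraNneq n1d => <-.
pose u j := if j <= i then v j else d.
have dv j : 0 < j < i -> d \notin N (v j).
  move=> ji; rewrite in_cnbhd negb_or; apply/andP; split.
    apply/eqP => E; have := inner j ltac:(lia); rewrite -E; lia.
  by apply/negP => ej; have := imin j; rewrite ej; lia.
have u1 j : j < i.+1 -> e (u j) (u j.+1).
  move=> ji; rewrite /u; have -> : j <= i by lia.
  case: ltnP => H; first by rewrite v1 //; lia.
  by have -> : j = i by lia.
have u2 j : j.+2 <= i.+1 -> u j.+2 \notin N (u j).
  move=> ji; rewrite /u; have -> : j <= i by lia.
  case: ltnP => H; first by rewrite v2 //; lia.
  by apply: dv; lia.
apply: (IH i.+1 u _ _ u1 u2); rewrite /u ?ltnn ?leq0n; try lia.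
move=> j ji; have -> : j <= i by lia.
have [jr|jr] := ltnP j r; first by have := inner j ltac:(lia); lia.
have -> : j = r by lia.
lia.
Qed.

Lemma mcs_elimination v a b : rank a < rank v -> rank b < rank v ->
  e v a -> e v b -> a != b -> e a b.
Proof.
move=> av bv va vb nab; apply/negPn/negP => eab.
apply: (@mcs_no_path 2 (fun i => nth a [:: a; v; b] i)) => //.
- by case=> [|[|i]] //=; rewrite e_sym.
- by case=> //= _; rewrite in_cnbhd eq_sym negb_or nab.
- by case=> [|[|i]] //= _; rewrite gtn_max av.
Qed.

Definition simplicial_in (U : {set T}) (s : T) : Prop :=
  forall a b, a \in U -> b \in U -> e s a -> e s b -> a != b -> e a b.

Lemma exists_simplicial_in (U : {set T}) x : x \in U ->
  exists2 s, s \in U & simplicial_in U s.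
Proof.
move=> xU; case: (arg_maxnP rank xU) => s sU smax; exists s => // a b aU bU.
have lt c : c \in U -> e s c -> rank c < rank s.
  move=> cU sc; rewrite ltn_neqAle [_ <= _]smax // andbT.
  by apply: contraTneq sc => /rank_inj ->; rewrite e_irr.
by move=> sa sb; apply: (@mcs_elimination s) => //; apply: lt.
Qed.

(* Induction on U, deleting a simplicial vertex s: if s misses N[x] it is the
   answer; if s is adjacent to x the induction hypothesis applies to U - s; if
   s = x one takes a simplicial vertex s' of U - x and, when s' is adjacent to
   x, applies the induction hypothesis to U - x and s'. *)
Lemma exists_far_simplicial_in (U : {set T}) x v :
  x \in U -> v \in U -> v \notin N x ->
  exists s, [/\ s \in U, s \notin N x & simplicial_in U s].
Proof.
have [m] := ubnP #|U|; elim: m U x v => // m IH U x v Um xU vU nvx.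
have vx : v != x by move: nvx; rewrite in_cnbhd => /norP[].
have nxv : ~~ e x v by move: nvx; rewrite in_cnbhd => /norP[].
have card y : y \in U -> #|U :\ y| < m.
  by move=> yU; move: Um; rewrite (cardsD1 y) yU; lia.
have [s sU simp_s] := exists_simplicial_in xU.
have [sx|nsx] := boolP (s \in N x); last by exists s.
have [Es|nsx] := eqVneq s x; last first.
  have exs : e x s by move: sx; rewrite in_cnbhd (negbTE nsx).
  have vs : v != s by apply: contraNneq nxv => ->.
  have [||||t [tU nt simp_t]] := IH (U :\ s) x v => //.
  - exact: card.
  - by rewrite !inE eq_sym nsx.
  - by rewrite !inE vU vs.
  move: tU; rewrite !inE => /andP[ts tU]; exists t; split=> //.
  have nts : ~~ e t s.
    apply/negP => ets; move: nt; rewrite in_cnbhd => /norP[tx /negP]; apply.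
    by apply: simp_s => //; rewrite 1?e_sym // eq_sym.
  move=> a b aU bU ta tb; apply: simp_t => //; rewrite !inE ?aU ?bU andbT.
    by apply: contraNneq nts => <-.
  by apply: contraNneq nts => <-.
rewrite {}Es in simp_s {sU sx}.
have vU' : v \in U :\ x by rewrite !inE vx.
have [s' s'U simp_s'] := exists_simplicial_in vU'.
move: (s'U); rewrite !inE => /andP[s'x s'U2].
have lift t : t \in U -> ~~ e t x -> simplicial_in (U :\ x) t ->
    simplicial_in U t.
  move=> tU ntx simp_t a b aU bU ta tb; apply: simp_t => //.
    by rewrite !inE aU andbT; apply: contraNneq ntx => <-.
  by rewrite !inE bU andbT; apply: contraNneq ntx => <-.
have [exs'|nxs'] := boolP (e x s'); last first.
  exists s'; split=> //; first by rewrite in_cnbhd negb_or s'x.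
  by apply: lift => //; rewrite e_sym.
have [/exists_inP[w wU nws']|univ] :=
    boolP [exists w in U :\ x, w \notin N s'].
  have [||||t [tU nt simp_t]] := IH (U :\ x) s' w => //.
    exact: card.
  move: tU; rewrite !inE => /andP[tx tU].
  have ntx : ~~ e x t.
    apply/negP => ext; move: nt; rewrite in_cnbhd => /norP[ts' /negP]; apply.
    by apply: simp_s => //; rewrite eq_sym.
  exists t; split=> //; first by rewrite in_cnbhd negb_or tx.
  by apply: lift => //; rewrite e_sym.
exists v; split=> //; apply: lift => //; first by rewrite e_sym.
have all_s' a : a \in U :\ x -> a = s' \/ e s' a.
  move=> aU; move: univ; rewrite negb_exists_in => /forall_inP/(_ a aU).
  by rewrite negbK in_cnbhd => /orP[/eqP|]; [left|right].
move=> a b aU bU va vb nab.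
case: (all_s' a aU) nab => [->|s'a] nab.
  by case: (all_s' b bU) nab => [->|//]; rewrite eqxx.
case: (all_s' b bU) nab => [->|s'b] nab; first by rewrite e_sym.
exact: simp_s'.
Qed.

(** Take for [b] a simplicial vertex of the subgraph induced on [N z], outside [N x]. If [N b]
    stayed inside [N z], then [b] would be simplicial in the whole graph, and [z] has no such
    neighbour. *)
Lemma exists_far_simplicial_nbr z x : x \in N z -> ~~ simplicial z ->
    (exists2 v, v \in N z & v \notin N x) ->
  (forall s, e z s -> ~~ simplicial s) ->
  exists b a, [/\ e z b, b \notin N x, e b a & a \notin N z].
Proof.
move=> xz nz [v vz nvx] zfar.
have [b [bz nbx simp_b]] := exists_far_simplicial_in xz vz nvx.
have bz' : b != z by apply: contraNneq nbx => ->; rewrite cnbhd_sym.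
have zb : e z b by move: bz; rewrite in_cnbhd (negbTE bz').
have /subsetPn[a ba naz] : ~~ (N b \subset N z).
  apply: contra (zfar b zb) => /subsetP sub; apply/simplicialP => c d bc bd.
  by apply: simp_b => //; apply: sub; apply: adj_cnbhd.
exists b, a; split=> //.
by move: ba; rewrite in_cnbhd; case: eqP => // E; move: naz; rewrite E bz.
Qed.

(* Otherwise there is a locally induced walk s a b z x c d, where s, a, b lie on
   the side of z and c, d on the side of x. *)
Lemma cnbhd_sub_of_near_simplicial x z : path_free 7 e -> e x z ->
  x \notin near_simplicial -> z \notin near_simplicial ->
  #|N z| <= #|N x| ->
  (forall q, q \in near_simplicial -> e q z -> q \in N x) ->
  N z \subset N x.
Proof.
move=> p7 xz nx nz card_le Q; apply/negPn/negP => nsub.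
have /subsetPn[b0 b0z nb0x] := nsub.
have sz : ~~ simplicial z.
  by apply: contra nsub => sz; apply: simplicial_cnbhd; rewrite // e_sym.
have zfar s : e z s -> ~~ simplicial s.
  by move=> zs; apply: contra nz => ss; apply: near_simplicialI zs _ _.
have sx : ~~ simplicial x by apply: zfar; rewrite e_sym.
have xfar s : e x s -> ~~ simplicial s.
  by move=> xs; apply: contra nx => ss; apply: near_simplicialI xs _ _.
(* Otherwise the cardinalities would force [N x] and [N z] to be equal. *)
have /subsetPn[c0 c0x nc0z] : ~~ (N x \subset N z).
  apply: contra nsub => sub; have /eqP -> // : N x == N z.
  by rewrite eqEcard sub.
have [c [d [xc ncz cd ndx]]] := exists_far_simplicial_nbr
  (adj_cnbhd xz) sx (ex_intro2 _ _ c0 c0x nc0z) xfar.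
have [b [a [zb nbx ba naz]]] := exists_far_simplicial_nbr
  (adj_cnbhd (etrans (e_sym z x) xz)) sz (ex_intro2 _ _ b0 b0z nb0x) zfar.
(* This is where the comparison on L enters: [b] is adjacent to [z] and misses [N x], so it is
   outside L and has no simplicial neighbour either. The argument can then be repeated from [b],
   where [a] only shows that [N b] leaves [N z]; the walk itself uses the new vertices [a'] and
   [s]. *)
have bQ : b \notin near_simplicial.
  by apply: contra nbx => bQ; apply: Q => //; rewrite e_sym.
have bfar s : e b s -> ~~ simplicial s.
  move=> bs; apply: contra bQ => ss; apply: near_simplicialI bs ss _.
  exact: zfar.
have [a' [s [ba' na'z a's nsb]]] := exists_far_simplicial_nbr
  (adj_cnbhd (etrans (e_sym b z) zb)) (zfar _ zb)
  (ex_intro2 _ _ a (adj_cnbhd ba) naz) bfar.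
apply: (@no_local_P7 s a' b z x c d) => //; rewrite 1?e_sym //.
- by rewrite cnbhd_sym.
- by rewrite cnbhd_sym.
- by rewrite cnbhd_sym.
Qed.

End MaxCardinalitySearch.

End Chordal.

(** * Irredundant vertices and inclusion of closed neighbourhoods *)

Section Irredundant.
Variables (n : nat) (e : rel 'I_n).
Hypotheses (e_sym : symmetric e) (e_irr : irreflexive e).

Local Notation N := (cnbhd e).
Local Notation irr := (irredundant e).

Lemma irredundant_min x y : irr x -> N y \subset N x -> N y = N x /\ x <= y.
Proof.
case/andP=> /minsetP[_ minx] /forallP lex sub.
have E : N y = N x by apply: minx; rewrite // imset_f.
by split=> //; move: (lex y); rewrite E eqxx.
Qed.

Lemma irredundant_inj x y : irr x -> irr y -> N y \subset N x -> y = x.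
Proof.
move=> ix iy sub; have [E le1] := irredundant_min ix sub.
have [|_ le2] := irredundant_min iy (_ : N x \subset N y); first by rewrite E.
by apply/val_inj/eqP; rewrite eqn_leq le1 le2.
Qed.

Lemma redundant_of_sub x y : N y \subset N x -> (N y != N x) || (y < x) ->
  ~~ irr x.
Proof.
move=> sub H; apply/negP => ix; have [E le] := irredundant_min ix sub.
by move: H; rewrite E eqxx ltnNge le.
Qed.

Lemma exists_irredundant v : exists2 w, irr w & N w \subset N v.
Proof.
have vF : N v \in [set N y | y : 'I_n] by rewrite imset_f.
have [A minA subA] := minset_exists (P := fun A => A \in [set N y | y : 'I_n]) vF.
have /imsetP[w0 _ Ew0] := minsetp minA.
have w0A : N w0 == A by rewrite Ew0.
case: (arg_minnP (P := fun w => N w == A) val w0A) => w /eqP Ew wmin.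
exists w; last by rewrite Ew.
rewrite /irredundant Ew minA; apply/forallP => y; apply/implyP => /wmin.
exact.
Qed.

Lemma in_RN x : (x \in RN e) = ~~ irr x.
Proof. by rewrite inE. Qed.

(** The neighbourhood of a simplicial neighbour [y] is included in [N x], strictly, since equality
    would make [x] simplicial too. *)
Lemma near_simplicial_RN x : x \in near_simplicial e -> ~~ irr x.
Proof.
rewrite inE => /andP[nsx /existsP[y /andP[xy sy]]].
have sub : N y \subset N x by apply: simplicial_cnbhd; rewrite 1?e_sym.
apply: redundant_of_sub (sub) _; apply/orP; left; apply: contra nsx => /eqP E.
move/simplicialP: sy => sy; apply/simplicialP => a b xa xb ab.
have N_adj c : e x c -> c = y \/ e y c.
  move/adj_cnbhd; rewrite -E in_cnbhd => /orP[/eqP|]; by [left|right].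
case: (N_adj a xa) ab => [->|ya] ab.
  by case: (N_adj b xb) ab => [->|//]; rewrite eqxx.
case: (N_adj b xb) ab => [->|yb] ab; first by rewrite e_sym.
exact: sy.
Qed.

(** * Cliques of irredundant vertices and traces of minimal dominating sets *)

Section Chordal.
Hypotheses (e_ch : chordal e) (p7 : path_free 7 e).

(** Provides two steps leading from [y1] away from [y2]. Pick [z1] in [N y1] outside [N y2] and an
    irredundant [w1] with [N w1] included in [N z1]. If [w1] is [z1] or lies in [N y1], it is the
    first step, and the minimality of [N y1] provides the second; otherwise the two steps are [z1]
    and [w1]. *)
Lemma irredundant_escape y1 y2 : irr y1 -> irr y2 -> e y1 y2 ->
  exists z w, [/\ e y1 z, z \notin N y2, e z w & w \notin N y1].
Proof.
move=> i1 i2 y12.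
have out z : irr z -> e y1 z -> exists2 w, e z w & w \notin N y1.
  move=> iz y1z; have /subsetPn[w wz nw] : ~~ (N z \subset N y1).
    by apply/negP => /(irredundant_inj i1 iz) E; move: y1z; rewrite E e_irr.
  exists w => //; move: wz; rewrite in_cnbhd; case: eqP => // E.
  by move: nw; rewrite E adj_cnbhd.
have /subsetPn[z1 z1y nz1] : ~~ (N y1 \subset N y2).
  by apply/negP => /(irredundant_inj i2 i1) E; move: y12; rewrite E e_irr.
have y1z1 : e y1 z1.
  move: z1y; rewrite in_cnbhd; case: eqP => // E.
  by move: nz1; rewrite E cnbhd_sym // adj_cnbhd.
have [w1 iw sub] := exists_irredundant z1.
have [E|nw1] := eqVneq w1 z1.
  by rewrite E in iw; have [w zw nw] := out _ iw y1z1; exists z1, w.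
have nyw : y2 \notin N w1.
  by apply: contra nz1 => /(subsetP sub); rewrite cnbhd_sym.
have [w1y|nwy] := boolP (w1 \in N y1).
  have y1w1 : e y1 w1.
    move: w1y; rewrite in_cnbhd; case: eqP => // E _.
    by move: nyw; rewrite E adj_cnbhd.
  have [w ww nw] := out _ iw y1w1; exists w1, w; split=> //.
  by rewrite cnbhd_sym.
exists z1, w1; split=> //.
by have := subsetP sub w1 (cnbhd_refl e w1); rewrite in_cnbhd (negbTE nw1).
Qed.

Definition component (y : 'I_n) : {set 'I_n} := [set z | irr z & z \in N y].

(** Otherwise the escapes of [y1] and of [y3] away from [y2] prolong the path [y1 y2 y3] at both
    ends into a locally induced walk on seven vertices. *)
Lemma irredundant_trans y1 y2 y3 : irr y1 -> irr y2 -> irr y3 ->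
  y1 \in N y2 -> y2 \in N y3 -> y1 \in N y3.
Proof.
move=> i1 i2 i3 H12 H23.
have [->//|n12] := eqVneq y1 y2; have [<-//|n23] := eqVneq y2 y3.
have y21 : e y2 y1 by move: H12; rewrite in_cnbhd (negbTE n12).
have y32 : e y3 y2 by move: H23; rewrite in_cnbhd (negbTE n23).
apply/negPn/negP => n13.
have [z [w [yz nz zw nw]]] := irredundant_escape i1 i2
  (etrans (e_sym y1 y2) y21).
have [z' [w' [yz' nz' zw' nw']]] := irredundant_escape i3 i2 y32.
apply: (@no_local_P7 _ e e_sym e_irr e_ch w z y1 y2 y3 z' w') => //;
  by rewrite 1?e_sym // 1?cnbhd_sym.
Qed.

Lemma component_eq y z : irr y -> z \in component y -> component z = component y.
Proof.
move=> iy; rewrite inE => /andP[iz zy]; apply/setP => w; rewrite !inE.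
rewrite -!in_cnbhd; have [iw|//] := boolP (irr w) => /=.
apply/idP/idP => [wz|wy]; first exact: irredundant_trans wz zy.
by apply: irredundant_trans wy _ => //; rewrite cnbhd_sym.
Qed.

Definition private_in (A : {set 'I_n}) (x y : 'I_n) : bool :=
  [&& irr y, component y \subset N x &
      [forall x' in A, (y \in N x') ==> (x' == x)]].

Definition independent (A : {set 'I_n}) : bool :=
  (A \subset RN e) && [forall x in A, exists y, private_in A x y].

Lemma dominatingP (D : {set 'I_n}) :
  reflect (forall v, exists2 d, d \in D & v \in N d)
          (cnbhds e D == [set: 'I_n]).
Proof.
apply: (iffP eqP) => [E v|H].
  by have := in_setT v; rewrite -E => /bigcupP[d]; exists d.
by apply/setP => v; rewrite inE; apply/bigcupP.
Qed.

(** A private vertex [v] may be replaced by an irredundant [w] with [N w] included in [N v], because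
    whatever dominates [w] dominates [v]. *)
Lemma minimal_dominating_private (D : {set 'I_n}) x : minimal_dominating e D -> x \in D ->
  exists2 y, irr y & forall d, d \in D -> (y \in N d) = (d == x).
Proof.
case/minsetP=> /dominatingP domD minD xD.
have : ~~ (cnbhds e (D :\ x) == [set: 'I_n]).
  apply/negP => /minD/(_ (subD1set D x))/setP/(_ x).
  by rewrite !inE eqxx xD.
rewrite eqEsubset subsetT => /subsetPn[v _ nv].
have [w iw sub] := exists_irredundant v; exists w => // d dD.
have far d' : d' \in D -> w \in N d' -> d' = x.
  move=> d'D wd'; apply/eqP; apply: contraNT nv => nd'.
  apply/bigcupP; exists d'; first by rewrite !inE nd'.
  by rewrite cnbhd_sym // (subsetP sub) // cnbhd_sym.
apply/idP/eqP => [|->]; first exact: far.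
by have [d' d'D wd'] := domD w; rewrite -(far _ d'D wd').
Qed.

Lemma minimal_dominatingI (D : {set 'I_n}) :
  (forall v, irr v -> exists2 d, d \in D & v \in N d) ->
  (forall x, x \in D -> exists v, forall d, d \in D -> v \in N d -> d = x) ->
  minimal_dominating e D.
Proof.
move=> domD priv; apply/minsetP; split.
  apply/dominatingP => v; have [w iw /subsetP sub] := exists_irredundant v.
  have [d dD wd] := domD w iw; exists d => //.
  by rewrite cnbhd_sym // sub // cnbhd_sym.
move=> B /dominatingP domB BD; apply/eqP; rewrite eqEsubset BD.
apply/subsetP => x xD; have [v pv] := priv x xD.
by have [b bB vb] := domB v; rewrite -(pv b) // (subsetP BD).
Qed.

(** Let [y1] be an irredundant private neighbour of [x]. If its clique is not inside [N x], some
    [y2] of the clique is dominated by another vertex [x2], which is redundant and gives a walk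
    [x y1 y2 x2 w2]. The witness is then an irredundant [w] with [N w] inside [N x]: a second
    redundant dominator [x'] of [w] would be adjacent to [x] and, with its own private neighbour
    [p'], prolong the walk to seven vertices. *)
Lemma independent_of_DRN (D : {set 'I_n}) : minimal_dominating e D ->
  independent (D :&: RN e).
Proof.
move=> mD; rewrite /independent subsetIr; apply/forall_inP => x.
rewrite in_setI in_RN => /andP[xD rx].
have [y1 i1 p1] := minimal_dominating_private mD xD.
have y1x : y1 \in N x by rewrite p1.
have xy1 : e x y1.
  by move: y1x; rewrite in_cnbhd; case: eqP => // E; move: rx; rewrite -E i1.
have [sub1|/subsetPn[y2]] := boolP (component y1 \subset N x).
  apply/existsP; exists y1; rewrite /private_in i1 sub1.
  apply/forall_inP => x'; rewrite in_setI => /andP[x'D _]; apply/implyP.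
  by rewrite p1.
rewrite inE => /andP[i2 y21] ny2.
have y12 : e y1 y2.
  by move: y21; rewrite in_cnbhd; case: eqP => // E; move: ny2; rewrite E y1x.
have [x2 x2D y2x2] : exists2 d, d \in D & y2 \in N d.
  by case/minsetP: mD => /dominatingP/(_ y2).
have nx2 : x2 != x by apply: contraNneq ny2 => <-.
have ny1 : y1 \notin N x2 by rewrite p1.
have rx2 : ~~ irr x2.
  apply: contra ny1 => ix2; apply: irredundant_trans (y2x2) => //.
  by rewrite cnbhd_sym.
have x2y2 : e x2 y2.
  by move: y2x2; rewrite in_cnbhd; case: eqP => // E; move: rx2; rewrite -E i2.
have [w2 iw2 sub2] := exists_irredundant x2.
have nw2 : y1 \notin N w2 by apply: contra ny1; apply: (subsetP sub2).
have x2w2 : e x2 w2.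
  have := subsetP sub2 _ (cnbhd_refl e w2); rewrite in_cnbhd.
  by case: eqP => // E; move: rx2; rewrite -E iw2.
have nw2y2 : w2 \notin N y2.
  apply: contra nw2 => w2y2; apply: (irredundant_trans i1 i2 iw2).
    by rewrite cnbhd_sym.
  by rewrite cnbhd_sym.
have [w iw sub] := exists_irredundant x.
apply/existsP; exists w; rewrite /private_in iw /=; apply/andP; split.
  by apply: subset_trans sub; apply/subsetP => z; rewrite !inE => /andP[].
apply/forall_inP => x'; rewrite in_setI in_RN => /andP[x'D rx'].
apply/implyP => wx'; apply/negPn/negP => nx'.
have x'x : e x' x.
  have : x' \in N x by rewrite (subsetP sub) // cnbhd_sym.
  by rewrite in_cnbhd (negbTE nx') e_sym.
have [p' ip' pp'] := minimal_dominating_private mD x'D.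
have p'x' : e p' x'.
  have : p' \in N x' by rewrite pp'.
  rewrite in_cnbhd e_sym; case: eqP => // E.
  by move: rx'; rewrite -E ip'.
apply: (@no_local_P7 _ e e_sym e_irr e_ch p' x' x y1 y2 x2 w2) => //.
- by rewrite e_sym.
- by rewrite cnbhd_sym // pp' // eq_sym.
- by rewrite p1.
- by rewrite cnbhd_sym.
Qed.

Definition leader (r : 'I_n) : bool := [forall y in component r, r <= y].

(** Complete [A] with the leader of each clique that [A] does not dominate entirely. The clique of a
    private neighbour is entirely dominated, receives no leader, and so the neighbour stays private;
    a leader has as private vertex an undominated vertex of its own clique. *)
Lemma DRN_of_independent (A : {set 'I_n}) : independent A -> A \in DRN e.
Proof.
case/andP=> /subsetP AR /forall_inP privA.
pose I := [set r | [&& irr r, leader r & ~~ (component r \subset cnbhds e A)]].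
have leader_uniq r r' : irr r -> irr r' -> leader r -> leader r' ->
    r' \in component r -> r' = r.
  move=> ir ir' /forall_inP lr /forall_inP lr' H; apply/val_inj/eqP.
  rewrite eqn_leq lr // lr' // (component_eq ir H).
  by rewrite inE ir cnbhd_refl.
have compI y r : irr y -> r \in I -> y \in N r ->
    ~~ (component y \subset cnbhds e A).
  move=> iy; rewrite inE => /and3P[ir _ nsub] yr.
  by rewrite (component_eq ir) // inE iy.
apply/imsetP; exists (A :|: I); last first.
  apply/setP => x; rewrite in_setI in_setU.
  have [xA|/=] := boolP (x \in A); first by rewrite AR.
  by rewrite in_RN inE; case: (irr x); rewrite ?andbF.
rewrite inE; apply: minimal_dominatingI => [v iv|x].
  have [/subsetP sub|nsub] := boolP (component v \subset cnbhds e A).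
    have /bigcupP[d dA vd] : v \in cnbhds e A by rewrite sub // inE iv cnbhd_refl.
    by exists d; rewrite // in_setU dA.
  have vC : v \in component v by rewrite inE iv cnbhd_refl.
  case: (arg_minnP val vC) => r rC rmin.
  have {}rC : r \in component v := rC.
  exists r; last by rewrite cnbhd_sym //; case/setIdP: rC.
  rewrite in_setU; apply/orP; right; rewrite inE.
  rewrite (component_eq iv rC) nsub andbT; move: (rC); rewrite inE => /andP[-> _].
  by apply/forall_inP => y; rewrite (component_eq iv rC); apply: rmin.
rewrite in_setU => /orP[xA|xI].
  have /existsP[y /and3P[iy ysub /forall_inP py]] := privA x xA.
  exists y => d; rewrite in_setU => /orP[dA yd|dI yd].
    by apply/eqP; have := py d dA; rewrite yd.
  have /subsetPn[z zC nz] := compI _ _ iy dI yd.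
  case/negP: nz; apply/bigcupP; exists x => //.
  exact: (subsetP ysub).
move: (xI); rewrite inE => /and3P[ix lx /subsetPn[u uC nu]].
exists u => d; rewrite in_setU => /orP[dA ud|dI ud].
  by case/negP: nu; apply/bigcupP; exists d.
move: (dI); rewrite inE => /and3P[id ld _].
apply: leader_uniq => //; rewrite -(component_eq ix uC); apply/setIdP; split=> //.
by rewrite cnbhd_sym.
Qed.

Lemma DRN_independent (A : {set 'I_n}) : (A \in DRN e) = independent A.
Proof.
apply/idP/idP; last exact: DRN_of_independent.
by case/imsetP=> D; rewrite inE => mD ->; apply: independent_of_DRN.
Qed.

End Chordal.

Lemma independent1 x : x \in RN e -> independent [set x].
Proof.
move=> xR; rewrite /independent sub1set xR; apply/forall_inP => _ /set1P ->.
have [y iy sub] := exists_irredundant x.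
apply/existsP; exists y; rewrite /private_in iy /=; apply/andP; split.
  by apply: subset_trans sub; apply/subsetP => z; rewrite !inE => /andP[].
by apply/forall_inP => _ /set1P ->; rewrite eqxx implybT.
Qed.

(** * The redundancy test on degrees, labels and L *)

Section RedundancyTest.
Hypotheses (e_ch : chordal e) (p7 : path_free 7 e).
Variable rank : 'I_n -> nat.
Hypothesis rank_inj : injective rank.
Hypothesis mcs : forall b c, rank b < rank c ->
  #|[set a | (rank a < rank b) && e c a]| <=
  #|[set a | (rank a < rank b) && e b a]|.

Lemma card_cnbhd x : #|N x| = #|[set y | e x y]|.+1.
Proof.
have -> : N x = x |: [set y | e x y] by apply/setP => y; rewrite !inE.
by rewrite cardsU1 inE e_irr.
Qed.

(** Since labels are below [n], [degree * n + label] compares pairs (degree, label)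
    lexicographically. A redundant [x] outside L is witnessed by an irredundant [z] with [N z]
    inside [N x]: it is outside L, and either has smaller degree or has the same neighbourhood and a
    smaller label. Conversely, the order on degrees is the cardinality hypothesis of
    [cnbhd_sub_of_near_simplicial]. *)
Lemma in_RN_test x : (x \in RN e) = (x \in near_simplicial e) ||
  [exists z, [&& e x z, z \notin near_simplicial e,
    ~~ [exists q in near_simplicial e, e q z && (x \notin N q)] &
    #|[set y | e z y]| * n + z < #|[set y | e x y]| * n + x]].
Proof.
rewrite in_RN; have [xQ|xQ] /= := boolP (x \in near_simplicial e).
  exact: near_simplicial_RN.
apply/idP/existsP => [rx|[z /and4P[xz zQ nq lt]]].
  have [z iz sub] := exists_irredundant x.
  have nzx : z != x by apply: contraNneq rx => <-.
  have xz : e x z.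
    by have := subsetP sub _ (cnbhd_refl e z); rewrite in_cnbhd (negbTE nzx).
  exists z; rewrite xz /=; apply/and3P; split.
  - by apply: contraL iz; apply: near_simplicial_RN.
  - apply/exists_inPn => q qQ; rewrite negb_and negbK; case: (boolP (e q z)) => //=.
    by rewrite e_sym => /adj_cnbhd/(subsetP sub); rewrite cnbhd_sym.
  - have [E|neq] := eqVneq (N z) (N x).
      have [|_ le] := irredundant_min iz (_ : N x \subset N z).
        by rewrite E.
      have /succn_inj -> : #|[set y | e z y]|.+1 = #|[set y | e x y]|.+1.
        by rewrite -!card_cnbhd E.
      by rewrite ltn_add2l ltn_neqAle nzx.
    have : #|N z| < #|N x| by rewrite proper_card // properEneq neq.
    rewrite !card_cnbhd ltnS => H.
    have := leq_mul H (leqnn n); rewrite mulSn => le.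
    apply: leq_trans (leq_addr x _); apply: leq_trans le.
    by rewrite addnC ltn_add2r ltn_ord.
have sub : N z \subset N x.
  apply: (cnbhd_sub_of_near_simplicial _ _ _ rank_inj mcs) => //.
    rewrite !card_cnbhd ltnS leqNgt; apply/negP => H.
    have := leq_mul H (leqnn n); rewrite mulSn => le.
    move: lt; apply/negP; rewrite -leqNgt; apply: leq_trans (leq_addr z _).
    by apply: leq_trans le; rewrite addnC leq_add2r ltnW.
  move=> q qQ qz; apply: contraR nq => nqx; apply/exists_inP; exists q => //.
  by rewrite qz cnbhd_sym.
apply: redundant_of_sub (sub) _; have [E|//] := eqVneq (N z) (N x).
have /succn_inj E' : #|[set y | e z y]|.+1 = #|[set y | e x y]|.+1.
  by rewrite -!card_cnbhd E.
by move: lt; rewrite E' ltn_add2l.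
Qed.

End RedundancyTest.

End Irredundant.

(** * Tick bounds for silent commands *)

Fixpoint den (s : memory) (t : expr) : nat :=
  match t with
  | Const k => k
  | Fetch a t1 => s a (den s t1)
  | Bin o t1 t2 => binop_eval o (den s t1) (den s t2)
  end.

(* Every constant cell index is at most 63, so that only the computed indices
   leave a bound to be proved. *)
Fixpoint safe (S : nat) (s : memory) (t : expr) : Prop :=
  match t with
  | Const k => k < 64
  | Fetch _ (Const k) => k < 64
  | Fetch a t1 => safe S s t1 /\ den s t1 < S
  | Bin _ t1 t2 => safe S s t1 /\ safe S s t2
  end.

(** An exponent: values are below [V ^ weight t] when all cells are below [V]. A constant is below
    64, which is at most [V ^ 2] as [V >= 8], and every binary operation stays below the product of
    the bounds of its operands. *)
Fixpoint weight (t : expr) : nat :=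
  match t with
  | Const _ => 2
  | Fetch _ t1 => weight t1
  | Bin _ t1 t2 => weight t1 + weight t2
  end.

Fixpoint light (c : cmd) : bool :=
  match c with
  | Skip | Emit => true
  | Store _ t1 t2 => (weight t1 <= 24) && (weight t2 <= 24)
  | Comp c1 c2 => light c1 && light c2
  | If t c1 c2 => [&& weight t <= 24, light c1 & light c2]
  | While t c => (weight t <= 24) && light c
  | Write t => weight t <= 24
  end.

(** Over-approximates the cells written: a store at a constant index counts for one cell, any other
    store for its whole bank. Frame conditions are thus discharged by computation. *)
Fixpoint touches (c : cmd) (b j : nat) : bool :=
  match c with
  | Store a (Const i) _ => (b == a) && (j == i)
  | Store a _ _ => b == a
  | Comp c1 c2 | If _ c1 c2 => touches c1 b j || touches c2 b j
  | While _ c => touches c b j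
  | _ => false
  end.

Definition agree (c : cmd) (s s' : memory) : Prop :=
  forall b j, ~~ touches c b j -> s' b j = s b j.

Lemma exec_agree S W c s u s' : exec S W c s u s' -> agree c s s'.
Proof.
elim=> {c s u s'} //.
- move=> s a t1 t2 i v e1 e2 _ b j /= H; rewrite /store.
  case: andP => // -[/eqP Eb /eqP Ej]; case/negP: H; rewrite Eb Ej eqxx.
  case: t1 e1 => //= k; rewrite /guard; case: ifP => // _ [->].
  by rewrite eqxx.
- move=> s1 s2 s3 c1 c2 u1 u2 _ A1 _ A2 b j /norP[n1 n2].
  by rewrite A2 ?A1.
- move=> s s' t c1 c2 v u _ _ A b j /norP[n1 n2]; apply: A.
  by case: (v != 0).
- move=> s1 s2 s3 t c v u1 u2 _ _ _ A1 _ A2 b j nt.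
  by rewrite A2 // A1.
Qed.

Lemma agree_trans c s1 s2 s3 : agree c s1 s2 -> agree c s2 s3 -> agree c s1 s3.
Proof. by move=> A1 A2 b j H; rewrite A2 ?A1. Qed.

Lemma agree_sub c c' s s' : (forall b j, touches c b j -> touches c' b j) ->
  agree c s s' -> agree c' s s'.
Proof. by move=> sub A b j H; apply: A; apply: contra H; apply: sub. Qed.

(** [V] bounds the contents of cells and [W] all intermediate values; 24 is the weight that [light]
    allows, and 64 the range of constant indices. *)
Definition machine (S W V : nat) : Prop :=
  [/\ 8 <= V, V ^ 24 <= W & 64 <= S].

Section Semantics.
Variables (S W V : nat).
Hypothesis M : machine S W V.

Lemma V8 : 8 <= V. Proof. by case: M. Qed.
Lemma VW : V ^ 24 <= W. Proof. by case: M. Qed.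
Lemma S64 : 64 <= S. Proof. by case: M. Qed.

Definition bounded (s : memory) : Prop := forall b j, s b j < V.

Lemma den_lt s t : bounded s -> safe S s t -> den s t < V ^ weight t.
Proof.
have := V8 => V8; have gt0 t' : 0 < weight t' by elim: t' => //= _ t1 ? t2 ?; lia.
have geV t' : V <= V ^ weight t'.
  by rewrite -{1}[V]expn1 leq_pexp2l //; lia.
move=> bs; elim: t => [k|a t1 IH|o t1 IH1 t2 IH2] /=.
- by move=> k64; rewrite -mulnn; apply: leq_trans k64 (leq_mul V8 V8).
- by move=> _; apply: leq_trans (bs _ _) (geV t1).
- case=> s1 s2; have := IH1 s1; have := IH2 s2.
  move: (geV t1) (geV t2); rewrite expnD.
  move: (V ^ weight t1) (V ^ weight t2) (den s t1) (den s t2) => p q x y.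
  move=> Vp Vq yq xp.
  have [p2 q2] : 2 <= p /\ 2 <= q by lia.
  have pq1 : p <= p * q by rewrite leq_pmulr //; lia.
  have pq2 : p + q <= p * q by nia.
  case: o => /=.
  + lia.
  + lia.
  + exact: ltn_mul.
  + by apply: leq_ltn_trans (leq_div _ _) _; lia.
  + by case: (x < y); lia.
  + by case: (x == y); lia.
Qed.

Lemma eval_den s t : bounded s -> safe S s t -> weight t <= 24 ->
  eval S W s t = Some (den s t).
Proof.
move: V8 S64 => V8 S64 bs; have lt t' : safe S s t' -> weight t' <= 24 -> den s t' < W.
  move=> st wt; apply: leq_trans VW; apply: leq_trans (den_lt bs st) _.
  by rewrite leq_pexp2l //; lia.
elim: t => [k|a t1 IH|o t1 IH1 t2 IH2] /=.
- by move=> kS wk; have := lt (Const k) kS wk; rewrite /guard /= => ->.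
- move=> st wt; have [st1 t1S] : safe S s t1 /\ den s t1 < S.
    by case: t1 st {IH wt} => //= k k64; split=> //; lia.
  rewrite IH //= t1S /guard.
  suff -> : s a (den s t1) < W by [].
  apply: leq_trans VW; apply: leq_trans (bs _ _) _.
  by rewrite -{1}[V]expn1 leq_pexp2l //; lia.
- move=> [s1 s2] wt; rewrite IH1 ?IH2 //=; try lia.
  by have := lt (Bin o t1 t2) (conj s1 s2) wt; rewrite /guard /= => ->.
Qed.

Definition wp (c : cmd) (s : memory) (k : nat) (Q : memory -> Prop) : Prop :=
  bounded s -> exists t s',
    [/\ exec S W c s (ticks t) s', t <= k, bounded s' & Q s'].

Lemma ticksD a b : ticks (a + b) = ticks a ++ ticks b.
Proof. by rewrite /ticks nseqD. Qed.

Lemma wp_mono c s k k' (Q Q' : memory -> Prop) :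
  k <= k' -> (forall s', agree c s s' -> bounded s' -> Q s' -> Q' s') ->
  wp c s k Q -> wp c s k' Q'.
Proof.
move=> kk' QQ' H bs; have [t [s' [E tk bs' Qs']]] := H bs.
exists t, s'; split=> //; first lia.
by apply: QQ' => //; apply: exec_agree E.
Qed.

Lemma wp_comp c1 c2 s k1 k2 k (Q : memory -> Prop) :
  wp c1 s k1 (fun s1 => wp c2 s1 k2 Q) -> k1 + k2 <= k ->
  wp (Comp c1 c2) s k Q.
Proof.
move=> H1 kk bs; have [t1 [s1 [E1 tk1 bs1 H2]]] := H1 bs.
have [t2 [s2 [E2 tk2 bs2 Qs2]]] := H2 bs1.
exists (t1 + t2), s2; split=> //; last lia.
by rewrite ticksD; apply: ExecComp E1 E2.
Qed.

Lemma wp_if t c1 c2 s k1 k (Q : memory -> Prop) :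
  weight t <= 24 -> safe S s t ->
  wp (if den s t != 0 then c1 else c2) s k1 Q -> (cost t).+1 + k1 <= k ->
  wp (If t c1 c2) s k Q.
Proof.
move=> wt st H kk bs; have [t1 [s1 [E1 tk1 bs1 Qs1]]] := H bs.
exists ((cost t).+1 + t1), s1; split=> //; last lia.
by rewrite ticksD; apply: ExecIf E1; apply: eval_den.
Qed.

(** Weakest precondition of loop-free silent code; loops and outputs have rules of their own, hence
    [False] here. *)
Fixpoint vc (c : cmd) (s : memory) (Q : memory -> Prop) : Prop :=
  match c with
  | Skip => Q s
  | Store a t1 t2 =>
      [/\ safe S s (Fetch a t1), safe S s t2, den s t2 < V &
          Q (store s a (den s t1) (den s t2))]
  | Comp c1 c2 => vc c1 s (fun s1 => vc c2 s1 Q)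
  | If t c1 c2 =>
      safe S s t /\ if den s t != 0 then vc c1 s Q else vc c2 s Q
  | _ => False
  end.

Fixpoint ccost (c : cmd) : nat :=
  match c with
  | Skip => 1
  | Store _ t1 t2 => (cost t1 + cost t2).+1
  | Comp c1 c2 => ccost c1 + ccost c2
  | If t c1 c2 => (cost t).+1 + maxn (ccost c1) (ccost c2)
  | _ => 0
  end.

Lemma wp_vc c s (Q : memory -> Prop) : light c -> vc c s Q -> wp c s (ccost c) Q.
Proof.
elim: c s Q => //= [|a t1 t2|c1 IH1 c2 IH2|t c1 IH1 c2 IH2] s Q.
- by move=> _ Qs bs; exists 1, s; split=> //; apply: ExecSkip.
- move=> /andP[w1 w2] [sf s2 d2 Qs] bs.
  have [s1 d1] : safe S s t1 /\ den s t1 < S.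
    by move: S64 => S64; case: t1 sf {Qs w1} => //= k k64; split=> //; lia.
  exists (cost t1 + cost t2).+1; eexists; split; last exact: Qs.
  + by apply: ExecStore; rewrite // eval_den.
  + by [].
  + by move=> b j; rewrite /store; case: ifP.
- move=> /andP[l1 l2] H; apply: wp_comp (leqnn _); apply: wp_mono (IH1 _ _ l1 H) => //.
  by move=> s' _ _; apply: IH2.
- move=> /and3P[wt l1 l2] [st H]; apply: (wp_if wt st _ (leqnn _)).
  case: ifP H => _ H.
    by apply: wp_mono (IH1 _ _ l1 H) => //; apply: leq_maxl.
  by apply: wp_mono (IH2 _ _ l2 H) => //; apply: leq_maxr.
Qed.

Lemma wp_vc_le c s k (Q : memory -> Prop) :
  light c -> ccost c <= k -> vc c s Q -> wp c s k Q.
Proof. by move=> lc ck H; apply: wp_mono (wp_vc lc H). Qed.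

End Semantics.

Notation sc k := (Fetch 0 (Const k)).
Notation set_sc k t := (Store 0 (Const k) t).

Definition For (v : nat) (b : expr) (body : cmd) : cmd :=
  Comp (set_sc v (Const 0))
    (While (Bin Lt (sc v) b) (Comp body (set_sc v (Bin Add (sc v) (Const 1))))).

Section ForLoop.
Variables (S W V : nat).
Hypothesis M : machine S W V.
Local Notation wp := (wp S W V).

(** The invariant after a round is stated on the memory whose counter has already been incremented.
    A round spends [cost b + 4] on the test and 6 on the increment; 13 also absorbs the 3 units of
    initialisation. *)
Lemma wp_for v b body N (I : nat -> memory -> Prop) (f : nat -> nat) s k
    (Q : memory -> Prop) :
  v < 64 -> weight b <= 22 -> ~~ touches body 0 v -> N < V ->
  (forall j s', j <= N -> agree (For v b body) s s' -> I j s' ->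
     s' 0 v = j -> safe S s' b /\ den s' b = N) ->
  I 0 (store s 0 v 0) ->
  (forall j s', j < N -> agree (For v b body) s s' -> bounded V s' ->
     s' 0 v = j -> I j s' ->
     wp body s' (f j) (fun s2 => I j.+1 (store s2 0 v j.+1))) ->
  (forall s', agree (For v b body) s s' -> s' 0 v = N -> I N s' -> Q s') ->
  \sum_(j < N) f j + (N.+1 * (cost b + 13)) <= k ->
  wp (For v b body) s k Q.
Proof.
move: (V8 M) (S64 M) => V8 S64 v64 wb nt NV Hb I0 Hbody HQ Hk bs.
pose t := Bin Lt (sc v) b.
pose inc := set_sc v (Bin Add (sc v) (Const 1)).
pose L := While t (Comp body inc).
have wt : weight t <= 24 by rewrite /t /=; lia.
have wi : weight (Bin Add (sc v) (Const 1)) <= 24 by [].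
have loop m : forall j s', j + m = N -> agree (For v b body) s s' ->
    bounded V s' -> s' 0 v = j -> I j s' ->
    exists k' s2, [/\ exec S W L s' (ticks k') s2,
      k' <= \sum_(j <= i < N) f i + (m.+1 * (cost b + 13) - 4),
      bounded V s2 & Q s2].
  elim: m => [|m IH] j s' jm ag bs' vj Ij.
    have [sb db] := Hb j s' ltac:(lia) ag Ij vj.
    exists (cost t).+1, s'; split=> //; last first.
    - by apply: HQ; rewrite // ?vj; have <- : j = N by lia.
    - by rewrite big_geq /t /=; lia.
    - apply: ExecWhileStop; rewrite (eval_den M bs') //=.
      by rewrite vj db; have -> : j < N = false by lia.
  have [sb db] := Hb j s' ltac:(lia) ag Ij vj.
  have [k1 [s1 [E1 k1f bs1 I1]]] := Hbody j s' ltac:(lia) ag bs' vj Ij bs'.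
  have ag1 := exec_agree E1.
  have v1 : s1 0 v = j by rewrite ag1.
  pose s2 := store s1 0 v j.+1.
  have E2 : exec S W inc s1 (ticks 6) s2.
    have -> : s2 = store s1 0 v (den s1 (Bin Add (sc v) (Const 1))).
      by rewrite /= v1 addn1.
    apply: ExecStore; first by rewrite (eval_den M).
      by rewrite (eval_den M).
    lia.
  have bs2 : bounded V s2.
    by move=> b' j'; rewrite /s2 /store; case: ifP => // _; lia.
  have ag2 : agree (For v b body) s s2.
    apply: agree_trans ag _; apply: agree_trans.
      by apply: agree_sub ag1 => b' j' /= ->; rewrite ?orbT.
    by apply: agree_sub (exec_agree E2) => b' j' /= ->; rewrite ?orbT.
  have v2 : s2 0 v = j.+1 by rewrite /s2 /store !eqxx.
  have [k3 [s3 [E3 k3f bs3 Q3]]] := IH j.+1 s2 ltac:(lia) ag2 bs2 v2 I1.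
  exists ((cost t).+1 + ((k1 + 6) + k3)), s3; split=> //.
    rewrite 2!ticksD [ticks (k1 + _)]ticksD.
    apply: ExecWhileStep (ExecComp E1 E2) E3.
      exact: (eval_den M bs').
    by rewrite /= vj db; have -> : j < N = true by lia.
  rewrite big_ltn; last lia.
  by rewrite /t /=; lia.
pose s0 := store s 0 v 0.
have E0 : exec S W (set_sc v (Const 0)) s (ticks 3) s0.
  by apply: ExecStore; rewrite ?(eval_den M) //=; lia.
have bs0 : bounded V s0 by move=> b' j'; rewrite /s0 /store; case: ifP => // _; lia.
have ag0 : agree (For v b body) s s0.
  by apply: agree_sub (exec_agree E0) => b' j' /= ->.
have v0 : s0 0 v = 0 by rewrite /s0 /store !eqxx.
have [k1 [s1 [E1 k1f bs1 Q1]]] := loop N 0 s0 (add0n _) ag0 bs0 v0 I0.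
exists (3 + k1), s1; split=> //.
  by rewrite ticksD; apply: ExecComp E0 E1.
by move: k1f Hk; rewrite big_mkord; lia.
Qed.

End ForLoop.

(** * Time credits between outputs *)

Definition not_sep (ev : event) : bool := if ev is Sep then false else true.

Lemma segments_cons u : exists r rs, segments u = r :: rs.
Proof.
by case: u => [|[|v|] u] /=; do ?[by exists [::], [::]];
  [case: (segments u) | case: (segments u) | exists [::], (segments u)];
  do 2?eexists.
Qed.

Lemma segments_cat u1 u2 A a b B : segments u1 = rcons A a ->
  segments u2 = b :: B -> segments (u1 ++ u2) = A ++ (a ++ b) :: B.
Proof.
move=> E1 E2; elim: u1 A a E1 => [|ev u1 IH] A a /=.
  by case: A => [|x [|y A]] //= [<-].
have [r [rs Er]] := segments_cons u1.
case/lastP: rs Er => [|rs' l] Er.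
  have E := IH [::] r Er; case: ev => [|v|]; rewrite E Er.
  - by case: A => [|x [|y A]] //= [<-].
  - by case: A => [|x [|y A]] //= [<-].
  - by case: A => [|x [|y [|z A]]] //= [<- <-].
have E := IH (r :: rs') l Er; case: ev => [|v|]; rewrite E Er /=.
- case: A => [|x A] /= [<-]; first by case: (rs').
  by move/rcons_inj=> [<- <-].
- case: A => [|x A] /= [<-]; first by case: (rs').
  by move/rcons_inj=> [<- <-].
- case: A => [|x A] /= [<-]; first by case: (rs').
  by rewrite -rcons_cons => /rcons_inj[<- <-].
Qed.

Lemma segments_not_sep w : all not_sep w -> segments w = [:: w].
Proof. by elim: w => //= -[|v|] w IH //= /IH ->. Qed.

Lemma written_cat u v : written (u ++ v) = written u ++ written v.
Proof. exact: pmap_cat. Qed.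

Lemma written_ticks k : written (ticks k) = [::].
Proof. by elim: k. Qed.

Section Credit.
Variable P : nat.

(* [gk p os u r]: starting with p units left in the current segment, the trace
   u outputs os without ever letting a segment run out of its P units, and
   leaves r units. *)
Inductive gk : nat -> seq (seq nat) -> trace -> nat -> Prop :=
  | gk_ticks p k r : k + r <= p -> gk p [::] (ticks k) r
  | gk_out p w : size w < p -> all not_sep w ->
      gk p [:: written w] (rcons w Sep) P
  | gk_cat p q r o1 o2 u1 u2 : gk p o1 u1 q -> gk q o2 u2 r ->
      gk p (o1 ++ o2) (u1 ++ u2) r.

Lemma gk_strengthen p p' r os u : p <= p' -> gk p os u r -> gk p' os u r.
Proof. by move=> pp; apply: (@gk_cat p' p r [::] os [::] u); apply: (@gk_ticks p' 0). Qed.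

Lemma gk_silent p k os u r : gk p os u r -> gk (k + p) os (ticks k ++ u) r.
Proof. by move=> H; apply: (@gk_cat _ p _ [::]) H; apply: gk_ticks. Qed.

(** The first segment has to live on the inherited [p] units, the following ones start with [P]. *)
Definition short (p : nat) (A : seq trace) : bool :=
  if A is a :: B then (size a < p) && all (fun b => size b < P) B else true.

Lemma gk_segments p os u r : gk p os u r -> exists A a,
  [/\ segments u = rcons A a, [seq written b | b <- A] = os, written a = [::],
      short p A & size a + r <= (if A is [::] then p else P)].
Proof.
elim=> {p os u r} [p k r kr|p w wp nw|p q r o1 o2 u1 u2 _ [A [a H1]] _ [B [b H2]]].
- exists [::], (ticks k); rewrite segments_not_sep /ticks ?all_nseq ?orbT //.
  by split=> //; [apply: written_ticks|rewrite size_nseq].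
- exists [:: w], [::]; rewrite -cats1.
  have := @segments_cat w [:: Sep] [::] w [::] [:: [::]] (segments_not_sep nw).
  by move=> /(_ erefl) ->; rewrite cats0; split=> //=; rewrite andbT.
case: H1 => E1 W1 wa S1 z1; case: H2 => E2 W2 wb S2 z2.
case: B E2 W2 S2 z2 => [|b0 B] E2 W2 S2 z2.
  exists A, (a ++ b); rewrite (segments_cat E1 E2) cats1 written_cat wa wb.
  split=> //; first by rewrite W1 -W2 cats0.
  by rewrite size_cat; case: (A) z1 => [|? ?]; lia.
exists (A ++ (a ++ b0) :: B), b; rewrite (segments_cat E1 E2) rcons_cat.
split=> //.
- by rewrite map_cat W1 -W2 /= written_cat wa.
- case: A {E1 W1} S1 z1 S2 => [|a0 A] /=.
    by rewrite size_cat => _ z1 /andP[b0q ->]; rewrite andbT; lia.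
  move=> /andP[-> sA] z1 /andP[b0q sB]; rewrite all_cat sA /= sB size_cat andbT.
  by rewrite /=; lia.
- by case: (A).
Qed.

Lemma gk_outputs os u r : gk P os u r ->
  [/\ outputs u = os, written (last [::] (segments u)) = [::] &
      delay u <= P.+1].
Proof.
case/gk_segments=> A [a [E W wa sA sa]]; split.
- by rewrite /outputs E size_rcons -cats1 take_size_cat.
- by rewrite E last_rcons.
have max_le (C : seq trace) : all (fun b => size b <= P) C ->
    \max_(b <- C) (size b).+1 <= P.+1.
  elim: C => [|b C IH] /=; first by rewrite big_nil.
  by rewrite big_cons geq_max => /andP[bP /IH ->]; rewrite ltnS bP.
rewrite /delay E; apply: max_le; rewrite all_rcons; apply/andP; split.
  by case: A {E W} sA sa => [|? ?]; lia.
case: A sA {E W sa} => //= b0 B /andP[/ltnW -> HB] /=.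
by apply: sub_all HB => b; apply: ltnW.
Qed.

Section Hoare.
Variables (S W V : nat).
Hypothesis M : machine S W V.
Local Notation wp := (wp S W V).

(** Unlike in [wp], the cost is not a bound fixed beforehand: an output restores the credit, so the
    postcondition receives what is left. *)
Definition wpg (c : cmd) (s : memory) (p : nat)
    (G : seq (seq nat) -> memory -> nat -> Prop) : Prop :=
  bounded V s -> exists u s' os r,
    [/\ exec S W c s u s', gk p os u r, bounded V s' & G os s' r].

Lemma wpg_wp c s k p (Q : memory -> Prop) G : wp c s k Q -> k <= p ->
  (forall s', agree c s s' -> Q s' -> G [::] s' (p - k)) -> wpg c s p G.
Proof.
move=> H kp QG bs; have [t [s' [E tk bs' Qs]]] := H bs.
exists (ticks t), s', [::], (p - k); split=> //; first by apply: gk_ticks; lia.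
by apply: QG => //; apply: exec_agree E.
Qed.

Lemma wpg_comp c1 c2 s p G :
  wpg c1 s p (fun o1 s1 q =>
    wpg c2 s1 q (fun o2 s2 r => G (o1 ++ o2) s2 r)) ->
  wpg (Comp c1 c2) s p G.
Proof.
move=> H bs; have [u1 [s1 [o1 [q [E1 g1 b1 H1]]]]] := H bs.
have [u2 [s2 [o2 [r [E2 g2 b2 H2]]]]] := H1 b1.
exists (u1 ++ u2), s2, (o1 ++ o2), r; split=> //; first exact: ExecComp E1 E2.
exact: gk_cat g1 g2.
Qed.

Lemma wpg_if t c1 c2 s p G : weight t <= 24 -> safe S s t -> (cost t).+1 <= p ->
  wpg (if den s t != 0 then c1 else c2) s (p - (cost t).+1) G ->
  wpg (If t c1 c2) s p G.
Proof.
move=> wt st tp H bs; have [u [s' [os [r [E g b' Gs]]]]] := H bs.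
exists (ticks (cost t).+1 ++ u), s', os, r; split=> //.
  by apply: ExecIf E; apply: (eval_den M).
by have := gk_silent (cost t).+1 g; rewrite subnKC.
Qed.

Lemma wpg_write t s p (G : seq (seq nat) -> memory -> nat -> Prop) :
  weight t <= 24 -> safe S s t -> (cost t).+1 < p ->
  G [:: [:: den s t]] s P -> wpg (Comp (Write t) Emit) s p G.
Proof.
move=> wt st tp Gs bs.
exists ((ticks (cost t) ++ [:: Out (den s t)]) ++ [:: Sep]), s.
exists [:: [:: den s t]], P; split=> //.
  by apply: ExecComp (ExecEmit _ _ _); apply: ExecWrite; apply: (eval_den M).
have -> : [:: den s t] = written (ticks (cost t) ++ [:: Out (den s t)]).
  by rewrite written_cat written_ticks.
rewrite [_ ++ [:: Sep]]cats1.
apply: gk_out; first by rewrite size_cat size_nseq /=; lia.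
by rewrite all_cat all_nseq orbT.
Qed.

(** [phi j] is the credit demanded at the test before round [j]. A potential replaces the sum of
    costs because a round with an output may end richer than it began. The test and the increment
    cost 6 units each. *)
Lemma wpg_for_n v body N (phi : nat -> nat)
    (I : nat -> seq (seq nat) -> memory -> Prop) s p
    (G : seq (seq nat) -> memory -> nat -> Prop) :
  v < 64 -> ~~ touches body 0 v -> ~~ touches (For v (sc 0) body) 0 0 ->
  N < V -> s 0 0 = N -> phi 0 + 3 <= p ->
  I 0 [::] (store s 0 v 0) ->
  (forall j os s', j < N -> agree (For v (sc 0) body) s s' ->
     s' 0 v = j -> I j os s' -> 6 <= phi j /\
     wpg body s' (phi j - 6) (fun os' s2 r => phi j.+1 + 6 <= r /\
       I j.+1 (os ++ os') (store s2 0 v j.+1))) ->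
  (forall os s', agree (For v (sc 0) body) s s' -> I N os s' ->
     6 <= phi N /\ G os s' (phi N - 6)) ->
  wpg (For v (sc 0) body) s p G.
Proof.
move: (V8 M) (S64 M) => V8 S64 v64 nt nt0 NV s0 pp I0 Hb HG bs.
pose t := Bin Lt (sc v) (sc 0).
pose inc := set_sc v (Bin Add (sc v) (Const 1)).
pose L := While t (Comp body inc).
have loop m : forall j os s', j + m = N -> agree (For v (sc 0) body) s s' ->
    bounded V s' -> s' 0 v = j -> I j os s' ->
    exists u s2 os' r, [/\ exec S W L s' u s2, gk (phi j) os' u r,
      bounded V s2 & G (os ++ os') s2 r].
  elim: m => [|m IH] j os s' jm ag bs' vj Ij.
    have jN : j = N by lia.
    rewrite jN in vj Ij *; have [p6 Gs] := HG os s' ag Ij.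
    exists (ticks 6), s', [::], (phi N - 6); split=> //.
    - apply: ExecWhileStop; rewrite (eval_den M bs') //=.
      by rewrite vj ag // s0 ltnn.
    - by apply: gk_ticks; lia.
    - by rewrite cats0.
  have jN : j < N by lia.
  have [p6 Hw] := Hb j os s' jN ag vj Ij.
  have [u1 [s1 [os1 [r1 [E1 g1 bs1 [pr I1]]]]]] := Hw bs'.
  have ag1 := exec_agree E1.
  have v1 : s1 0 v = j by rewrite ag1.
  pose s2 := store s1 0 v j.+1.
  have E2 : exec S W inc s1 (ticks 6) s2.
    have -> : s2 = store s1 0 v (den s1 (Bin Add (sc v) (Const 1))).
      by rewrite /= v1 addn1.
    apply: ExecStore; first by rewrite (eval_den M).
      by rewrite (eval_den M).
    lia.
  have bs2 : bounded V s2.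
    by move=> b' j'; rewrite /s2 /store; case: ifP => // _; lia.
  have ag2 : agree (For v (sc 0) body) s s2.
    apply: agree_trans ag _; apply: agree_trans.
      by apply: agree_sub ag1 => b' j' /= ->; rewrite ?orbT.
    by apply: agree_sub (exec_agree E2) => b' j' /= ->; rewrite ?orbT.
  have v2 : s2 0 v = j.+1 by rewrite /s2 /store !eqxx.
  have [u3 [s3 [os3 [r3 [E3 g3 bs3 G3]]]]] :=
    IH j.+1 (os ++ os1) s2 ltac:(lia) ag2 bs2 v2 I1.
  exists (ticks 6 ++ (u1 ++ ticks 6) ++ u3), s3, (os1 ++ os3), r3; split=> //.
  - apply: ExecWhileStep (ExecComp E1 E2) E3.
      by rewrite (eval_den M bs').
    by rewrite /= vj ag // s0 jN.
  - rewrite -{1}[phi j](subnKC p6); apply: gk_silent.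
    apply: gk_cat g3; rewrite -[os1]cats0.
    by apply: gk_cat g1 _; apply: gk_ticks; lia.
  - by rewrite catA.
pose s1 := store s 0 v 0.
have E0 : exec S W (set_sc v (Const 0)) s (ticks 3) s1.
  by apply: ExecStore; rewrite ?(eval_den M) //=; lia.
have bs1 : bounded V s1.
  by move=> b' j'; rewrite /s1 /store; case: ifP => // _; lia.
have ag0 : agree (For v (sc 0) body) s s1.
  by apply: agree_sub (exec_agree E0) => b' j' /= ->.
have v0 : s1 0 v = 0 by rewrite /s1 /store !eqxx.
have [u1 [s2 [os1 [r1 [E1 g1 bs2 G1]]]]] :=
  loop N 0 [::] s1 (add0n _) ag0 bs1 v0 I0.
exists (ticks 3 ++ u1), s2, os1, r1; split=> //; first exact: ExecComp E0 E1.
by apply: gk_strengthen (gk_silent 3 g1); lia.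
Qed.

End Hoare.
End Credit.

(** * Silent passes of the program *)

Definition idx (a b : expr) : expr := Bin Add (Bin Mul a (sc 0)) b.

(* Banks: 0 scalars, 1 adjacency matrix, 2 adjacency lists, 3 degrees, 4 numbers
   of visited neighbours, 5 visit times, 6 simplicial vertices, 7 vertices of l1,
   8 pairs (z, x) with N(z) not included in N[x] on l1, 9 singletons output
   before the search, 10 redundant vertices, 11 and 12 leader and size of the
   component of an irredundant vertex, 13 scratch, 14 the relation ok, 15 and 16
   the functions cov and own of the stack, 17 numbers of private neighbours,
   18 the stack.
   Scalars: 0 n, 1 current vertex, 3 position in its list, 10 its neighbour at
   that position, 13 parity, 15 height of the stack, 16 number of vertices with a
   private neighbour, 17 end of the search; the others are local. *)
Definition build_lists : cmd :=
  For 1 (sc 0) (For 2 (sc 0)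
    (If (Fetch 1 (idx (sc 1) (sc 2)))
       (Comp (Store 2 (idx (sc 1) (Fetch 3 (sc 1))) (sc 2))
             (Store 3 (sc 1) (Bin Add (Fetch 3 (sc 1)) (Const 1))))
       Skip)).

(** Scalar 4 is the best unvisited vertex met so far and scalar 5 its number of visited neighbours
    plus one, with 0 for no candidate yet. Visit times are also shifted by one, so that 0 marks an
    unvisited vertex. *)
Definition visit_order : cmd :=
  For 3 (sc 0)
    (Comp (Comp (set_sc 4 (Const 0)) (set_sc 5 (Const 0)))
    (Comp (For 1 (sc 0)
      (If (Bin Mul (Bin Eq (Fetch 5 (sc 1)) (Const 0))
                   (Bin Lt (sc 5) (Bin Add (Fetch 4 (sc 1)) (Const 1))))
         (Comp (set_sc 4 (sc 1))
               (set_sc 5 (Bin Add (Fetch 4 (sc 1)) (Const 1))))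
         Skip))
    (Comp (Store 5 (sc 4) (Bin Add (sc 3) (Const 1)))
      (For 2 (sc 0) (Store 4 (sc 2)
        (Bin Add (Fetch 4 (sc 2)) (Fetch 1 (idx (sc 4) (sc 2))))))))).

Definition any (r v : nat) (b cond : expr) : cmd :=
  Comp (set_sc r (Const 0)) (For v b (If cond (set_sc r (Const 1)) Skip)).

(** Scalar 6 becomes the vertex f of N[x] visited last. The neighbours of f visited before f form a
    clique, so x is simplicial as soon as f is adjacent to all other neighbours of x. This takes
    O(n) time per vertex, where comparing all pairs of neighbours would not. *)
Definition simplicial_pass : cmd :=
  For 1 (sc 0)
    (Comp (set_sc 6 (sc 1))
    (Comp (For 2 (sc 0)
      (If (Bin Mul (Fetch 1 (idx (sc 1) (sc 2)))
                   (Bin Lt (Fetch 5 (sc 6)) (Fetch 5 (sc 2))))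
         (set_sc 6 (sc 2)) Skip))
    (Comp (any 7 2 (sc 0) (Bin Mul (Fetch 1 (idx (sc 1) (sc 2)))
      (Bin Mul (Bin Eq (Bin Eq (sc 6) (sc 2)) (Const 0))
               (Bin Eq (Fetch 1 (idx (sc 6) (sc 2))) (Const 0)))))
      (Store 6 (sc 1) (Bin Eq (sc 7) (Const 0)))))).

Definition near_simplicial_pass : cmd :=
  For 1 (sc 0)
    (Comp (any 7 2 (sc 0)
            (Bin Mul (Fetch 1 (idx (sc 1) (sc 2))) (Fetch 6 (sc 2))))
       (Store 7 (sc 1) (Bin Mul (sc 7) (Bin Eq (Fetch 6 (sc 1)) (Const 0))))).

Definition neighbour : cmd := set_sc 10 (Fetch 2 (idx (sc 1) (sc 3))).

Definition redundant_pass : cmd :=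
  For 1 (sc 0)
    (Comp (set_sc 7 (Fetch 7 (sc 1)))
    (Comp (For 3 (Fetch 3 (sc 1)) (Comp neighbour
      (If (Bin Mul (Bin Eq (Fetch 7 (sc 10)) (Const 0))
          (Bin Mul (Bin Eq (Fetch 8 (idx (sc 10) (sc 1))) (Const 0))
                   (Bin Lt (idx (Fetch 3 (sc 10)) (sc 10))
                           (idx (Fetch 3 (sc 1)) (sc 1)))))
         (set_sc 7 (Const 1)) Skip)))
      (Store 10 (sc 1) (sc 7)))).

Definition leader_pass : cmd :=
  For 1 (sc 0)
    (Comp (Comp (set_sc 6 (sc 1)) (set_sc 7 (Const 1)))
    (Comp (For 3 (Fetch 3 (sc 1)) (Comp neighbour
      (If (Bin Eq (Fetch 10 (sc 10)) (Const 0))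
         (Comp (set_sc 7 (Bin Add (sc 7) (Const 1)))
               (If (Bin Lt (sc 10) (sc 6)) (set_sc 6 (sc 10)) Skip))
         Skip)))
      (Comp (Store 11 (sc 1) (sc 6)) (Store 12 (sc 1) (sc 7))))).

Definition irr_bit : expr := Bin Defs.Sub (Const 1) (Fetch 10 (sc 10)).

Definition count_leaders : cmd :=
  For 3 (Fetch 3 (sc 1)) (Comp neighbour
    (Store 13 (Fetch 11 (sc 10))
       (Bin Add (Fetch 13 (Fetch 11 (sc 10))) irr_bit))).

Definition store_ok : cmd :=
  For 3 (Fetch 3 (sc 1)) (Comp neighbour
    (Store 14 (idx (sc 1) (sc 10))
       (Bin Mul (Bin Eq (Fetch 13 (Fetch 11 (sc 10))) (Fetch 12 (sc 10)))
                irr_bit))).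

(** Clears only the counters that this vertex may have used, so that a round of [ok_pass] takes time
    proportional to the degree and not to [n]. *)
Definition reset_leaders : cmd :=
  For 3 (Fetch 3 (sc 1)) (Comp neighbour
    (Store 13 (Fetch 11 (sc 10)) (Const 0))).

Definition ok_pass : cmd :=
  For 1 (sc 0) (Comp count_leaders (Comp store_ok reset_leaders)).

Section Program.
Variables (n : nat) (g : nat -> nat -> bool) (S W V : nat).
Hypothesis g_sym : symmetric g.
Hypothesis M : machine S W V.
Hypothesis D : n * n <= S /\ (n + 2) * (n + 2) <= V.

Lemma nS : n * n <= S. Proof. by case: D. Qed.
Lemma nV : (n + 2) * (n + 2) <= V. Proof. by case: D. Qed.

Local Notation wp := (wp S W V).

Definition nb (x : nat) : seq nat := [seq y <- iota 0 n | g x y].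

Lemma mem_nb x y : (y \in nb x) = (y < n) && g x y.
Proof. by rewrite mem_filter mem_iota andbC. Qed.

Lemma size_nb x : size (nb x) <= n.
Proof. by rewrite size_filter (leq_trans (count_size _ _)) // size_iota. Qed.

Lemma idx_lt x y : x < n -> y < n -> x * n + y < n * n.
Proof. by move=> xn yn; have := leq_mul xn (leqnn n); rewrite mulSn; lia. Qed.

Lemma idx_S x y : x < n -> y < n -> x * n + y < S.
Proof. by move=> xn yn; apply: leq_trans (idx_lt xn yn) nS. Qed.

Lemma lt_S x : x < n -> x < S.
Proof.
move=> xn; apply: leq_ltn_trans (idx_S xn xn).
by rewrite -{1}[x]addn0 leq_add // leq_pmulr //; lia.
Qed.

Lemma idx_inj x y x' y' : y < n -> y' < n ->
  (x * n + y == x' * n + y') = (x == x') && (y == y').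
Proof.
move=> yn y'n; apply/eqP/andP => [E|[/eqP -> /eqP ->] //].
have n0 : 0 < n by lia.
have Ex : x = x'.
  by have := congr1 (divn^~ n) E; rewrite !divnMDl // !divn_small // !addn0.
by split; apply/eqP => //; move: E; rewrite Ex; lia.
Qed.

Definition lists_ok (s : memory) : Prop :=
  forall x, x < n -> s 3 x = size (nb x) /\
    forall k, k < size (nb x) -> s 2 (x * n + k) = nth 0 (nb x) k.

Lemma nV1 : n < V.
Proof. by apply: leq_trans nV; rewrite mulnDl; lia. Qed.

Lemma iota0S j : iota 0 j.+1 = rcons (iota 0 j) j.
Proof. by rewrite -addn1 iotaD cats1. Qed.

Lemma wp_seq c s k (Q : memory -> Prop) :
  light c -> ccost c <= k -> vc S V c s Q -> wp c s k Q.
Proof. exact: (wp_vc_le M). Qed.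

Lemma wp_then k1 k2 c1 c2 s k (Q : memory -> Prop) : k1 + k2 <= k ->
  wp c1 s k1 (fun s1 => wp c2 s1 k2 Q) -> wp (Comp c1 c2) s k Q.
Proof. by move=> kk H; exact: (wp_comp H kk). Qed.

Lemma wp_for_n v body c (I : nat -> memory -> Prop) s k (Q : memory -> Prop) :
  v < 64 -> ~~ touches body 0 v -> ~~ touches (For v (sc 0) body) 0 0 ->
  s 0 0 = n -> n * (c + 15) + 15 <= k ->
  I 0 (store s 0 v 0) ->
  (forall j s', j < n -> agree (For v (sc 0) body) s s' -> bounded V s' ->
     s' 0 v = j -> I j s' ->
     wp body s' c (fun s2 => I j.+1 (store s2 0 v j.+1))) ->
  (forall s', agree (For v (sc 0) body) s s' -> I n s' -> Q s') ->
  wp (For v (sc 0) body) s k Q.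
Proof.
move=> v64 nt nt0 s0 Hk I0 Hb HQ.
apply: (@wp_for _ _ _ M _ _ _ n I (fun _ => c)) => //.
- exact: nV1.
- by move=> j s' _ ag _ _; rewrite /= ag.
- by move=> s' ag _; apply: HQ.
- by rewrite sum_nat_const card_ord /=; lia.
Qed.

Lemma wp_for_nb v w x body c (I : nat -> memory -> Prop) s k
    (Q : memory -> Prop) :
  v < 64 -> w < 64 -> x < n -> ~~ touches body 0 v ->
  ~~ touches (For v (Fetch 3 (sc w)) body) 0 w ->
  ~~ touches (For v (Fetch 3 (sc w)) body) 3 x ->
  s 0 w = x -> s 3 x = size (nb x) -> size (nb x) * (c + 16) + 16 <= k ->
  I 0 (store s 0 v 0) ->
  (forall j s', j < size (nb x) -> agree (For v (Fetch 3 (sc w)) body) s s' ->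
     bounded V s' -> s' 0 v = j -> I j s' ->
     wp body s' c (fun s2 => I j.+1 (store s2 0 v j.+1))) ->
  (forall s', agree (For v (Fetch 3 (sc w)) body) s s' ->
     I (size (nb x)) s' -> Q s') ->
  wp (For v (Fetch 3 (sc w)) body) s k Q.
Proof.
move=> v64 w64 xn nt ntw nt3 sw s3 Hk I0 Hb HQ.
apply: (@wp_for _ _ _ M _ _ _ (size (nb x)) I (fun _ => c)) => //.
- exact: leq_ltn_trans (size_nb x) nV1.
- by move=> j s' _ ag _ _; rewrite /= (ag 0) // sw ag //; do 2!split=> //; apply: lt_S.
- by move=> s' ag _; apply: HQ.
- by rewrite sum_nat_const card_ord /=; lia.
Qed.

Lemma wp_build_lists s (Q : memory -> Prop) :
  s 0 0 = n -> (forall x y, x < n -> y < n -> s 1 (x * n + y) = g x y) ->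
  (forall x, s 3 x = 0) ->
  (forall s', agree build_lists s s' -> lists_ok s' -> Q s') ->
  wp build_lists s (100 * (n * n + n + 1)) Q.
Proof.
move=> s0 s1 s3 HQ.
pose row x (p : seq nat) (s' : memory) := s' 3 x = size p /\
   forall k, k < size p -> s' 2 (x * n + k) = nth 0 p k.
pose part x j := [seq y <- iota 0 j | g x y].
have part_n x j : j <= n -> size (part x j) <= j.
  by move=> jn; rewrite size_filter (leq_trans (count_size _ _)) // size_iota.
pose I x s' := (forall x', x' < x -> row x' (nb x') s') /\
  forall x', x <= x' -> s' 3 x' = 0.
apply: (@wp_for_n _ _ (90 * n + 20) I) => //.
- by nia.
- by split=> // x' _; rewrite /store /= s3.
- move=> x s' xn ag bs' vx [rows later].
  pose J y s2 := [/\ forall x', x' < x -> row x' (nb x') s2,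
     forall x', x < x' -> s2 3 x' = 0 & row x (part x y) s2].
  apply: (@wp_for_n _ _ 40 J) => //.
  + by rewrite ag.
  + lia.
  + split=> //; last by split=> //; rewrite /store /= later.
    by move=> x' xx'; rewrite /store /= later //; lia.
  + move=> y s2 yn ag2 bs2 vy [rows2 later2 [r2 l2]].
    have E0 : s2 0 0 = n by rewrite ag2 // ag.
    have E1 : s2 0 1 = x by rewrite ag2.
    have E2 : s2 1 (x * n + y) = g x y by rewrite ag2 // ag // s1.
    apply: wp_seq => //.
    rewrite /= vy E0 E1 E2; split; first by repeat split; apply: idx_S.
    have EP : part x y.+1 = if g x y then rcons (part x y) y else part x y.
      by rewrite /part iota0S filter_rcons.
    have py := part_n x y ltac:(lia).
    case gxy: (g x y) EP => /= EP; last first.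
      by split=> //; rewrite /row EP.
    rewrite r2 ?E0 ?E1; split.
    * by repeat split=> //; [apply: lt_S|apply: idx_S; lia].
    * by [].
    * by have := nV1; lia.
    rewrite /store /= ?E1 ?r2; split.
    * by repeat split; apply: lt_S.
    * by repeat split=> //; apply: lt_S.
    * by have := nV1; lia.
    split.
    * move=> x' x'x /=; have [h1 h2] := rows2 x' x'x.
      split=> /=; first by have -> : (x' == x) = false by lia.
      move=> k kn; have nb_n := size_nb x'.
      rewrite idx_inj; [|lia|lia]; have -> : (x' == x) = false by lia.
      exact: h2.
    * move=> x' xx'; have -> : (x' == x) = false by lia.
      exact: later2.
    * split; rewrite /= ?eqxx EP size_rcons ?addn1 // => k kn.
      rewrite idx_inj ?eqxx /=; [|lia|lia].
      rewrite nth_rcons; case: (ltngtP k (size (part x y))) => // H; auto.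
      lia.
  + move=> s2 ag2 [rows2 later2 r2]; split=> //= x' xx'.
    have [->//|ne] := eqVneq x' x; apply: rows2; lia.
- by move=> s' ag [rows _]; apply: HQ.
Qed.

Definition greedy (o : seq nat) : Prop :=
  forall p b q c, o = p ++ b :: q -> c < n -> c \notin p ->
    count (g c) p <= count (g b) p.

Definition visited (o : seq nat) (s : memory) : Prop :=
  [/\ uniq o, {subset o <= gtn n}, greedy o &
     forall x, x < n -> s 5 x = if x \in o then (index x o).+1 else 0].

Lemma greedy_rcons o b : greedy o ->
  (forall c, c < n -> c \notin o -> count (g c) o <= count (g b) o) ->
  greedy (rcons o b).
Proof.
move=> go gb p b' q c; case/lastP: q => [|q z].
  by rewrite cats1 => /rcons_inj[<- <-]; apply: gb.
by rewrite -rcons_cons -rcons_cat => /rcons_inj[E _]; apply: go E.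
Qed.

Lemma wp_visit_order s (Q : memory -> Prop) :
  s 0 0 = n -> (forall x y, x < n -> y < n -> s 1 (x * n + y) = g x y) ->
  (forall x, s 4 x = 0) -> (forall x, s 5 x = 0) ->
  (forall s' o, agree visit_order s s' -> size o = n -> visited o s' -> Q s') ->
  wp visit_order s (200 * (n * n + n + 1)) Q.
Proof.
move=> s0 s1 s4 s5 HQ.
pose I t s' := exists o, [/\ size o = t, visited o s' &
  forall x, x < n -> s' 4 x = count (g x) o].
apply: (@wp_for_n _ _ (190 * n + 150) I) => //.
- nia.
- exists [::]; split=> //; last by move=> x xn; rewrite /store /= s4.
  split=> //; first by case.
  by move=> x xn; rewrite /store /= s5.
- move=> t s' tn ag bs' vt [o [so [uo on go vo] co]].
  have E0 : s' 0 0 = n by rewrite ag.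
  have cn x : count (g x) o < n.
    by apply: leq_ltn_trans (count_size _ _) _; rewrite so.
  apply: (@wp_then 30 (190 * n + 120)); first lia.
  have V0 : 0 < V by have := V8 M; lia.
  apply: wp_seq => //=; split=> //=; split=> //.
  set s2 := store _ 0 5 0.
  pose J x s3 := [/\ forall x', x' < x -> x' \notin o -> count (g x') o < s3 0 5 &
    s3 0 5 = 0 \/ [/\ s3 0 4 < n, s3 0 4 \notin o &
                      s3 0 5 = (count (g (s3 0 4)) o).+1]].
  apply: (@wp_then (115 * n + 15) (70 * n + 100)); first lia.
  apply: (@wp_for_n _ _ 100 J) => //.
  + lia.
  + by split=> //; left.
  + move=> x s3 xn ag3 bs3 vx [J1 J2].
    have E5 : s3 5 x = s' 5 x by rewrite ag3.
    have E4 : s3 4 x = s' 4 x by rewrite ag3.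
    have c5 : s3 0 5 <= n by case: J2 => [->//|[_ _ ->]].
    apply: wp_seq => //=; rewrite vx E5 E4 (co x xn) (vo x xn).
    split; first by repeat split=> //; apply: lt_S.
    have xS := lt_S xn; have nV' := nV1; have cnx := cn x.
    case xo: (x \in o); rewrite /= ?mul0n ?mul1n /=.
      split=> //= x' x'x x'o; rewrite {1}/store /=.
      by apply: J1 => //; have := x'x; rewrite ltnS leq_eqVlt => /predU1P[E|//];
        move: x'o; rewrite E xo.
    rewrite addn1; case: ltnP => H /=.
      split=> //; first by lia.
      rewrite /store /= vx E4 (co x xn) addn1; split=> //; first by lia.
      split=> /=; last by right; rewrite xo.
      move=> x' x'x x'o; rewrite ltnS.
      have [->//|ne] := eqVneq x' x.
      by have := J1 x' ltac:(lia) x'o; lia.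
    split=> //= x' x'x x'o; rewrite /store /=.
    have [->|ne] := eqVneq x' x; first by lia.
    by apply: J1 => //; lia.
  + move=> s3 ag3 [J1 J2].
    set b := s3 0 4.
    have [bn bo mx] : [/\ b < n, b \notin o &
       forall c, c < n -> c \notin o -> count (g c) o <= count (g b) o].
      have [x xn xo] : exists2 x, x < n & x \notin o.
        have : ~~ all (mem o) (iota 0 n).
          apply/negP => /allP sub.
          have := uniq_leq_size (iota_uniq 0 n) sub.
          by rewrite size_iota so leqNgt tn.
        by case/allPn => x; rewrite mem_iota => /andP[_ xn] xo; exists x.
      have := J1 x xn xo; case: J2 => [->//|[bn bo E] _]; split=> // c c_n co'.
      by have := J1 c c_n co'; rewrite E ltnS.
    have E3 : s3 0 3 = t by rewrite ag3.
    have E0' : s3 0 0 = n by rewrite ag3.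
    have A4 x : s3 4 x = s' 4 x by rewrite ag3.
    have A5 x : s3 5 x = s' 5 x by rewrite ag3.
    have A1 x : s3 1 x = s' 1 x by rewrite ag3.
    have nV' := nV1.
    apply: (@wp_then 10 (70 * n + 60)); first lia.
    apply: wp_seq => //=; rewrite -/b E3; split=> //.
    * by split=> //; apply: lt_S.
    * lia.
    set m4 := store _ _ _ _.
    pose K y u5 := forall x, x < n -> u5 4 x = count (g x) o + (x < y) * g b x.
    apply: (@wp_for_n _ _ 45 K) => //.
    * lia.
    * by move=> x xn; rewrite /m4 /store /= A4 co // addn0.
    * move=> y u5 yn ag5 bu5 vy K5.
      have F0 : u5 0 0 = n by rewrite ag5.
      have F4 : u5 0 4 = b by rewrite ag5.
      have F1 : u5 1 (b * n + y) = g b y by rewrite ag5 // /m4 /store /= A1 ag // s1.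
      apply: wp_seq => //=; rewrite vy F0 F4 F1 (K5 y yn) ltnn mul0n addn0; split.
      - by split=> //; apply: lt_S.
      - by repeat split=> //; [apply: lt_S|apply: idx_S].
      - by have := cn y; case: (g b y); lia.
      move=> x xn; rewrite /store /=; have [->|ne] := eqVneq x y.
        by rewrite ltnSn mul1n.
      by rewrite K5 // ltnS [x <= y]leq_eqVlt (negbTE ne).
    * move=> u5 ag5 K5; exists (rcons o b); split.
      - by rewrite size_rcons so.
      - split; first by rewrite rcons_uniq bo.
        + by move=> x; rewrite mem_rcons inE => /predU1P[->//|/on].
        + exact: greedy_rcons.
        + move=> x xn; rewrite /store /= ag5 // /m4 /store /=.
          rewrite mem_rcons inE -cats1 index_cat; have [->|ne] /= := eqVneq x b.
            by rewrite (negbTE bo) /= eqxx addn0 so addn1.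
          by rewrite A5 vo //; case: ifP.
      - move=> x xn; rewrite /store /= K5 // xn -cats1 count_cat /= g_sym.
        by rewrite addn0 mul1n.
- by move=> s' ag [o [so vo _]]; apply: (HQ s' o).
Qed.

Lemma has_iotaS (P : pred nat) j :
  has P (iota 0 j.+1) = has P (iota 0 j) || P j.
Proof. by rewrite iota0S has_rcons orbC. Qed.

Lemma wp_any r v cond c (P : pred nat) s k (Q : memory -> Prop) :
  r < 64 -> v < 64 -> (v != r) && (r != 0) && (v != 0) ->
  weight cond <= 24 -> cost cond <= c -> s 0 0 = n ->
  n * (c + 22) + 20 <= k ->
  (forall s' y, y < n -> agree (any r v (sc 0) cond) s s' -> s' 0 v = y ->
     safe S s' cond /\ (den s' cond != 0) = P y) ->
  (forall s', agree (any r v (sc 0) cond) s s' -> s' 0 r = has P (iota 0 n) ->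
     Q s') ->
  wp (any r v (sc 0) cond) s k Q.
Proof.
move=> r64 v64 /andP[/andP[vr r0] v0] wc cc s0 Hk Hc HQ.
have V0 : 1 < V by have := V8 M; lia.
apply: (@wp_then 3 (n * (c + 22) + 17)); first lia.
apply: wp_seq => //=; split=> //; first lia.
set s1 := store _ _ _ _.
have ag1 : agree (any r v (sc 0) cond) s s1.
  by move=> b j /= /norP[H _]; rewrite /s1 /store (negbTE H).
pose J j (s' : memory) := s' 0 r = has P (iota 0 j).
have sub s' : agree (For v (sc 0) (If cond (set_sc r (Const 1)) Skip)) s1 s' ->
    agree (any r v (sc 0) cond) s s'.
  move=> ag; apply: agree_trans ag1 _; apply: agree_sub ag => b j /= ->.
  by rewrite orbT.
apply: (@wp_for_n _ _ (c + 6) J) => //=.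
- by rewrite (negbTE vr).
- by rewrite !(eq_sym 0) (negbTE v0) (negbTE r0).
- by rewrite /s1 /store /= eq_sym (negbTE r0).
- by lia.
- by rewrite /J /s1 /store /= eqxx eq_sym (negbTE vr).
- move=> j s' jn ag bs' vj Jj; have [sf dc] := Hc s' j jn (sub _ ag) vj.
  apply: wp_seq => /=; [by rewrite wc|lia|].
  split=> //; rewrite dc /J has_iotaS.
  have [Pj|nPj] := boolP (P j); last first.
    by rewrite /= /store /= eq_sym (negbTE vr) Jj orbF.
  split=> //; rewrite /store /=.
  by rewrite eq_sym (negbTE vr) eqxx orbT.
- by move=> s' ag JN; apply: HQ => //; apply: sub.
Qed.

Definition simp (x : nat) : bool :=
  all (fun y => all (fun z => [&& g x y, g x z & y != z] ==> g y z) (iota 0 n))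
      (iota 0 n).

Definition l1 (x : nat) : bool :=
  ~~ simp x && has (fun y => g x y && simp y) (iota 0 n).

Lemma wp_simplicial_pass s (Q : memory -> Prop) :
  s 0 0 = n -> (forall x y, x < n -> y < n -> s 1 (x * n + y) = g x y) ->
  (forall x y, x < n -> y < n -> s 5 x = s 5 y -> x = y) ->
  (forall v a b, v < n -> a < n -> b < n -> s 5 a < s 5 v -> s 5 b < s 5 v ->
     g v a -> g v b -> a != b -> g a b) ->
  (forall s', agree simplicial_pass s s' ->
     (forall x, x < n -> s' 6 x = simp x) -> Q s') ->
  wp simplicial_pass s (300 * (n * n + n + 1)) Q.
Proof.
move=> s0 s1 inj elim HQ.
pose I x (s' : memory) := forall x', x' < x -> s' 6 x' = simp x'.
have nV' := nV1; have V8 := V8 M.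
apply: (@wp_for_n _ _ (200 * n + 150) I) => //.
- nia.
- move=> x s' xn ag bs' vx Ix.
  have E0 : s' 0 0 = n by rewrite ag.
  have E1 a b : a < n -> b < n -> s' 1 (a * n + b) = g a b.
    by move=> an bn; rewrite ag // s1.
  have E5 a : s' 5 a = s 5 a by rewrite ag.
  apply: (@wp_then 10 (200 * n + 140)); first lia.
  apply: wp_seq => //=; rewrite vx; split=> //; first lia.
  set s2 := store _ _ _ _.
  have S2 b j : b != 0 -> s2 b j = s' b j.
    by rewrite /s2 /store => /negbTE ->.
  pose nbx y := (y == x) || g x y.
  pose J y s3 := [/\ s3 0 6 < n, nbx (s3 0 6) &
     forall z, z < n -> (z == x) || (z < y) && g x z -> s 5 z <= s 5 (s3 0 6)].
  apply: (@wp_then (70 * n + 20) (120 * n + 120)); first lia.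
  apply: (@wp_for_n _ _ 55 J) => //.
  + lia.
  + split=> //; rewrite /store /= ?/nbx ?eqxx //.
    by move=> z zn /orP[/eqP ->|].
  + move=> y s3 yn ag3 bs3 vy [J1 J2 J3].
    have F1 : s3 0 1 = x by rewrite ag3.
    have F0 : s3 0 0 = n by rewrite ag3.
    have F : s3 1 (x * n + y) = g x y by rewrite ag3 // S2 // E1.
    have F5 a : s3 5 a = s 5 a by rewrite ag3 // S2 // E5.
    apply: wp_seq => //=; rewrite vy F1 F0 F !F5.
    split; first by repeat split=> //; [apply: idx_S|apply: lt_S|apply: lt_S].
    case gxy: (g x y) => /=; rewrite ?mul0n ?mul1n /=; last first.
      split; rewrite /store //= => z zn /orP[zx|/andP[zy xz]].
        by apply: J3 => //; rewrite zx.
      apply: J3; rewrite // xz andbT; apply/orP; right.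
      rewrite ltn_neqAle -ltnS zy andbT.
      by apply: contraTneq xz => ->; rewrite gxy.
    case: ltnP => lt /=.
      split=> //; rewrite ?vy; first lia.
      split; rewrite /store /= ?/nbx ?vy ?gxy ?orbT // => z zn.
      case/orP=> [zx|/andP[zy xz]].
        by apply: leq_trans (ltnW lt); apply: J3; rewrite // zx.
      have [->//|ne] := eqVneq z y.
      by apply: leq_trans (ltnW lt); apply: J3; rewrite // xz andbT; lia.
    split; rewrite /store //= => z zn /orP[zx|/andP[zy xz]].
      by apply: J3; rewrite // zx.
    have [->//|ne] := eqVneq z y.
    by apply: J3; rewrite // xz andbT; lia.
  + move=> s3 ag3 [fn nbf fmax]; set f := s3 0 6.
    have F1 : s3 0 1 = x by rewrite ag3.
    have F0 : s3 0 0 = n by rewrite ag3.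
    have F a b : a < n -> b < n -> s3 1 (a * n + b) = g a b.
      by move=> an bn; rewrite ag3 // S2 // E1.
    apply: (@wp_then (100 * n + 20) 50); first lia.
    apply: (@wp_any _ _ _ 60 (fun y => [&& g x y, f != y & ~~ g f y])) => //.
    * lia.
    * move=> s4 y yn ag4 vy.
      have G0 : s4 0 0 = n by rewrite ag4.
      have G1 : s4 0 1 = x by rewrite ag4.
      have G6 : s4 0 6 = f by rewrite ag4.
      have Gx : s4 1 (x * n + y) = g x y by rewrite ag4 // F.
      have Gf : s4 1 (f * n + y) = g f y by rewrite ag4 // F.
      rewrite /= G0 G1 G6 vy Gx Gf; split.
        by repeat split=> //; apply: idx_S.
      by case: (g x y); case: (f == y); case: (g f y).
    * move=> s4 ag4 r7; apply: wp_seq => //=.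
      have G1 : s4 0 1 = x by rewrite ag4.
      rewrite G1 r7; split=> //.
      - by split=> //; apply: lt_S.
      - by case: eqP; lia.
      move=> x' x'x; rewrite /store /=; have [->|ne] := eqVneq x' x; last first.
        by rewrite ag4 //= ag3 //= S2 //= Ix //; lia.
      have lt y : y < n -> g x y -> f != y -> s 5 y < s 5 f.
        move=> yn xy fy; rewrite ltn_neqAle fmax // ?yn ?xy ?orbT // andbT.
        by apply: contraNneq fy => /(inj _ _ yn fn) ->.
      congr nat_of_bool; rewrite eqb0 -all_predC /simp.
      apply/allP/allP => H y; rewrite mem_iota => /andP[_ yn] /=.
        apply/allP => z; rewrite mem_iota => /andP[_ zn]; apply/implyP.
        case/and3P=> xy xz yz.
        have adj w : w < n -> g x w -> f != w -> g f w.
          move=> wn xw fw; have := H w; rewrite mem_iota wn /= xw fw /=.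
          by rewrite negbK; apply.
        have [Ef|fy] := eqVneq f y; first by rewrite -Ef adj // Ef.
        have [Ef|fz] := eqVneq f z; first by rewrite -Ef g_sym adj.
        by apply: (elim f y z) => //; [apply: lt|apply: lt|apply: adj|apply: adj].
      apply/negP => /and3P[xy fy nfy].
      have := H y; rewrite mem_iota yn => /(_ isT)/allP/(_ f).
      rewrite mem_iota fn xy eq_sym fy /= => /(_ isT).
      case/orP: nbf => [/eqP Ef|xf]; first by move: nfy; rewrite /f Ef xy.
      by rewrite xf g_sym (negbTE nfy).
Qed.

Lemma wp_near_simplicial_pass s (Q : memory -> Prop) :
  s 0 0 = n -> (forall x y, x < n -> y < n -> s 1 (x * n + y) = g x y) ->
  (forall x, x < n -> s 6 x = simp x) ->
  (forall s', agree near_simplicial_pass s s' ->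
     (forall x, x < n -> s' 7 x = l1 x) -> Q s') ->
  wp near_simplicial_pass s (200 * (n * n + n + 1)) Q.
Proof.
move=> s0 s1 s6 HQ.
pose I x (s' : memory) := forall x', x' < x -> s' 7 x' = l1 x'.
have nV' := nV1; have V8 := V8 M.
apply: (@wp_for_n _ _ (100 * n + 50) I) => //.
- nia.
- move=> x s' xn ag bs' vx Ix.
  have E0 : s' 0 0 = n by rewrite ag.
  have E1 a b : a < n -> b < n -> s' 1 (a * n + b) = g a b.
    by move=> an bn; rewrite ag // s1.
  have E6 a : a < n -> s' 6 a = simp a by move=> an; rewrite ag // s6.
  apply: (@wp_then (100 * n + 20) 30); first lia.
  apply: (@wp_any _ _ _ 60 (fun y => g x y && simp y)) => //.
  + lia.
  + move=> s4 y yn ag4 vy.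
    have G0 : s4 0 0 = n by rewrite ag4.
    have G1 : s4 0 1 = x by rewrite ag4.
    have Gx : s4 1 (x * n + y) = g x y by rewrite ag4 // E1.
    have Gs : s4 6 y = simp y by rewrite ag4 // E6.
    rewrite /= G0 G1 vy Gx Gs; split.
      by repeat split=> //; [apply: idx_S|apply: lt_S].
    by case: (g x y); case: (simp y).
  + move=> s4 ag4 r7; apply: wp_seq => //=.
    have G1 : s4 0 1 = x by rewrite ag4.
    have Gs : s4 6 x = simp x by rewrite ag4 // E6.
    rewrite G1 r7 Gs; split=> //.
    * by split=> //; apply: lt_S.
    * by repeat split=> //; apply: lt_S.
    * by case: (has _ _); case: (simp x); lia.
    move=> x' x'x; rewrite /store /=; have [->|ne] := eqVneq x' x.
      by rewrite /l1; case: (has _ _); case: (simp x).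
    by rewrite ag4 //= Ix //; lia.
Qed.

Definition degree_sum : nat := \sum_(x < n) size (nb x).

Lemma wp_for_sum v body a c (I : nat -> memory -> Prop) s k
    (Q : memory -> Prop) :
  v < 64 -> ~~ touches body 0 v -> ~~ touches (For v (sc 0) body) 0 0 ->
  s 0 0 = n -> a * degree_sum + n * (c + 15) + 15 <= k ->
  I 0 (store s 0 v 0) ->
  (forall j s', j < n -> agree (For v (sc 0) body) s s' -> bounded V s' ->
     s' 0 v = j -> I j s' ->
     wp body s' (a * size (nb j) + c) (fun s2 => I j.+1 (store s2 0 v j.+1))) ->
  (forall s', agree (For v (sc 0) body) s s' -> I n s' -> Q s') ->
  wp (For v (sc 0) body) s k Q.
Proof.
move=> v64 nt nt0 s0 Hk I0 Hb HQ.
apply: (@wp_for _ _ _ M _ _ _ n I (fun j => a * size (nb j) + c)) => //.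
- exact: nV1.
- by move=> j s' _ ag _ _; rewrite /= ag.
- by move=> s' ag _; apply: HQ.
- by rewrite big_split sum_nat_const card_ord -big_distrr /= -/degree_sum; lia.
Qed.

Lemma nth_nb x j : j < size (nb x) ->
  [/\ nth 0 (nb x) j < n, g x (nth 0 (nb x) j) &
      take j.+1 (nb x) = rcons (take j (nb x)) (nth 0 (nb x) j)].
Proof.
move=> jn; have := mem_nth 0 jn; rewrite mem_nb => /andP[-> ->].
by split=> //; apply: take_nth.
Qed.

Lemma uniq_nb x : uniq (nb x).
Proof. by rewrite filter_uniq // iota_uniq. Qed.

(** * Redundant vertices, clique leaders and the relation [ok] in linear time *)

Section Phase3.
Variable bad : nat -> nat -> bool.

Definition red (x : nat) : bool :=
  l1 x || has (fun z => [&& ~~ l1 z, ~~ bad z x &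
                 size (nb z) * n + z < size (nb x) * n + x]) (nb x).

(** For an irredundant [y] this is the least label of its clique. For a redundant one it is just a
    legal index, at which [count_leaders] adds 0. *)
Definition rep (y : nat) : nat :=
  foldl (fun r z => if ~~ red z && (z < r) then z else r) y (nb y).

(** Compares the part of the clique of [y] seen by [x] with the whole clique; the successor counts
    [y] itself, which is not in its own list. *)
Definition ok (x y : nat) : bool :=
  [&& g x y, ~~ red y &
      count (fun z => ~~ red z && (rep z == rep y)) (nb x) ==
      (count (predC red) (nb y)).+1].

Lemma wp_redundant_pass s (Q : memory -> Prop) :
  s 0 0 = n -> lists_ok s -> (forall x, x < n -> s 7 x = l1 x) ->
  (forall z x, z < n -> x < n -> g z x -> s 8 (z * n + x) = bad z x) ->
  (forall s', agree redundant_pass s s' ->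
     (forall x, x < n -> s' 10 x = red x) -> Q s') ->
  wp redundant_pass s (200 * (degree_sum + n + 1)) Q.
Proof.
move=> s0 lst s7 s8 HQ; have nV' := nV1; have V8 := V8 M.
pose I x (s' : memory) := forall x', x' < x -> s' 10 x' = red x'.
apply: (@wp_for_sum _ _ 100 80 I) => //; first lia.
move=> x s' xn ag bs' vx Ix.
have E0 : s' 0 0 = n by rewrite ag.
have E2 b j : ~~ touches redundant_pass b j -> s' b j = s b j by apply: ag.
apply: (@wp_then 10 (100 * size (nb x) + 70)); first lia.
apply: wp_seq => //=; rewrite vx E2 // s7 //; split=> //.
- by split=> //; apply: lt_S.
- by case: (l1 x); lia.
set s2 := store _ _ _ _.
have S2 b j : b != 0 -> s2 b j = s' b j.
  by rewrite /s2 /store => /negbTE ->.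
apply: (@wp_then (100 * size (nb x) + 20) 40); first lia.
pose P z := [&& ~~ l1 z, ~~ bad z x &
                 size (nb z) * n + z < size (nb x) * n + x].
pose J j (s3 : memory) := s3 0 7 = l1 x || has P (take j (nb x)).
apply: (@wp_for_nb _ _ x _ 70 J) => //.
- by rewrite S2 // E2 //; case: (lst x xn).
- lia.
- by rewrite /J take0 orbF.
- move=> j s3 jn ag3 bs3 vj Jj.
  have [zn xz tk] := nth_nb jn; set z := nth 0 (nb x) j in zn xz tk.
  have F b i : ~~ touches redundant_pass b i -> b != 0 -> s3 b i = s b i.
    move=> H b0; rewrite ag3 ?S2 ?E2 //.
    by apply: contra H => /= H; rewrite H !orbT.
  have F0 : s3 0 0 = n by rewrite ag3.
  have F1 : s3 0 1 = x by rewrite ag3.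
  have Fz : s3 2 (x * n + j) = z by rewrite F //; case: (lst x xn) => _ ->.
  have F7 : s3 7 z = l1 z by rewrite F // s7.
  have F8 : s3 8 (z * n + x) = bad z x by rewrite F // s8 // g_sym.
  have F3z : s3 3 z = size (nb z) by rewrite F //; case: (lst z zn).
  have F3x : s3 3 x = size (nb x) by rewrite F //; case: (lst x xn).
  have jn' : j < n by apply: leq_trans (size_nb x).
  apply: wp_seq => //=; rewrite vj F0 F1 Fz; split=> //.
  + by repeat split=> //; apply: idx_S.
  + lia.
  rewrite /store /= F0 F1 F7 F8 F3z F3x; split.
    by repeat split=> //; do ?[exact: lt_S|exact: idx_S].
  have -> : (((l1 z == 0 :> nat) * ((bad z x == 0 :> nat) *
     (size (nb z) * n + z < size (nb x) * n + x)))%N != 0) = P z.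
    by rewrite /P; case: (l1 z); case: (bad z x); case: (_ < _).
  have JS : l1 x || has P (take j.+1 (nb x)) = (l1 x || has P (take j (nb x))) || P z.
    by rewrite tk has_rcons [P z || _]orbC orbA.
  case: (P z) JS => JS.
    by split=> //; [lia|rewrite /J JS orbT].
  by rewrite /J /= JS orbF.
- move=> s3 ag3; rewrite /J take_size => J3.
  have F1 : s3 0 1 = x by rewrite ag3.
  apply: wp_seq => //=; rewrite F1 J3; split=> //.
  + by split=> //; apply: lt_S.
  + by case: (_ || _); lia.
  move=> x' x'x; rewrite /store /=; have [->//|ne] := eqVneq x' x.
  by rewrite ag3 // S2 // Ix //; lia.
Qed.

Lemma rep_lt y : y < n -> rep y < n.
Proof.
rewrite /rep => yn; have : {subset nb y <= gtn n}.
  by move=> z; rewrite mem_nb => /andP[].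
elim: (nb y) {1 3}y yn => //= z p IH r rn sub; apply: IH.
  by case: ifP => // _; apply: sub; rewrite mem_head.
by move=> w wp; apply: sub; rewrite inE wp orbT.
Qed.

Lemma wp_leader_pass s (Q : memory -> Prop) :
  s 0 0 = n -> lists_ok s -> (forall x, x < n -> s 10 x = red x) ->
  (forall s', agree leader_pass s s' ->
     (forall x, x < n -> s' 11 x = rep x) ->
     (forall x, x < n -> s' 12 x = (count (predC red) (nb x)).+1) -> Q s') ->
  wp leader_pass s (200 * (degree_sum + n + 1)) Q.
Proof.
move=> s0 lst s10 HQ; have nV' := nV1; have V8 := V8 M.
pose I x (s' : memory) := forall x', x' < x ->
  s' 11 x' = rep x' /\ s' 12 x' = (count (predC red) (nb x')).+1.
apply: (@wp_for_sum _ _ 100 80 I) => //; [lia| |].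
  move=> x s' xn ag bs' vx Ix.
  have E0 : s' 0 0 = n by rewrite ag.
  apply: (@wp_then 10 (100 * size (nb x) + 70)); first lia.
  apply: wp_seq => //=; rewrite vx; split=> //; first by lia.
  split=> //; first by lia.
  set s2 := store _ _ _ _.
  have S2 b j : b != 0 -> s2 b j = s' b j.
    by rewrite /s2 /store => /negbTE ->.
  apply: (@wp_then (100 * size (nb x) + 20) 40); first lia.
  pose step r z := if ~~ red z && (z < r) then z else r.
  pose J j (s3 : memory) := [/\ s3 0 6 < n,
    s3 0 6 = foldl step x (take j (nb x)) &
    s3 0 7 = (count (predC red) (take j (nb x))).+1].
  apply: (@wp_for_nb _ _ x _ 70 J) => //.
  - by rewrite S2 // ag //; case: (lst x xn).
  - lia.
  - by split; rewrite ?take0.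
  - move=> j s3 jn ag3 bs3 vj [J1 J2 J3].
    have [zn xz tk] := nth_nb jn; set z := nth 0 (nb x) j in zn xz tk.
    have F b i : ~~ touches leader_pass b i -> b != 0 -> s3 b i = s b i.
      move=> H b0; rewrite ag3 ?S2 ?ag //.
      by apply: contra H => /= H; rewrite H !orbT.
    have F0 : s3 0 0 = n by rewrite ag3.
    have F1 : s3 0 1 = x by rewrite ag3.
    have Fz : s3 2 (x * n + j) = z by rewrite F //; case: (lst x xn) => _ ->.
    have F10 : s3 10 z = red z by rewrite F // s10.
    have jn' : j < n by apply: leq_trans (size_nb x).
    have c_n : count (predC red) (take j (nb x)) <= j.
      by apply: leq_trans (count_size _ _) _; rewrite size_take; case: ifP; lia.
    apply: wp_seq => //=; rewrite vj F0 F1 Fz; split=> //.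
    + by repeat split=> //; apply: idx_S.
    + lia.
    rewrite /store /= F10; split.
      by repeat split=> //; apply: lt_S.
    have step1 : foldl step x (take j.+1 (nb x)) = step (s3 0 6) z.
      by rewrite tk foldl_rcons J2.
    have cnt1 : count (predC red) (take j.+1 (nb x)) =
        count (predC red) (take j (nb x)) + ~~ red z.
      by rewrite tk -cats1 count_cat /= addn0.
    have [rz|nrz] /= := boolP (red z).
      by split; rewrite ?step1 ?cnt1 /step ?rz ?J3 ?addn0.
    rewrite addn1 J3; split=> //; first lia.
    split=> //; case: ltnP => lt /=; last first.
      split; rewrite ?step1 ?cnt1 /step ?nrz ?addn1 //=.
      by rewrite ltnNge lt.
    split=> //; first lia.
    by split; rewrite ?step1 ?cnt1 /step ?nrz ?addn1 ?lt.
  - move=> s3 ag3; rewrite /J take_size => -[J1 J2 J3].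
    have F1 : s3 0 1 = x by rewrite ag3.
    have c_n : count (predC red) (nb x) < V.
      by have := count_size (predC red) (nb x); have := size_nb x; lia.
    apply: wp_seq => //=; rewrite F1; split=> //.
    + by split=> //; apply: lt_S.
    + lia.
    rewrite /store /= F1 J3; split=> //.
    + by split=> //; apply: lt_S.
    + by have := count_size (predC red) (nb x); have := size_nb x; lia.
    move=> x' x'x; rewrite /=; have [->|ne] := eqVneq x' x.
      by rewrite J2.
    rewrite !ag3 // !S2 //; apply: Ix; lia.
move=> s' ag In; apply: HQ => // x xn; by case: (In x xn).
Qed.

Lemma wp_ok_pass s (Q : memory -> Prop) :
  s 0 0 = n -> lists_ok s -> (forall x, x < n -> s 10 x = red x) ->
  (forall x, x < n -> s 11 x = rep x) ->
  (forall x, x < n -> s 12 x = (count (predC red) (nb x)).+1) ->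
  (forall i, s 13 i = 0) -> (forall i, s 14 i = 0) ->
  (forall s', agree ok_pass s s' ->
     (forall x y, x < n -> y < n -> s' 14 (x * n + y) = ok x y) -> Q s') ->
  wp ok_pass s (400 * (degree_sum + n + 1)) Q.
Proof.
move=> s0 lst s10 s11 s12 s13 s14 HQ; have nV' := nV1; have V8 := V8 M.
pose I x (s' : memory) := [/\ forall i, s' 13 i = 0,
  forall x' y, x' < x -> y < n -> s' 14 (x' * n + y) = ok x' y &
  forall x' y, x <= x' -> x' < n -> y < n -> s' 14 (x' * n + y) = 0].
apply: (@wp_for_sum _ _ 250 100 I) => //; first lia.
- by split=> // x' y _ _ _; rewrite /store /= s14.
- move=> x s' xn ag bs' vx [I1 I2 I3].
  have F b i : ~~ touches ok_pass b i -> s' b i = s b i by apply: ag.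
  pose known s3 := [/\ s3 0 0 = n, s3 0 1 = x, lists_ok s3 &
    forall z, z < n -> [/\ s3 10 z = red z, s3 11 z = rep z &
       s3 12 z = (count (predC red) (nb z)).+1]].
  have known' : known s'.
    split=> //; first by rewrite F.
      by move=> z zn; have [h1 h2] := lst z zn; split=> [|k kn]; rewrite F // h2.
    by move=> z zn; rewrite !F // s10 // s11 // s12.
  have knownP c s1 s2 : agree c s1 s2 -> known s1 ->
      (forall i, ~~ touches c 2 i) -> (forall i, ~~ touches c 3 i) ->
      (forall i, ~~ touches c 10 i) -> (forall i, ~~ touches c 11 i) ->
      (forall i, ~~ touches c 12 i) -> ~~ touches c 0 0 -> ~~ touches c 0 1 ->
      known s2.
    move=> A [k0 k1 kl kr] t2 t3 t10 t11 t12 t00 t01; split; rewrite ?A //.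
      by move=> z zn; have [h1 h2] := kl z zn; split=> [|k kn]; rewrite A // h2.
    by move=> z zn; have [h1 h2 h3] := kr z zn; rewrite !A.
  pose C (i : nat) := count (fun z => ~~ red z && (rep z == i)) (nb x).
  have CV i : C i < V.
    by apply: leq_ltn_trans (count_size _ _) _; have := size_nb x; lia.
  apply: (@wp_then (80 * size (nb x) + 20) (170 * size (nb x) + 80)); first lia.
  pose J1 j (s3 : memory) := forall i, s3 13 i =
    count (fun z => ~~ red z && (rep z == i)) (take j (nb x)).
  have cnt_lt j (i : nat) :
      count (fun z => ~~ red z && (rep z == i)) (take j (nb x)) <= n.
    apply: leq_trans (count_size _ _) _; rewrite size_take.
    by have := size_nb x; case: ifP; lia.
  apply: (@wp_for_nb _ _ x _ 60 J1) => //.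
  + by case: known' => _ _ kl _; case: (kl x xn).
  + lia.
  + by move=> i; rewrite take0 /store /= I1.
  + move=> j s3 jn ag3 bs3 vj Jj.
    have [zn xz tk] := nth_nb jn; set z := nth 0 (nb x) j in zn xz tk.
    have [k0 k1 kl kr] := knownP _ _ _ ag3 known'
      ltac:(by []) ltac:(by []) ltac:(by []) ltac:(by []) ltac:(by [])
      ltac:(by []) ltac:(by []).
    have Fz : s3 2 (x * n + j) = z by case: (kl x xn) => _ ->.
    have [r10 r11 r12] := kr z zn.
    have jn' : j < n by apply: leq_trans (size_nb x).
    apply: wp_seq => //=; rewrite vj k0 k1 Fz; split=> //.
    * by repeat split=> //; apply: idx_S.
    * lia.
    have cl := cnt_lt j.+1 (rep z).
    have JS i : count (fun z => ~~ red z && (rep z == i)) (take j.+1 (nb x)) =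
       s3 13 i + (~~ red z && (rep z == i)).
      by rewrite tk -cats1 count_cat /= addn0 Jj.
    rewrite /store /= r11 r10; rewrite JS eqxx andbT in cl; split.
    * by repeat split=> //; apply: lt_S => //; apply: rep_lt.
    * by repeat split=> //; apply: lt_S => //; apply: rep_lt.
    * by case: (red z) cl => /=; lia.
    move=> i /=; rewrite JS; have [->|ne] := eqVneq i (rep z).
      by rewrite andbT; case: (red z).
    by rewrite andbF addn0.
  move=> s3 ag3; rewrite /J1 take_size -/(C _) => C3.
  have known3 := knownP _ _ _ ag3 known'
      ltac:(by []) ltac:(by []) ltac:(by []) ltac:(by []) ltac:(by [])
      ltac:(by []) ltac:(by []).
  apply: (@wp_then (90 * size (nb x) + 20) (80 * size (nb x) + 60)); first lia.
  pose J2 j (s4 : memory) := forall x' y, x' < n -> y < n -> s4 14 (x' * n + y) =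
    if x' == x then nat_of_bool ((y \in take j (nb x)) && ok x y)
    else s' 14 (x' * n + y).
  apply: (@wp_for_nb _ _ x _ 70 J2) => //.
  + by case: known3.
  + by case: known3 => _ _ kl _; case: (kl x xn).
  + lia.
  + move=> x' y x'n yn; rewrite take0 /store /= ag3 //=.
    by case: eqP => // ->; rewrite I3.
  + move=> j s4 jn ag4 bs4 vj Jj.
    have [zn xz tk] := nth_nb jn; set z := nth 0 (nb x) j in zn xz tk.
    have [k0 k1 kl kr] := knownP _ _ _ ag4 known3
      ltac:(by []) ltac:(by []) ltac:(by []) ltac:(by []) ltac:(by [])
      ltac:(by []) ltac:(by []).
    have Fz : s4 2 (x * n + j) = z by case: (kl x xn) => _ ->.
    have [r10 r11 r12] := kr z zn.
    have jn' : j < n by apply: leq_trans (size_nb x).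
    have F13 : s4 13 (rep z) = C (rep z) by rewrite ag4 // C3.
    have okz : (C (rep z) == (count (predC red) (nb z)).+1) * (1 - red z) =
        ok x z.
      by rewrite /ok xz /C; case: (red z); rewrite ?muln0 ?muln1.
    apply: wp_seq => //=; rewrite vj k0 k1 Fz; split=> //.
    * by repeat split=> //; apply: idx_S.
    * lia.
    rewrite /store /= k0 k1 r10 r11 r12 F13 okz; split.
    * by repeat split=> //; apply: idx_S.
    * by repeat split=> //; apply: lt_S => //; apply: rep_lt.
    * by case: (ok x z); lia.
    move=> x' y x'n yn /=; rewrite idx_inj // Jj //.
    have [_|ne] //= := eqVneq x' x.
    by rewrite tk mem_rcons inE; have [->|] := eqVneq y z.
  move=> s4 ag4; rewrite /J2 take_size => {}J2.
  have known4 := knownP _ _ _ ag4 known3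
      ltac:(by []) ltac:(by []) ltac:(by []) ltac:(by []) ltac:(by [])
      ltac:(by []) ltac:(by []).
  pose J3 j (s5 : memory) := forall i, s5 13 i =
    if has (fun z => rep z == i) (take j (nb x)) then 0 else C i.
  apply: (@wp_for_nb _ _ x _ 60 J3) => //.
  + by case: known4.
  + by case: known4 => _ _ kl _; case: (kl x xn).
  + lia.
  + by move=> i; rewrite take0 /store /= ag4 // C3.
  + move=> j s5 jn ag5 bs5 vj Jj.
    have [zn xz tk] := nth_nb jn; set z := nth 0 (nb x) j in zn xz tk.
    have [k0 k1 kl kr] := knownP _ _ _ ag5 known4
      ltac:(by []) ltac:(by []) ltac:(by []) ltac:(by []) ltac:(by [])
      ltac:(by []) ltac:(by []).
    have Fz : s5 2 (x * n + j) = z by case: (kl x xn) => _ ->.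
    have [r10 r11 r12] := kr z zn.
    have jn' : j < n by apply: leq_trans (size_nb x).
    apply: wp_seq => //=; rewrite vj k0 k1 Fz; split=> //.
    * by repeat split=> //; apply: idx_S.
    * lia.
    rewrite /store /= r11; split=> //.
    * by repeat split=> //; apply: lt_S => //; apply: rep_lt.
    * lia.
    by move=> i /=; rewrite tk has_rcons Jj; have [->|ne] := eqVneq i (rep z).
  move=> s5 ag5; rewrite /J3 take_size => {}J3; split.
  (* A counter that is not cleared was never incremented, since no neighbour of [x] has it as
     leader. *)
  + move=> i; rewrite /store /= J3; case: ifP => // /negbT; rewrite -all_predC.
    move/allP => H; rewrite /C; apply/eqP; rewrite -leqn0 leqNgt -has_count.
    by apply/hasP => -[z /H /= /negbTE ->]; rewrite andbF.
  + move=> x' y x'x yn; rewrite /store /= ag5 // J2 //; last lia.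
    have [->|ne] := eqVneq x' x; last by apply: I2 => //; lia.
    by rewrite mem_nb yn /ok; case: (g x y).
  + move=> x' y x'x x'n yn; rewrite /store /= ag5 // J2 //.
    by have [E|ne] := eqVneq x' x; [lia|apply: I3 => //; lia].
- by move=> s' ag [_ In _]; apply: HQ => // x y xn; apply: In.
Qed.

End Phase3.

End Program.

(** * Inclusion rounds paid for by singletons *)

(** The round of [q], held in scalar 1. A walk [q z x] that ends outside N[q] shows that [q] lies in
    N(z) and not in N[x]. The inner loops run over the lists of the neighbours of [q], at most all
    lists once. *)
Definition mark : cmd :=
  For 3 (Fetch 3 (sc 1)) (Comp neighbour
    (For 9 (Fetch 3 (sc 10))
      (Comp (set_sc 12 (Fetch 2 (idx (sc 10) (sc 9))))
        (If (Bin Mul (Bin Eq (Bin Eq (sc 12) (sc 1)) (Const 0))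
                     (Bin Eq (Fetch 1 (idx (sc 1) (sc 12))) (Const 0)))
           (Store 8 (idx (sc 10) (sc 12)) (Const 1)) Skip)))).

Definition singletons : cmd :=
  For 1 (sc 0)
    (If (Fetch 7 (sc 1))
       (Comp mark
         (If (Bin Eq (sc 13) (Const 0))
            (Comp (Comp (set_sc 13 (Const 1)) (Store 9 (sc 1) (Const 1)))
                  (Comp (Write (sc 1)) Emit))
            (set_sc 13 (Const 0))))
       Skip).

Section Singletons.
Variables (n : nat) (g : nat -> nat -> bool) (S W V : nat).
Hypothesis g_sym : symmetric g.
Hypothesis M : machine S W V.
Hypothesis D : n * n <= S /\ (n + 2) * (n + 2) <= V.
Local Notation wp := (wp S W V).
Local Notation nb := (nb n g).
Local Notation l1 := (l1 n g).
Local Notation degree_sum := (degree_sum n g).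

Lemma sum_nb_le (F : nat -> nat) x :
  \sum_(j < size (nb x)) F (nth 0 (nb x) j) <= \sum_(y < n) F y.
Proof.
rewrite -(big_mkord xpredT (fun j => F (nth 0 (nb x) j))) -(big_nth 0 xpredT F).
rewrite big_filter big_mkcond -(big_mkord xpredT F) /index_iota subn0.
by apply: leq_sum => y _; case: (g x y).
Qed.

Definition marks (q z x : nat) : bool :=
  [&& g q z, g z x, x != q & ~~ g q x].

Lemma wp_mark q (B : nat -> nat -> bool) s (Q : memory -> Prop) :
  q < n -> s 0 0 = n -> s 0 1 = q -> lists_ok n g s ->
  (forall x y, x < n -> y < n -> s 1 (x * n + y) = g x y) ->
  (forall z x, z < n -> x < n -> s 8 (z * n + x) = B z x) ->
  (forall s', agree mark s s' ->
     (forall z x, z < n -> x < n ->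
        s' 8 (z * n + x) = B z x || marks q z x) -> Q s') ->
  wp mark s (200 * (degree_sum + n + 1)) Q.
Proof.
move=> qn s0 s1 lst adj s8 HQ; have nV' := nV1 D; have V8 := V8 M.
pose J j (s3 : memory) := forall z x, z < n -> x < n ->
  s3 8 (z * n + x) = B z x || (z \in take j (nb q)) && marks q z x.
apply: (wp_for M (N := size (nb q)) (I := J)
         (f := fun j => 90 * size (nb (nth 0 (nb q) j)) + 60)) => //.
- by have := size_nb n g q; lia.
- move=> j s' _ ag _ _; rewrite /= (ag 0) // s1 ag //; have [-> _] := lst q qn.
  by split=> //; split=> //; apply: (lt_S D).
- by move=> z x zn xn; rewrite take0 orbF /store /= s8.
- move=> j s3 jn ag bs3 vj Jj.
  have [zn qz tk] := nth_nb jn; set z := nth 0 (nb q) j in zn qz tk *.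
  have F b i : ~~ touches mark b i -> s3 b i = s b i by apply: ag.
  have jn' : j < n by apply: leq_trans (size_nb n g q).
  apply: (@wp_then _ _ _ 20 (90 * size (nb z) + 40)); first lia.
  apply: (wp_seq M) => //=; rewrite vj !F // s0 s1.
  have -> : s 2 (q * n + j) = z by case: (lst q qn) => _ ->.
  split=> //; [by repeat split=> //; apply: (idx_S D)|lia|].
  set s4 := store _ _ _ _.
  have S4 b i : b != 0 -> s4 b i = s3 b i.
    by rewrite /s4 /store => /negbTE ->.
  pose B3 w x := B w x || (w \in take j (nb q)) && marks q w x.
  pose K l (s5 : memory) := forall w x, w < n -> x < n -> s5 8 (w * n + x) =
    B3 w x || [&& w == z, x \in take l (nb z), x != q & ~~ g q x].
  apply: (wp_for_nb M D (x := z) (g := g) (c := 70) (I := K)) => //.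
  + by rewrite S4 // F //; case: (lst z zn).
  + lia.
  + by move=> w x wn xn; rewrite take0 andbF orbF /store /= S4 ?Jj.
  + move=> l s5 ln ag5 bs5 vl Kl.
    have [yn zy tk5] := nth_nb ln; set y := nth 0 (nb z) l in yn zy tk5.
    have F5 b i : ~~ touches mark b i -> b != 0 -> s5 b i = s b i.
      move=> H b0; rewrite ag5 ?S4 ?F //.
      by apply: contra H => /= H; rewrite H ?orbT.
    have F0 : s5 0 0 = n by rewrite ag5 // /s4 /store /= F.
    have F1 : s5 0 1 = q by rewrite ag5 // /s4 /store /= F.
    have F10 : s5 0 10 = z by rewrite ag5.
    have Fy : s5 2 (z * n + l) = y by rewrite F5 //; case: (lst z zn) => _ ->.
    have ln' : l < n by apply: leq_trans (size_nb n g z).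
    apply: (wp_seq M) => //=; rewrite vl F0 F10 Fy; split=> //.
    * by repeat split=> //; apply: (idx_S D).
    * lia.
    rewrite /store /= F0 F1 F10 F5 // adj //; split.
      by repeat split=> //; apply: (idx_S D).
    have KS w x : w < n -> x < n ->
        B3 w x || [&& w == z, x \in take l.+1 (nb z), x != q & ~~ g q x] =
        (B3 w x || [&& w == z, x \in take l (nb z), x != q & ~~ g q x]) ||
        [&& w == z, x == y, y != q & ~~ g q y].
      move=> wn xn; rewrite tk5 mem_rcons inE.
      by have [->|ne] := eqVneq x y; case: (B3 w _); case: (w == z); case: (_ \in _);
        case: (_ == q); case: (g q _).
    have -> : ((y == q :> nat) == 0 :> nat) * (g q y == 0 :> nat) =
        (y != q) && ~~ g q y :> nat by case: (y == q); case: (g q y).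
    case yq: ((y != q) && ~~ g q y) => /=.
      split=> //; first by repeat split=> //; apply: (idx_S D).
        by lia.
      move=> w x wn xn /=; rewrite KS // (idx_inj D) // yq andbT.
      by case: (_ && _); rewrite ?orbT // orbF Kl.
    by move=> w x wn xn /=; rewrite KS // yq !andbF orbF Kl.
  + move=> s5 ag5 KN w x wn xn; rewrite /store /= KN // take_size /B3 tk.
    rewrite mem_rcons inE mem_nb xn /= /marks.
    have [->|ne] := eqVneq w z; rewrite /= ?orbF //.
    by rewrite qz /=; case: (B z x); case: (z \in _); rewrite /= ?orbb ?orbF.
- move=> s' ag vN; rewrite /J take_size => JN; apply: HQ => // z x zn xn.
  by rewrite JN // mem_nb zn /marks; case: (g q z).
- have E : \sum_(y < n) (90 * size (nb y) + 60) = 90 * degree_sum + n * 60.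
    by rewrite big_split sum_nat_const card_ord -big_distrr.
  have := sum_nb_le (fun z => 90 * size (nb z) + 60) q; rewrite E /=.
  by have := size_nb n g q; lia.
Qed.

Definition bad (z x : nat) : bool :=
  has (fun q => l1 q && marks q z x) (iota 0 n).

(* Every second vertex of l1: the output of its singleton pays for its own round
   and for the next one. *)
Definition skip (q : nat) : bool := l1 q && ~~ odd (count l1 (iota 0 q)).

Definition round_cost : nat := 200 * (degree_sum + n + 1) + 40.

Lemma wpg_singletons P T s (G : seq (seq nat) -> memory -> nat -> Prop) :
  20 * n + 2 * round_cost + T + 10 <= P ->
  s 0 0 = n -> s 0 13 = 0 -> lists_ok n g s ->
  (forall x y, x < n -> y < n -> s 1 (x * n + y) = g x y) ->
  (forall x, x < n -> s 7 x = l1 x) ->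
  (forall i, s 8 i = 0) -> (forall i, s 9 i = 0) ->
  (forall s' r, agree singletons s s' -> T <= r ->
     (forall z x, z < n -> x < n -> s' 8 (z * n + x) = bad z x) ->
     (forall q, q < n -> s' 9 q = skip q) ->
     G [seq [:: q] | q <- iota 0 n & skip q] s' r) ->
  wpg P S W V singletons s P G.
Proof.
move=> PT s0 s13 lst adj s7 s8 s9 HG; have nV' := nV1 D; have V8 := V8 M.
pose par j := odd (count l1 (iota 0 j)).
have parS j : par j.+1 = par j (+) l1 j.
  by rewrite /par iota0S -cats1 count_cat oddD /= addn0; case: (l1 j).
(* After an odd number of rounds the last output must still pay for two rounds, the silent one and
   the one that ends with the next output; after an even number one round is left to pay. [T] is
   reserved for the passes after the loop, since no further round need occur. *)
pose phi j := 20 * (n - j) + (1 + par j) * round_cost + T.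
have phiP j : phi j + 10 <= P by rewrite /phi; case: (par j); lia.
pose I j (os : seq (seq nat)) (s' : memory) :=
  [/\ os = [seq [:: q] | q <- iota 0 j & skip q], s' 0 13 = par j,
      forall q, q < n -> s' 9 q = (q < j) && skip q &
      forall z x, z < n -> x < n ->
        s' 8 (z * n + x) = has (fun q => l1 q && marks q z x) (iota 0 j)].
apply: (wpg_for_n M (N := n) (phi := phi) (I := I)) => //.
- by have := phiP 0; lia.
- by split=> // [q _|z x _ _]; rewrite /store /= ?s9 ?s8.
- move=> j os s' jn ag vj [Ios Ipar I9 I8].
  have F b i : ~~ touches singletons b i -> s' b i = s b i by apply: ag.
  have R0 : 40 <= round_cost by rewrite /round_cost; lia.
  have phi6 : 6 <= phi j by rewrite /phi; case: (par j); lia.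
  split=> //.
  have E1 : den s' (Fetch 7 (sc 1)) = l1 j by rewrite /= vj F // s7.
  apply: (wpg_if M) => //=.
  + by rewrite vj; split=> //; apply: (lt_S D).
  + by rewrite /phi; case: (par j); lia.
  rewrite vj F // s7 //; case lj: (l1 j) => /=; last first.
    apply: (@wpg_wp _ _ _ _ _ _ 1 _ (fun s2 => s2 = s')).
    + exact: (wp_seq M).
    + by rewrite /phi; case: (par j); lia.
    move=> _ _ ->; have pS : par j.+1 = par j by rewrite parS lj addbF.
    split; first by rewrite /phi pS; case: (par j); lia.
    have skj : skip j = false by rewrite /skip lj.
    split=> //.
    + by rewrite Ios iota0S filter_rcons skj cats0.
    + by rewrite pS.
    + move=> q qn; rewrite /store /= I9 // [q < j.+1]ltnS [q <= j]leq_eqVlt.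
      by have [->|ne] := eqVneq q j; rewrite // ltnn skj.
    + by move=> z x zn xn; rewrite has_iotaS lj /= orbF /store /= I8.
  apply: wpg_comp; apply: (@wpg_wp _ _ _ _ _ _ (round_cost - 40) _ (fun s2 =>
    forall z x, z < n -> x < n -> s2 8 (z * n + x) =
      has (fun q => l1 q && marks q z x) (iota 0 j.+1))).
  + rewrite /round_cost addnK.
    apply: (wp_mark jn _ _ _ _ I8) => //.
    * by rewrite F.
    * by move=> x xn; have [h1 h2] := lst x xn; split=> [|k kn]; rewrite F // h2.
    * by move=> x y xn yn; rewrite F // adj.
    by move=> s2 ag2 H z x zn xn; rewrite H // has_iotaS lj.
  + by rewrite /phi; case: (par j); lia.
  move=> s2 ag2 H8.
  have F2 b i : ~~ touches mark b i -> s2 b i = s' b i by apply: ag2.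
  apply: (wpg_if M) => //=.
    by rewrite /phi; case: (par j); lia.
  rewrite F2 // Ipar; case pj: (par j) => /=.
    apply: (@wpg_wp _ _ _ _ _ _ 10 _ (fun s3 => s3 = store s2 0 13 0)).
    + by apply: (wp_seq M) => //=; split=> //; lia.
    + by rewrite /phi pj; lia.
    move=> _ _ ->; have pS : par j.+1 = false by rewrite parS lj pj.
    split; first by rewrite /phi pS pj; lia.
    have skj : skip j = false by rewrite /skip lj [odd _]pj.
    split=> //.
    + by rewrite Ios iota0S filter_rcons skj cats0.
    + by rewrite pS.
    + move=> q qn; rewrite /store /= F2 // I9 // [q < j.+1]ltnS [q <= j]leq_eqVlt.
      by have [->|ne] := eqVneq q j; rewrite // ltnn skj.
  apply: wpg_comp.
  pose s3 := store (store s2 0 13 1) 9 j 1.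
  apply: (@wpg_wp _ _ _ _ _ _ 10 _ (fun s4 => s4 = s3)).
  + apply: (wp_seq M) => //=; split=> //; first lia.
    rewrite /store /= F2 // vj; split=> //; last lia.
    by split=> //; apply: (lt_S D).
  + by rewrite /phi pj; lia.
  move=> _ _ ->; apply: (wpg_write M) => //=.
    by rewrite /phi pj; lia.
  have pS : par j.+1 = true by rewrite parS lj pj.
  split; first by have := phiP j.+1; lia.
  have skj : skip j by rewrite /skip lj [odd _]pj.
  split=> //.
  + by rewrite Ios iota0S filter_rcons skj map_rcons /s3 /store /= F2 // vj cats1.
  + by rewrite pS.
  + move=> q qn; rewrite /s3 /store /= ltnS leq_eqVlt.
    have [->|ne] := eqVneq q j; first by rewrite skj.
    by rewrite F2 // I9.
- move=> os s' ag [-> _ I9 I8].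
  have R0 : 40 <= round_cost by rewrite /round_cost; lia.
  split; first by rewrite /phi; case: (par n); lia.
  apply: HG => //; first by rewrite /phi; case: (par n); lia.
  by move=> q qn; rewrite I9 // qn.
Qed.

End Singletons.

(** * Search of an independence system *)

(** A vertex contributes to the counters only while it is covered exactly once. Its contribution is
    taken out before [cov] and [own] change there, and [deposit] puts the new one in afterwards;
    scalar 19 is the 0/1 value of [ok]. *)
Definition withdraw : cmd :=
  If (Bin Eq (Fetch 15 (sc 10)) (Const 1))
    (Comp (set_sc 18 (Fetch 16 (sc 10)))
    (Comp (set_sc 19 (Fetch 14 (idx (sc 18) (sc 10))))
    (Comp (Store 17 (sc 18) (Bin Defs.Sub (Fetch 17 (sc 18)) (sc 19)))
          (set_sc 16 (Bin Defs.Sub (sc 16)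
             (Bin Mul (sc 19) (Bin Eq (Fetch 17 (sc 18)) (Const 0))))))))
    Skip.

Definition deposit : cmd :=
  If (Bin Eq (Fetch 15 (sc 10)) (Const 1))
    (Comp (set_sc 18 (Fetch 16 (sc 10)))
    (Comp (set_sc 19 (Fetch 14 (idx (sc 18) (sc 10))))
    (Comp (set_sc 16 (Bin Add (sc 16)
             (Bin Mul (sc 19) (Bin Eq (Fetch 17 (sc 18)) (Const 0)))))
          (Store 17 (sc 18) (Bin Add (Fetch 17 (sc 18)) (sc 19))))))
    Skip.

Definition update (o : binop) : cmd :=
  For 3 (Fetch 3 (sc 1))
    (Comp (Comp neighbour withdraw)
    (Comp (Comp (Store 15 (sc 10) (Bin o (Fetch 15 (sc 10)) (Const 1)))
                (Store 16 (sc 10) (Bin o (Fetch 16 (sc 10)) (sc 1))))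
          deposit)).

Section Update.
Variables (n : nat) (g okf : nat -> nat -> bool) (S W V : nat).
Hypothesis M : machine S W V.
Hypothesis D : n * n <= S /\ (n + 2) * (n + 2) <= V.
Local Notation wp := (wp S W V).
Local Notation nb := (nb n g).

Lemma count_exchange (P Q : pred nat) (s : seq nat) x :
  uniq s -> x \in s -> (forall y, y != x -> P y = Q y) ->
  count P s + Q x = count Q s + P x.
Proof.
elim: s => //= y s IH /andP[ys us]; rewrite inE => /predU1P[->|xs] PQ.
  suff -> : count P s = count Q s by lia.
  apply: eq_in_count => z zs; apply: PQ.
  by apply: contraNneq ys => <-.
have := IH us xs PQ; rewrite (PQ y); first lia.
by apply: contraNneq ys => ->.
Qed.

Definition privs (cov own : nat -> nat) (x : nat) : nat :=
  count (fun y => [&& cov y == 1, own y == x & okf x y]) (iota 0 n).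

Definition npriv (cov own : nat -> nat) : nat :=
  count (fun x => 0 < privs cov own x) (iota 0 n).

Definition upd (f : nat -> nat) (y v : nat) : nat -> nat :=
  fun z => if z == y then v else f z.

Lemma privs_upd cov own y x : y < n ->
  privs cov own x = privs (upd cov y 0) own x +
    [&& cov y == 1, own y == x & okf x y].
Proof.
move=> yn; have := @count_exchange
  (fun y => [&& cov y == 1, own y == x & okf x y])
  (fun z => [&& upd cov y 0 z == 1, own z == x & okf x z]) (iota 0 n) y.
rewrite /privs {2}/upd eqxx addn0; apply; first exact: iota_uniq.
  by rewrite mem_iota.
by move=> z zy; rewrite /upd (negbTE zy).
Qed.

Lemma privs_ext cov own cov' own' x :
  (forall y, y < n -> cov y = cov' y) ->
  (forall y, y < n -> cov y = 1 -> own y = own' y) ->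
  privs cov own x = privs cov' own' x.
Proof.
move=> Ec Eo; apply: eq_in_count => y; rewrite mem_iota => /andP[_ yn] /=.
by rewrite -Ec //; case: eqP => //= c1; rewrite Eo.
Qed.

Lemma npriv_ext cov own cov' own' :
  (forall x, x < n -> privs cov own x = privs cov' own' x) ->
  npriv cov own = npriv cov' own'.
Proof.
by move=> E; apply: eq_in_count => x; rewrite mem_iota => /andP[_ xn] /=; rewrite E.
Qed.

Lemma privs_le cov own x : privs cov own x <= n.
Proof. by rewrite -[leqRHS](size_iota 0 n) count_size. Qed.

Lemma npriv_le cov own : npriv cov own <= n.
Proof. by rewrite -[leqRHS](size_iota 0 n) count_size. Qed.

Lemma npriv_upd cov own y : y < n -> own y < n -> cov y = 1 ->
  npriv cov own = npriv (upd cov y 0) own +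
    (okf (own y) y && (privs (upd cov y 0) own (own y) == 0)).
Proof.
move=> yn on c1; have pu := privs_upd cov own (own y) yn.
rewrite c1 !eqxx /= in pu.
have : npriv cov own + (0 < privs (upd cov y 0) own (own y)) =
       npriv (upd cov y 0) own + (0 < privs cov own (own y)).
  apply: (@count_exchange (fun x => 0 < privs cov own x)
    (fun x => 0 < privs (upd cov y 0) own x)); first exact: iota_uniq.
    by rewrite mem_iota.
  move=> x xo; rewrite (privs_upd cov own x yn) [own y == x]eq_sym (negbTE xo).
  by rewrite andbF addn0.
rewrite pu; case: (okf _ _) => /=; last by rewrite !addn0 => /addIn ->.
by case: (privs (upd _ _ _) _ _) => [|p] /=; lia.
Qed.

Definition counters (cov own : nat -> nat) (s : memory) : Prop :=
  (forall x, x < n -> s 17 x = privs cov own x) /\ s 0 16 = npriv cov own.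

(** Between [withdraw] and [deposit] the counters describe [upd cov y 0]: a vertex covered zero
    times is private to nobody, so this amounts to leaving [y] out. *)
Lemma wp_withdraw cov own y s (Q : memory -> Prop) :
  y < n -> s 0 0 = n -> s 0 10 = y -> s 15 y = cov y -> s 16 y = own y ->
  (cov y = 1 -> own y < n /\ s 14 (own y * n + y) = okf (own y) y) ->
  counters cov own s ->
  (forall s', agree withdraw s s' -> counters (upd cov y 0) own s' -> Q s') ->
  wp withdraw s 60 Q.
Proof.
move=> yn s0 s10 s15 s16 Hy [C1 C2] HQ; have nV' := nV1 D; have V8 := V8 M.
apply: (wp_mono (leqnn _) (fun s' A _ => HQ s' A)); apply: (wp_seq M) => //.
rewrite /= s10 s15; split; first by split=> //; split=> //; apply: (lt_S D).
case: (cov y =P 1) => c1 /=; last first.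
  have E x : privs (upd cov y 0) own x = privs cov own x.
    by rewrite [RHS](privs_upd _ _ _ yn); case: eqP => // _; rewrite addn0.
  split=> [x xn|]; first by rewrite E C1.
  by rewrite C2; apply: npriv_ext => x _; rewrite E.
have [on ok_y] := Hy c1.
have p_le := privs_le cov own (own y); have np_le := npriv_le cov own.
have pu := privs_upd cov own (own y) yn; rewrite c1 !eqxx /= in pu.
have nu := npriv_upd yn on c1.
have kV : okf (own y) y < V by case: (okf _ _); lia.
rewrite s16; split=> //; first by split=> //; apply: (lt_S D).
  lia.
rewrite /store /= s0 s10 ok_y; split=> //.
  by repeat split=> //; apply: (idx_S D).
rewrite C1 // C2; split=> //.
- by repeat split=> //; apply: (lt_S D).
- by repeat split=> //; apply: (lt_S D).
- lia.
rewrite eqxx; split=> //.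
- by repeat split=> //; apply: (lt_S D).
- by case: (okf _ _) => /=; lia.
split=> /= [x xn|].
  have [->|ne] := eqVneq x (own y).
    by rewrite pu; case: (okf _ _); lia.
  rewrite C1 // (privs_upd _ _ _ yn) [own y == x]eq_sym (negbTE ne) andbF.
  by rewrite addn0.
rewrite nu pu; case: (okf _ _) => /=; last by rewrite mul0n addn0 subn0.
by rewrite addnK mul1n addnK.
Qed.

Lemma wp_deposit cov own y s (Q : memory -> Prop) :
  y < n -> s 0 0 = n -> s 0 10 = y -> s 15 y = cov y -> s 16 y = own y ->
  (cov y = 1 -> own y < n /\ s 14 (own y * n + y) = okf (own y) y) ->
  counters (upd cov y 0) own s ->
  (forall s', agree deposit s s' -> counters cov own s' -> Q s') ->
  wp deposit s 60 Q.
Proof.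
move=> yn s0 s10 s15 s16 Hy [C1 C2] HQ; have nV' := nV1 D; have V8 := V8 M.
apply: (wp_mono (leqnn _) (fun s' A _ => HQ s' A)); apply: (wp_seq M) => //.
rewrite /= s10 s15; split; first by split=> //; split=> //; apply: (lt_S D).
case: (cov y =P 1) => c1 /=; last first.
  have E x : privs (upd cov y 0) own x = privs cov own x.
    by rewrite [RHS](privs_upd _ _ _ yn); case: eqP => // _; rewrite addn0.
  split=> [x xn|]; first by rewrite -E C1.
  by rewrite C2; apply: npriv_ext => x _; rewrite E.
have [on ok_y] := Hy c1.
have p_le := privs_le cov own (own y); have np_le := npriv_le cov own.
have pu := privs_upd cov own (own y) yn; rewrite c1 !eqxx /= in pu.
have nu := npriv_upd yn on c1.
have kV : okf (own y) y < V by case: (okf _ _); lia.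
rewrite s16; split=> //; first by split=> //; apply: (lt_S D).
  lia.
rewrite /store /= s0 s10 ok_y; split=> //.
  by repeat split=> //; apply: (idx_S D).
rewrite C1 // C2 mulnb -nu; split=> //.
- by repeat split=> //; apply: (lt_S D).
- lia.
rewrite -pu; split=> //.
- by repeat split=> //; apply: (lt_S D).
- by repeat split=> //; apply: (lt_S D).
- lia.
split=> //= x xn.
have [->//|ne] := eqVneq x (own y).
rewrite C1 // [RHS](privs_upd _ _ _ yn) [own y == x]eq_sym (negbTE ne) andbF.
by rewrite addn0.
Qed.

Lemma counters_ext cov own cov' own' s s' :
  (forall y, y < n -> cov y = cov' y) ->
  (forall y, y < n -> cov y = 1 -> own y = own' y) ->
  (forall x, x < n -> s' 17 x = s 17 x) -> s' 0 16 = s 0 16 ->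
  counters cov own s -> counters cov' own' s'.
Proof.
move=> Ec Eo E17 E16 [C1 C2]; have E x := privs_ext x Ec Eo.
split=> [x xn|]; first by rewrite E17 // C1.
by rewrite E16 C2; apply: npriv_ext => x _.
Qed.

Definition state (cov own : nat -> nat) (s : memory) : Prop :=
  [/\ forall y, y < n -> s 15 y = cov y, forall y, y < n -> s 16 y = own y &
      counters cov own s].

Lemma wp_update o cov own i s (Q : memory -> Prop) :
  let cov' y := if g i y then binop_eval o (cov y) 1 else cov y in
  let own' y := if g i y then binop_eval o (own y) i else own y in
  i < n -> s 0 0 = n -> s 0 1 = i -> lists_ok n g s ->
  (forall x y, x < n -> y < n -> s 14 (x * n + y) = okf x y) ->
  (forall y, y < n -> cov y = 1 -> own y < n) ->
  (forall y, y < n -> cov' y = 1 -> own' y < n) ->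
  (forall y, y < n -> cov' y < V /\ own' y < V) ->
  state cov own s ->
  (forall s', agree (update o) s s' -> state cov' own' s' -> Q s') ->
  wp (update o) s (200 * size (nb i) + 20) Q.
Proof.
move=> cov' own' i_n s0 s1 lst s14 val val' bnd' st HQ.
have nV' := nV1 D; have V8 := V8 M.
pose covj j y := if y \in take j (nb i) then binop_eval o (cov y) 1 else cov y.
pose ownj j y := if y \in take j (nb i) then binop_eval o (own y) i else own y.
pose J j := state (covj j) (ownj j).
have sub_nb j y : y \in take j (nb i) -> g i y.
  by move/mem_take; rewrite mem_nb => /andP[].
have valj j y : y < n -> covj j y = 1 -> ownj j y < n.
  move=> yn; rewrite /covj /ownj; case: ifP => [yt|_]; last exact: val.
  by have := val' y yn; rewrite /cov' /own' (sub_nb j).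
apply: (wp_for_nb M D (x := i) (g := g) (c := 180) (I := J)) => //.
- by case: (lst i i_n).
- lia.
- case: st => h1 h2 h3; split=> [y yn|y yn|].
  + by rewrite /covj take0 /store /= h1.
  + by rewrite /ownj take0 /store /= h2.
  + by apply: counters_ext h3; rewrite // /covj /ownj take0.
- move=> j s2 jn ag bs2 vj [J1 J2 J3].
  have F b k : ~~ touches (update o) b k -> s2 b k = s b k by apply: ag.
  have [yn iy tk] := nth_nb jn; set y := nth 0 (nb i) j in yn iy tk.
  have yt : y \notin take j (nb i).
    have : uniq (take j.+1 (nb i)) by rewrite take_uniq // uniq_nb.
    by rewrite tk rcons_uniq => /andP[].
  have jn' : j < n by apply: leq_trans (size_nb n g i).
  have E2 : s 2 (i * n + j) = y by case: (lst i i_n) => _ ->.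
  have cy : covj j y = cov y by rewrite /covj (negbTE yt).
  have oy : ownj j y = own y by rewrite /ownj (negbTE yt).
  have cov'y : cov' y = binop_eval o (cov y) 1 by rewrite /cov' iy.
  have own'y : own' y = binop_eval o (own y) i by rewrite /own' iy.
  have covS z : covj j.+1 z = upd (covj j) y (cov' y) z.
    rewrite /covj tk mem_rcons inE /upd; have [->|] //= := eqVneq z y.
  have ownS z : ownj j.+1 z = upd (ownj j) y (own' y) z.
    rewrite /ownj tk mem_rcons inE /upd; have [->|] //= := eqVneq z y.
  have [bc bo] := bnd' y yn.
  apply: (@wp_then _ _ _ 80 100); first by [].
  apply: (@wp_then _ _ _ 20 60); first by [].
  apply: (wp_seq M) => //=; rewrite vj !F // s0 s1 E2; split=> //.
  + by repeat split=> //; apply: (idx_S D).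
  + lia.
  set s3 := store _ _ _ _.
  have F3 b k : b != 0 -> s3 b k = s2 b k.
    by rewrite /s3 /store => /negbTE ->.
  apply: (@wp_withdraw (covj j) (ownj j) y) => //.
  + by rewrite /s3 /store /= F.
  + by rewrite F3 // J1.
  + by rewrite F3 // J2.
  + move=> c1; have on := valj _ _ yn c1; split=> //.
    by rewrite F3 // F // s14.
  move=> s4 ag4 C4.
  have F4 b k : ~~ touches withdraw b k -> b != 0 -> s4 b k = s2 b k.
    by move=> H b0; rewrite ag4 // F3.
  have G0 : s4 0 0 = n by rewrite ag4 // /s3 /store /= F.
  have G1 : s4 0 1 = i by rewrite ag4 // /s3 /store /= F.
  have G10 : s4 0 10 = y by rewrite ag4.
  apply: (@wp_then _ _ _ 40 60); first by [].
  apply: (wp_seq M) => //=; rewrite G10 F4 // J1 // cy -cov'y; split=> //.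
    by split=> //; apply: (lt_S D).
    by repeat split=> //; apply: (lt_S D).
  rewrite /store /= G10 G1 F4 // J2 // oy -own'y; split=> //.
  + by split=> //; apply: (lt_S D).
  + by repeat split=> //; apply: (lt_S D).
  set s5 := (fun b => _).
  have F5 b k : b != 15 -> b != 16 -> s5 b k = s4 b k.
    by rewrite /s5 => /negbTE -> /negbTE ->.
  have H15 z : z < n -> s5 15 z = covj j.+1 z.
    move=> zn; rewrite /s5 /= covS /upd; case: ifP => // _.
    by rewrite F4 // J1.
  have H16 z : z < n -> s5 16 z = ownj j.+1 z.
    move=> zn; rewrite /s5 /= ownS /upd; case: ifP => // _.
    by rewrite F4 // J2.
  apply: (@wp_deposit (covj j.+1) (ownj j.+1) y) => //.
  + by rewrite H15.
  + by rewrite H16.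
  + move=> c1; have on := valj _ _ yn c1; split=> //.
    by rewrite F5 // F4 // F // s14.
  + apply: counters_ext C4 => [z zn|z zn|x xn|].
    * by rewrite /upd covS /upd; case: eqP.
    * by rewrite /upd ownS /upd; case: eqP.
    * by rewrite F5.
    * by rewrite F5.
  move=> s6 ag6 C6; split=> [z zn|z zn|].
  + by rewrite /store /= ag6 // H15.
  + by rewrite /store /= ag6 // H16.
  + exact: counters_ext C6.
- move=> s' ag; rewrite /J /covj /ownj take_size => -[h1 h2 h3]; apply: HQ => //.
  have E y : y < n -> (y \in nb i) = g i y by rewrite mem_nb => ->.
  split=> [y yn|y yn|].
  + by rewrite h1 // E.
  + by rewrite h2 // E.
  + by apply: counters_ext h3 => // y yn; rewrite E.
Qed.

End Update.

Definition next : cmd := set_sc 1 (Bin Add (sc 1) (Const 1)).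

Definition output_stack : cmd :=
  Comp (For 3 (sc 15) (Write (Fetch 18 (sc 3)))) Emit.

Definition accept : cmd :=
  Comp (Comp (Store 18 (sc 15) (sc 1)) (set_sc 15 (Bin Add (sc 15) (Const 1))))
    (If (Bin Mul (Bin Eq (sc 15) (Const 1)) (Fetch 9 (sc 1)))
        Skip output_stack).

Definition try : cmd :=
  Comp (update Add)
    (If (Bin Eq (sc 16) (Bin Add (sc 15) (Const 1))) accept (update Defs.Sub)).

Definition backtrack : cmd :=
  Comp (Comp (set_sc 15 (Bin Defs.Sub (sc 15) (Const 1)))
             (set_sc 1 (Fetch 18 (sc 15))))
       (Comp (update Defs.Sub) next).

Definition search_body : cmd :=
  If (Bin Lt (sc 1) (sc 0))
     (Comp (If (Fetch 10 (sc 1)) try Skip) next)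
     (If (Bin Eq (sc 15) (Const 0)) (set_sc 17 (Const 1)) backtrack).

Definition search : cmd := While (Bin Eq (sc 17) (Const 0)) search_body.

(** * The search: feasibility, potential and simulation *)

Section Search.
Variables (n : nat) (g okf : nat -> nat -> bool) (redf skipf : nat -> bool).
Variables (S W V P : nat).
Hypothesis g_sym : symmetric g.
Hypothesis M : machine S W V.
Hypothesis D : n * n <= S /\ (n + 2) * (n + 2) <= V.
Local Notation wp := (wp S W V).
Local Notation wpg := (wpg P S W V).
Local Notation nb := (nb n g).
Local Notation degree_sum := (degree_sum n g).

Definition hits (A : seq nat) (y : nat) : seq nat := [seq x <- A | g y x].
Definition cov (A : seq nat) (y : nat) : nat := size (hits A y).
(* Meaningful when cov A y = 1: it is then the only element of A adjacent to y.
   Unlike an owner, a sum can be updated when an element is removed. *)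
Definition own (A : seq nat) (y : nat) : nat := sumn (hits A y).

Definition private (A : seq nat) (x y : nat) : bool :=
  (hits A y == [:: x]) && okf x y.

Definition feasible (A : seq nat) : bool :=
  all (fun x => has (private A x) (iota 0 n)) A.

Lemma hits1 A y x : (cov A y == 1) && (own A y == x) = (hits A y == [:: x]).
Proof.
rewrite /cov /own; case: (hits A y) => [|z [|z' s]]; rewrite /= ?addn0 ?eqseq_cons ?andbT //.
by rewrite andbF.
Qed.

(** Only elements of [A] can have a private neighbour, so all of them have one exactly when the
    number of vertices having one reaches the size of [A]. *)
Lemma npriv_feasible A : uniq A -> all (gtn n) A ->
  (npriv n okf (cov A) (own A) == size A) = feasible A.
Proof.
move=> uA An.
have E x : (0 < privs n okf (cov A) (own A) x) = has (private A x) (iota 0 n).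
  rewrite -has_count; apply: eq_has => y; by rewrite andbA hits1.
have -> : npriv n okf (cov A) (own A) =
    count (fun x => has (private A x) (iota 0 n)) A.
  rewrite /npriv; have /permP -> : perm_eq A [seq x <- iota 0 n | x \in A].
    apply: uniq_perm; rewrite ?filter_uniq ?iota_uniq // => x.
    rewrite mem_filter mem_iota /=; have [xA|//] := boolP (x \in A).
    by have /= := allP An x xA.
  rewrite count_filter; apply: eq_count => x /=; rewrite E.
  have [xA|xA] := boolP (x \in A); first by rewrite andbT.
  rewrite andbF; apply/negbTE/hasP => -[y _ /andP[/eqP Eh _]].
  have : x \in hits A y by rewrite Eh mem_head.
  by rewrite mem_filter (negbTE xA) andbF.
by rewrite /feasible all_count.
Qed.

(** A private neighbour [y] of [x] for [B] remains one for [A]: [hits A y] is a subsequence of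
    [[:: x]] that contains [x]. *)
Lemma feasible_subseq A B : subseq A B -> feasible B -> feasible A.
Proof.
move=> sAB /allP fB; apply/allP => x xA.
have /hasP[y yn /andP[/eqP hy okxy]] := fB x (mem_subseq sAB xA).
apply/hasP; exists y => //; rewrite /private okxy andbT.
have : subseq (hits A y) [:: x].
  rewrite -hy subseq_filter filter_all.
  exact: subseq_trans (filter_subseq _ _) sAB.
have : x \in hits A y.
  rewrite mem_filter xA andbT.
  have : x \in hits B y by rewrite hy mem_head.
  by rewrite mem_filter => /andP[].
case: (hits A y) => [|z [|z' s]] // xz /size_subseq // _.
by move: xz; rewrite inE => /eqP ->.
Qed.

Definition admissible (A : seq nat) (i : nat) : bool :=
  redf i && feasible (i :: A).

(* A stack lists its elements in decreasing order, an output in increasing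
   order. *)
Fixpoint explore (d : nat) (A : seq nat) (i : nat) : seq (seq nat) :=
  if d is d'.+1 then
    if admissible A i then
      (if (A == [::]) && skipf i then [::] else [:: rev (i :: A)]) ++
      explore d' (i :: A) i.+1 ++ explore d' A i.+1
    else explore d' A i.+1
  else [::].

(** A rejected candidate is added and removed again, which means two calls of [update] at
    [200 * size (nb j) + 20] each. *)
Definition scan_cost (i : nat) : nat :=
  \sum_(i <= j < n) (400 * size (nb j) + 150).
Definition out_cost : nat := 40 * (n + 1).
Definition pop_cost : nat := 200 * n + 150.
Definition spare : nat := scan_cost 0 + out_cost + pop_cost.

Definition extendable (A : seq nat) (i : nat) : bool :=
  has (admissible A) (iota i (n - i)).

(** The case without candidates counts as unskipped, since the search at the empty stack then
    terminates. *)
Definition unskipped (i : nat) : bool :=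
  if [seq j <- iota i (n - i) | redf j] is j :: _ then ~~ skipf j else true.

(* Bounds the time to the next output (or to termination) when the search is
   about to try i on the stack A: it scans the remaining candidates and, if no
   one can be added, removes the top of the stack and continues above it. *)
Fixpoint potential (A : seq nat) (i : nat) : nat :=
  if A is a :: A' then
    scan_cost i + (if extendable A i then out_cost
                   else pop_cost + potential A' a.+1)
  else scan_cost i + out_cost + pop_cost + (if unskipped i then 0 else spare).

Hypothesis feasible1 : forall i, i < n -> redf i -> feasible [:: i].
Hypothesis skip_next : forall i, i < n -> skipf i -> unskipped i.+1.
Hypothesis P_ge : 7 * spare + 6 <= P.

Lemma scan_costS i : i < n ->
  scan_cost i = (400 * size (nb i) + 150) + scan_cost i.+1.
Proof. by move=> i_n; rewrite /scan_cost big_ltn. Qed.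

Lemma scan_cost_le i : i <= n -> scan_cost i <= scan_cost 0.
Proof. by move=> i_n; rewrite /scan_cost [leqRHS](@big_cat_nat _ _ _ i) //= leq_addl. Qed.

Lemma scan_cost_n : scan_cost n = 0.
Proof. by rewrite /scan_cost big_geq. Qed.

Lemma iota_sub i : i < n -> iota i (n - i) = i :: iota i.+1 (n - i.+1).
Proof. by move=> i_n; rewrite subnS; case: (n - i) (subn_gt0 i n) => [|m]; rewrite i_n. Qed.

Lemma extendableS A i : i < n ->
  extendable A i = admissible A i || extendable A i.+1.
Proof. by move=> i_n; rewrite /extendable iota_sub. Qed.

(* Popping two elements b < a of the stack leaves a candidate, namely a. *)
Lemma extendable_pop A a b : b < a -> a < n -> redf a ->
  feasible [:: a, b & A] -> extendable A b.+1.
Proof.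
move=> ba an ra fA; apply/hasP; exists a; first by rewrite mem_iota; lia.
rewrite /admissible ra (feasible_subseq _ fA) //=.
by rewrite eqxx; apply: subseq_cons.
Qed.

Definition stack_ok (A : seq nat) (i : nat) : bool :=
  [&& feasible A, all redf A, sorted gtn A, all (gtn i) A & i <= n].

Lemma potential_nil_le i : i <= n -> potential [::] i <= 2 * spare.
Proof.
by move=> /scan_cost_le; rewrite /= /spare; case: (unskipped i); lia.
Qed.

(** The recursion of [potential] stops early. After two pops [extendable_pop] provides a candidate
    if the stack is still nonempty, and [potential_nil_le] takes over when it is empty; each level
    costs at most [spare]. *)
Lemma potential_le A i : stack_ok A i -> potential A i + 6 <= P.
Proof.
move=> H; apply: leq_trans P_ge; rewrite leq_add2r; move: H; case: A => [|a A] /and5P[fA rA sA iA i_n].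
  by have := potential_nil_le i_n; lia.
have an : a < n by case/andP: iA => /= ai _; lia.
have si := scan_cost_le i_n; have sa := scan_cost_le an.
rewrite /=; case: (extendable _ i); first by rewrite /spare; lia.
case: A fA rA sA iA => [|b A] fA rA sA iA.
  by have := potential_nil_le an; rewrite /spare in sa *; lia.
have ba : b < a by case/andP: sA.
have ra : redf a by case/andP: rA.
have sb : scan_cost b.+1 <= scan_cost 0 by apply: scan_cost_le; lia.
rewrite /=; case: (extendable _ a.+1); first by rewrite /spare; lia.
have ext := extendable_pop ba an ra fA.
case: A {fA rA sA iA} ext => [|c A] ext.
  have : potential [::] b.+1 <= 2 * spare by apply: potential_nil_le; lia.
  by rewrite /spare; lia.
by rewrite [potential (c :: A) _]/= ext /spare; lia.
Qed.

(** An output is a single step of [gk], separator included, so the loop of writes is executed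
    directly and only the finished segment is handed to [gk_out]. *)
Lemma wpg_output A s p (G : seq (seq nat) -> memory -> nat -> Prop) :
  size A <= n -> s 0 15 = size A ->
  (forall k, k < size A -> s 18 k = nth 0 (rev A) k) -> out_cost <= p ->
  (forall s', agree output_stack s s' -> G [:: rev A] s' P) ->
  wpg output_stack s p G.
Proof.
move=> An s15 s18 Ep HG bs; have nV' := nV1 D; have V8 := V8 M.
have S64 := S64 M.
pose body := Write (Fetch 18 (sc 3)).
pose inc := set_sc 3 (Bin Add (sc 3) (Const 1)).
pose L := While (Bin Lt (sc 3) (sc 15)) (Comp body inc).
have loop m : forall j s', j + m = size A -> agree output_stack s s' ->
    bounded V s' -> s' 0 3 = j ->
    exists w s2, [/\ exec S W L s' w s2, bounded V s2, all not_sep w,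
      written w = drop j (rev A) & size w <= 16 * m + 6].
  elim: m => [|m IH] j s' jm ag bs' vj.
    exists (ticks 6), s'; split=> //.
    - apply: ExecWhileStop; rewrite (eval_den M bs') //=.
      by rewrite vj ag // s15; have -> : j < size A = false by lia.
    - by rewrite drop_oversize // size_rev; lia.
  have jA : j < size A by lia.
  pose s2 := store s' 0 3 j.+1.
  have E1 : exec S W body s' (ticks 3 ++ [:: Out (nth 0 (rev A) j)]) s'.
    have -> : nth 0 (rev A) j = den s' (Fetch 18 (sc 3)).
      by rewrite /= vj ag // s18.
    apply: ExecWrite; apply: (eval_den M bs') => //=.
    by rewrite vj; split=> //; apply: (lt_S D); lia.
  have E2 : exec S W inc s' (ticks 6) s2.
    have -> : s2 = store s' 0 3 (den s' (Bin Add (sc 3) (Const 1))).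
      by rewrite /= vj addn1.
    apply: ExecStore; first by rewrite (eval_den M).
      by rewrite (eval_den M).
    lia.
  have bs2 : bounded V s2.
    by move=> b' j'; rewrite /s2 /store; case: ifP => // _; lia.
  have ag2 : agree output_stack s s2.
    apply: agree_trans ag _.
    by apply: agree_sub (exec_agree E2) => b' j' /= ->; rewrite ?orbT.
  have [w [s3 [E3 bs3 nw ww sw]]] := IH j.+1 s2 ltac:(lia) ag2 bs2 erefl.
  exists (ticks 6 ++ ((ticks 3 ++ [:: Out (nth 0 (rev A) j)]) ++ ticks 6) ++ w), s3.
  split=> //.
  - apply: ExecWhileStep (ExecComp E1 E2) E3; first by rewrite (eval_den M bs').
    by rewrite /= vj ag // s15 jA.
  - rewrite !written_cat !written_ticks ww cats0 /=.
    by rewrite [RHS](drop_nth 0) // size_rev.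
  - by rewrite !size_cat !size_nseq /=; lia.
pose s1 := store s 0 3 0.
have E0 : exec S W (set_sc 3 (Const 0)) s (ticks 3) s1.
  by apply: ExecStore; rewrite ?(eval_den M) //=; lia.
have bs1 : bounded V s1.
  by move=> b' j'; rewrite /s1 /store; case: ifP => // _; lia.
have ag0 : agree output_stack s s1.
  by apply: agree_sub (exec_agree E0) => b' j' /= ->.
have [w [s2 [E1 bs2 nw ww sw]]] := loop (size A) 0 s1 (add0n _) ag0 bs1 erefl.
have E : exec S W output_stack s ((ticks 3 ++ w) ++ [:: Sep]) s2.
  exact: ExecComp (ExecComp E0 E1) (ExecEmit _ _ _).
exists ((ticks 3 ++ w) ++ [:: Sep]), s2, [:: rev A], P; split=> //.
  have -> : [:: rev A] = [:: written (ticks 3 ++ w)].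
    by rewrite written_cat written_ticks ww drop0.
  rewrite [_ ++ [:: Sep]]cats1; apply: gk_out.
    by move: Ep; rewrite /out_cost size_cat size_nseq; lia.
  by rewrite all_cat all_nseq nw orbT.
by apply: HG; apply: exec_agree E.
Qed.

Lemma cov_cons A i y : cov (i :: A) y = g i y + cov A y.
Proof. by rewrite /cov /hits /= g_sym; case: (g i y). Qed.

Lemma own_cons A i y : own (i :: A) y = (if g i y then i else 0) + own A y.
Proof. by rewrite /own /hits /= g_sym; case: (g i y). Qed.

Lemma cov_le A y : cov A y <= size A.
Proof. by rewrite /cov size_filter count_size. Qed.

Lemma own_le A y : all (gtn n) A -> own A y <= size A * n.
Proof.
elim: A => //= x A IH /andP[xn /IH le]; rewrite own_cons mulSn leq_add //.
by case: ifP => // _; lia.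
Qed.

Lemma own_lt A y : all (gtn n) A -> cov A y = 1 -> own A y < n.
Proof.
move=> /allP An c1; have := hits1 A y (own A y); rewrite c1 !eqxx => /esym/eqP h.
have : own A y \in hits A y by rewrite h mem_head.
by rewrite mem_filter => /andP[_ /An].
Qed.

Lemma stack_uniq_push A i : stack_ok A i -> uniq (i :: A).
Proof.
case/and5P=> _ _ sA /allP iA _ /=; apply/andP; split.
  by apply/negP => /iA /=; rewrite ltnn.
by apply: sorted_uniq sA; [move=> x y z /=; lia|move=> x /=; rewrite ltnn].
Qed.

Lemma stack_size A i : stack_ok A i -> size A <= i.
Proof.
move=> okA; have /andP[_ uA] := stack_uniq_push okA.
case/and5P: okA => _ _ _ /allP iA _; rewrite -[i](size_iota 0); apply: uniq_leq_size => // x /iA /=.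
by rewrite mem_iota.
Qed.

Lemma stack_lt A i : stack_ok A i -> all (gtn n) A.
Proof.
case/and5P=> _ _ _ /allP iA i_n; apply/allP => x /iA /=; lia.
Qed.

Variable s0 : memory.
Hypotheses (s0n : s0 0 0 = n) (s0l : lists_ok n g s0).
Hypothesis s0red : forall x, x < n -> s0 10 x = redf x.
Hypothesis s0skip : forall x, x < n -> s0 9 x = skipf x.
Hypothesis s0ok : forall x y, x < n -> y < n -> s0 14 (x * n + y) = okf x y.

Definition at_node (A : seq nat) (i : nat) (s : memory) : Prop :=
  [/\ agree search s0 s, s 0 1 = i, s 0 15 = size A, s 0 17 = 0 &
   (forall k, k < size A -> s 18 k = nth 0 (rev A) k) /\
   state n okf (cov A) (own A) s].

Lemma state_ext c o c' o' s s' :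
  (forall y, y < n -> c y = c' y) -> (forall y, y < n -> o y = o' y) ->
  (forall b k, b \in [:: 15; 16; 17] -> s' b k = s b k) -> s' 0 16 = s 0 16 ->
  state n okf c o s -> state n okf c' o' s'.
Proof.
move=> Ec Eo E E16 [h1 h2 h3]; split=> [y yn|y yn|].
- by rewrite E // h1 // Ec.
- by rewrite E // h2 // Eo.
- by apply: counters_ext h3 => // [y yn _|x xn]; [apply: Eo|apply: E].
Qed.

Lemma wp_add A i s (Q : memory -> Prop) : stack_ok A i -> i < n -> at_node A i s ->
  (forall s', agree (update Add) s s' ->
     state n okf (cov (i :: A)) (own (i :: A)) s' -> Q s') ->
  wp (update Add) s (200 * size (nb i) + 20) Q.
Proof.
move=> okA i_n [ag s1 s15 s17 [s18 st]] HQ.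
have F b k : ~~ touches search b k -> s b k = s0 b k by apply: ag.
have An := stack_lt okA; have sA := stack_size okA.
have nV' := nV D; have V8 := V8 M.
have Ec y : (if g i y then binop_eval Add (cov A y) 1 else cov A y) =
            cov (i :: A) y.
  by rewrite cov_cons; case: (g i y); rewrite //= addnC.
have Eo y : (if g i y then binop_eval Add (own A y) i else own A y) =
            own (i :: A) y.
  by rewrite own_cons; case: (g i y); rewrite //= addnC.
have An' : all (gtn n) (i :: A) by rewrite /= i_n.
apply: (wp_update (okf := okf) M D (cov := cov A) (own := own A)) => //.
- by rewrite F.
- by move=> x xn; have [h1 h2] := s0l xn; split=> [|k kn]; rewrite F // h2.
- by move=> x y xn yn; rewrite F // s0ok.
- by move=> y yn; apply: own_lt.
- by move=> y yn; rewrite Ec Eo; apply: own_lt.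
- move=> y yn; rewrite Ec Eo; have /= cl := cov_le (i :: A) y.
  have /= ol := own_le y An'; split; first by apply: leq_trans nV'; nia.
  by apply: leq_trans nV'; nia.
- move=> s' ag' st'; apply: HQ => //.
  by apply: state_ext st'.
Qed.

Lemma wp_remove A i s (Q : memory -> Prop) : i < n -> all (gtn n) (i :: A) ->
  size A < n -> agree search s0 s -> s 0 1 = i ->
  state n okf (cov (i :: A)) (own (i :: A)) s ->
  (forall s', agree (update Defs.Sub) s s' ->
     state n okf (cov A) (own A) s' -> Q s') ->
  wp (update Defs.Sub) s (200 * size (nb i) + 20) Q.
Proof.
move=> i_n An' sA ag s1 st HQ.
have F b k : ~~ touches search b k -> s b k = s0 b k by apply: ag.
have nV' := nV D; have V8 := V8 M.
have An : all (gtn n) A by case/andP: An'.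
have Ec y : (if g i y then binop_eval Defs.Sub (cov (i :: A) y) 1
             else cov (i :: A) y) = cov A y.
  by rewrite cov_cons; case: (g i y); rewrite //= addKn.
have Eo y : (if g i y then binop_eval Defs.Sub (own (i :: A) y) i
             else own (i :: A) y) = own A y.
  by rewrite own_cons; case: (g i y); rewrite //= addKn.
apply: (wp_update (okf := okf) M D (cov := cov (i :: A)) (own := own (i :: A))) => //.
- by rewrite F.
- by move=> x xn; have [h1 h2] := s0l xn; split=> [|k kn]; rewrite F // h2.
- by move=> x y xn yn; rewrite F // s0ok.
- by move=> y yn; apply: own_lt.
- by move=> y yn; rewrite Ec Eo; apply: own_lt.
- move=> y yn; rewrite Ec Eo; have /= cl := cov_le A y.
  have /= ol := own_le y An; split; first by apply: leq_trans nV'; nia.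
  by apply: leq_trans nV'; nia.
- move=> s' ag' st'; apply: HQ => //.
  by apply: state_ext st'.
Qed.

Lemma unskippedS i : i < n -> ~~ redf i -> unskipped i = unskipped i.+1.
Proof. by move=> i_n nr; rewrite /unskipped iota_sub //= (negbTE nr). Qed.

Lemma potential_reject A i : i < n -> ~~ admissible A i ->
  potential A i.+1 + (400 * size (nb i) + 150) <= potential A i.
Proof.
move=> i_n nadm; case: A nadm => [|a A] nadm /=; rewrite (scan_costS i_n).
  have nr : ~~ redf i.
    by apply: contra nadm => ri; rewrite /admissible ri feasible1.
  by rewrite (unskippedS i_n nr); lia.
by rewrite (extendableS _ i_n) (negbTE nadm) /=; lia.
Qed.

Lemma potential_accept A i : i < n -> admissible A i ->
  (400 * size (nb i) + 150) + out_cost <= potential A i.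
Proof.
move=> i_n adm; case: A adm => [|a A] adm /=; rewrite (scan_costS i_n); first lia.
by rewrite (extendableS _ i_n) adm /=; lia.
Qed.

(** The additional [spare] at a root whose next candidate is skipped pays for the detour through
    [[:: i]]; upon return [skip_next] guarantees a candidate that is output, or the end. *)
Lemma potential_skip i : i < n -> redf i -> skipf i ->
  potential [:: i] i.+1 + (400 * size (nb i) + 150) <= potential [::] i.
Proof.
move=> i_n ri ki; rewrite /= skip_next //.
have -> : unskipped i = false by rewrite /unskipped iota_sub //= ri ki.
have s1 : scan_cost i.+1 <= scan_cost 0 by apply: scan_cost_le; lia.
rewrite (scan_costS i_n) /spare; case: (extendable _ _); lia.
Qed.

Lemma potential_pop i A : potential (i :: A) n = pop_cost + potential A i.+1.
Proof. by rewrite /= scan_cost_n /extendable subnn. Qed.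

Lemma stack_ok_push A i : i < n -> stack_ok A i -> admissible A i ->
  stack_ok (i :: A) i.+1.
Proof.
move=> i_n /and5P[fA rA sA iA _] /andP[ri fi]; rewrite /stack_ok fi /= ri rA.
rewrite ltnSn i_n; apply/and3P; split=> //; last first.
  by rewrite andbT; apply: sub_all iA => x /=; lia.
by case: A sA iA {fA rA fi} => //= a A -> /andP[->].
Qed.

Lemma stack_okS A i : i < n -> stack_ok A i -> stack_ok A i.+1.
Proof.
move=> i_n /and5P[fA rA sA iA _]; apply/and5P; split=> //.
by apply: sub_all iA => x /=; lia.
Qed.

Definition reach (s : memory) (p : nat) (os : seq (seq nat)) : Prop :=
  bounded V s -> exists u s' r, exec S W search s u s' /\ gk P p os u r.

Lemma reach_mono s p p' os : p <= p' -> reach s p os -> reach s p' os.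
Proof.
move=> pp R bs; have [u [s' [r [E g']]]] := R bs.
by exists u, s', r; split=> //; apply: gk_strengthen g'.
Qed.

Lemma reach_stop s p : s 0 17 = 1 -> 5 <= p -> reach s p [::].
Proof.
move=> s17 p5 bs; exists (ticks 5), s, (p - 5); split.
  by apply: ExecWhileStop; rewrite (eval_den M bs) //= s17.
by apply: gk_ticks; lia.
Qed.

Lemma reach_step s p os : s 0 17 = 0 -> 5 <= p ->
  wpg search_body s (p - 5) (fun os1 s1 r1 =>
    exists os2, os = os1 ++ os2 /\ reach s1 r1 os2) ->
  reach s p os.
Proof.
move=> s17 p5 H bs.
have [u1 [s1 [os1 [r1 [E1 g1 bs1 [os2 [-> R]]]]]]] := H bs.
have [u2 [s2 [r2 [E2 g2]]]] := R bs1.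
have Ev : eval S W s (Bin Eq (sc 17) (Const 0)) = Some 1.
  by rewrite (eval_den M bs) //= s17.
exists (ticks 5 ++ u1 ++ u2), s2, r2; split.
  exact: ExecWhileStep Ev _ E1 E2.
rewrite -(subnKC p5); apply: gk_silent.
exact: gk_cat g1 g2.
Qed.

Lemma search_exit s r : at_node [::] n s -> 40 <= r -> reach s r [::].
Proof.
move=> [ag s1 s15 s17 _] r40; have V8 := V8 M.
apply: reach_step => //; first lia.
apply: (wpg_if M) => //=; first lia.
rewrite s1 ag // s0n ltnn /=; apply: (wpg_if M) => //=; first lia.
rewrite s15 /=; apply: (@wpg_wp _ _ _ _ _ _ 3 _ (fun s' => s' 0 17 = 1)).
- by apply: (wp_seq M) => //=; split=> //; lia.
- lia.
- by move=> s' _ s'17; exists [::]; split=> //; apply: reach_stop => //; lia.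
Qed.

Lemma at_node_next A i s s1 : agree search s0 s -> agree search s s1 ->
  s1 0 1 = i -> s1 0 15 = size A -> s1 0 17 = 0 ->
  (forall k, k < size A -> s1 18 k = nth 0 (rev A) k) ->
  state n okf (cov A) (own A) s1 ->
  at_node A i.+1 (store s1 0 1 i.+1).
Proof.
move=> ag ag1 e1 e15 e17 e18 st; split=> //.
  apply: agree_trans ag _; apply: agree_trans ag1 _ => b j /= H.
  rewrite /store; case: andP => // -[/eqP E1 /eqP E2].
  by move: H; rewrite E1 E2.
Qed.

Lemma sub_update o b j : touches (update o) b j -> touches search b j.
Proof. by case: o => /=; repeat case/orP; move=> H; rewrite H ?orbT. Qed.

Lemma sub_output b j : touches output_stack b j -> touches search b j.
Proof. by rewrite /=; repeat case/orP; move=> H; rewrite H ?orbT. Qed.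

Lemma search_pop A i s r os : stack_ok (i :: A) i.+1 -> i < n ->
  at_node (i :: A) n s -> pop_cost <= r ->
  (forall s', at_node A i.+1 s' -> reach s' (r - pop_cost) os) ->
  reach s r os.
Proof.
move=> okA i_n nd pr HR; have [ag s1 s15 s17 [s18 st]] := nd.
have nV' := nV1 D; have V8 := V8 M; have S64 := S64 M.
have sA := stack_size okA; rewrite /= in sA.
have dn : 200 * size (nb i) + 20 <= pop_cost - 100.
  by rewrite /pop_cost; have := size_nb n g i; lia.
have pc : 150 <= pop_cost by rewrite /pop_cost; lia.
apply: reach_step => //; first lia.
apply: (wpg_if M) => //=; first lia.
rewrite s1 ag // s0n ltnn /=.
apply: (wpg_if M) => //=; first lia.
rewrite s15 /=.
apply: (@wpg_wp _ _ _ _ _ _ (pop_cost - 40) _ (fun s' => at_node A i.+1 s')).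
- apply: (@wp_then _ _ _ 20 (pop_cost - 60)); first lia.
  apply: (wp_seq M) => //=; rewrite s15 subn1 /=; split=> //; first lia.
  rewrite /store /=; split=> //.
  + by split=> //; apply: (lt_S D); lia.
  + by rewrite s18 //= rev_cons nth_rcons size_rev ltnn eqxx; lia.
  have -> : s 18 (size A) = i by rewrite s18 //= rev_cons nth_rcons size_rev ltnn eqxx.
  set s2 := (fun b => _).
  have F b k : (b == 0) && ((k == 15) || (k == 1)) = false -> s2 b k = s b k.
    by rewrite /s2; case: (b == 0) => //= /norP[/negbTE -> /negbTE ->].
  apply: (@wp_then _ _ _ (pop_cost - 80) 20); first lia.
  apply: (wp_mono (k := 200 * size (nb i) + 20) (Q := fun s' =>
     agree (update Defs.Sub) s2 s' /\ state n okf (cov A) (own A) s')); first lia.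
    move=> s3 _ _ [ag3 st3]; apply: (wp_seq M) => //=.
    have G1 : s3 0 1 = i by rewrite ag3.
    rewrite G1 addn1; split=> //; first lia.
    apply: (@at_node_next A i s) => //.
    * apply: agree_trans (agree_sub (@sub_update _) ag3) => b k H.
      by apply: F; apply: contraNF H => /andP[/eqP -> /orP[]/eqP ->].
    * by rewrite ag3.
    * by rewrite ag3 //= F.
    * move=> k kA; rewrite ag3 // F // s18 /=; last lia.
      by rewrite rev_cons nth_rcons size_rev kA.
  apply: (wp_remove i_n) => //.
  + exact: stack_lt okA.
  + lia.
  + apply: agree_trans ag _ => b k H.
    by apply: F; apply: contraNF H => /andP[/eqP -> /orP[]/eqP ->].
  + by apply: state_ext st => // b k; rewrite !inE => /or3P[]/eqP ->.
  + by [].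
- lia.
- move=> s' _ nd'; exists os; split=> //.
  by apply: reach_mono (HR s' nd'); lia.
Qed.

(** Stated with a continuation: [os] is what follows once the candidates above [A] are exhausted.
    The machine has a single loop and no recursive call, so the return from
    [explore d (i :: A) i.+1] to [explore d A i.+1] is the pop of [search_pop], used as the
    continuation of the first induction hypothesis. *)
Lemma explore_reach d A i os : n - i = d -> stack_ok A i ->
  (forall s r, at_node A n s -> potential A n <= r -> reach s r os) ->
  forall s r, at_node A i s -> potential A i <= r ->
    reach s r (explore d A i ++ os).
Proof.
elim: d A i os => [|d IH] A i os id okA Hend s r nd pr.
  have i_n : i = n by case/and5P: okA => _ _ _ _; lia.
  by rewrite i_n in nd pr; apply: Hend.
have i_n : i < n by lia.
have id' : n - i.+1 = d by lia.
have [ag s1 s15 s17 [s18 st]] := nd.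
have nV' := nV1 D; have V8 := V8 M; have S64 := S64 M.
have sA := stack_size okA.
have F b k : ~~ touches search b k -> s b k = s0 b k by apply: ag.
have okS := stack_okS i_n okA.
have rest s' r' : at_node A i.+1 s' -> potential A i.+1 <= r' ->
    reach s' r' (explore d A i.+1 ++ os).
  exact: IH.
have [adm|nadm] := boolP (admissible A i); last first.
  have -> : explore d.+1 A i = explore d A i.+1 by rewrite /= (negbTE nadm).
  have pot := potential_reject i_n nadm.
  apply: reach_step => //; first lia.
  pose deg := size (nb i).
  apply: (@wpg_wp _ _ _ _ _ _ (400 * deg + 140) _
     (fun s' => at_node A i.+1 s')); first last.
  - move=> s' _ nd'; exists (explore d A i.+1 ++ os); split=> //.
    by apply: rest => //; rewrite /deg; lia.
  - by rewrite /deg; lia.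
  apply: (wp_if M (k1 := 400 * deg + 130)) => //=; last lia.
  rewrite s1 F // s0n i_n /=.
  apply: (@wp_then _ _ _ (400 * deg + 110) 20); first lia.
  apply: (wp_if M (k1 := 400 * deg + 100)) => //=; last lia.
    by rewrite s1; split=> //; apply: (lt_S D).
  rewrite s1 F // s0red //; have [ri|nri] /= := boolP (redf i); last first.
    apply: (wp_seq M) => //; first by rewrite /=; lia.
    apply: (wp_seq M) => //=; rewrite s1 addn1.
    by split=> //; [lia|apply: (@at_node_next A i s)].
  apply: (@wp_then _ _ _ (200 * deg + 20) (200 * deg + 80)); first lia.
  apply: (wp_add okA i_n nd) => s2 ag2 st2.
  have G1 : s2 0 1 = i by rewrite ag2.
  have G15 : s2 0 15 = size A by rewrite ag2.
  have An' : all (gtn n) (i :: A) by rewrite /= i_n; apply: stack_lt okA.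
  have ui := stack_uniq_push okA.
  have agS := agree_trans ag (agree_sub (@sub_update _) ag2).
  apply: (wp_if M (k1 := 200 * deg + 40)) => //=; last lia.
  have -> : s2 0 16 = npriv n okf (cov (i :: A)) (own (i :: A)) by case: st2 => _ _ [].
  rewrite G15 addn1 -[(size A).+1]/(size (i :: A)) npriv_feasible //.
  have -> : feasible (i :: A) = false.
    by apply: contraNF nadm => fi; rewrite /admissible ri.
  apply: (wp_mono (k := 200 * size (nb i) + 20) (Q := fun s' =>
     agree (update Defs.Sub) s2 s' /\ state n okf (cov A) (own A) s')).
  - by rewrite /deg; lia.
  - move=> s3 _ _ [ag3 st3]; apply: (wp_seq M) => //=.
    have H1 : s3 0 1 = i by rewrite ag3.
    rewrite H1 addn1; split=> //; first lia.
    apply: (@at_node_next A i s2) => //.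
    + by apply: agree_sub ag3; apply: sub_update.
    + by rewrite ag3.
    + by rewrite ag3 // ag2.
    + by move=> k kA; rewrite ag3 // ag2 // s18.
  - by apply: (wp_remove (A := A) i_n) => //; lia.
have okP := stack_ok_push i_n okA adm.
have [ri fi] := andP adm.
have push s' r' : at_node (i :: A) i.+1 s' -> potential (i :: A) i.+1 <= r' ->
    reach s' r' (explore d (i :: A) i.+1 ++ explore d A i.+1 ++ os).
  apply: IH => // s2 r2 nd2; rewrite potential_pop => pr2.
  apply: (search_pop okP i_n nd2); first lia.
  by move=> s3 nd3; apply: rest => //; lia.
have [os' Eall] : exists os', os' = explore d.+1 A i ++ os by eexists.
rewrite -Eall; pose out := if (A == [::]) && skipf i then [::] else [:: rev (i :: A)].
have fin o1 s5 q : o1 = out -> agree search s0 s5 -> s5 0 1 = i ->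
    s5 0 15 = (size A).+1 -> s5 0 17 = 0 ->
    (forall k, k < (size A).+1 -> s5 18 k = nth 0 (rev (i :: A)) k) ->
    state n okf (cov (i :: A)) (own (i :: A)) s5 ->
    potential (i :: A) i.+1 + 6 <= q ->
    wpg next s5 q (fun o2 s6 r6 => exists os2,
      os' = (o1 ++ o2) ++ os2 /\ reach s6 r6 os2).
  move=> -> ag5 e1 e15 e17 e18 st5 pq.
  apply: (@wpg_wp _ _ _ _ _ _ 6 _ (fun s6 => at_node (i :: A) i.+1 s6)).
  - apply: (wp_seq M) => //=; rewrite e1 addn1; split=> //; first lia.
    exact: (@at_node_next _ _ s5).
  - lia.
  - move=> s6 _ nd6.
    exists (explore d (i :: A) i.+1 ++ explore d A i.+1 ++ os); split.
      by rewrite Eall /= adm cats0 -!catA.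
    by apply: push => //; lia.
have pot : (400 * size (nb i) + 150) +
    (if (A == [::]) && skipf i then potential (i :: A) i.+1 else out_cost) <= r.
  apply: leq_trans pr; case: ifP => [/andP[/eqP -> ki]|_].
    by rewrite addnC; apply: potential_skip.
  exact: potential_accept.
have pot0 : 400 * size (nb i) + 150 <= r by lia.
apply: reach_step => //; first lia.
apply: (wpg_if M) => //=; first lia.
rewrite s1 F // s0n i_n /=; apply: wpg_comp.
apply: (wpg_if M) => //=; last 1 first.
- rewrite s1 F // s0red // ri /=; apply: wpg_comp.
  pose deg := size (nb i).
  apply: (@wpg_wp _ _ _ _ _ _ (200 * deg + 20) _ (fun s2 =>
     state n okf (cov (i :: A)) (own (i :: A)) s2)).
  + by apply: (wp_add okA i_n nd).
  + by clear -pot0; rewrite /deg; lia.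
  move=> s2 ag2 st2.
  have G1 : s2 0 1 = i by rewrite ag2.
  have G15 : s2 0 15 = size A by rewrite ag2.
  have An' : all (gtn n) (i :: A) by rewrite /= i_n; apply: stack_lt okA.
  have agS := agree_trans ag (agree_sub (@sub_update _) ag2).
  apply: (wpg_if M) => //=; first by clear -pot0; rewrite /deg; lia.
  have -> : s2 0 16 = npriv n okf (cov (i :: A)) (own (i :: A)) by case: st2 => _ _ [].
  rewrite G15 addn1 -[(size A).+1]/(size (i :: A)) npriv_feasible //; last first.
    exact: stack_uniq_push okA.
  rewrite fi; apply: wpg_comp.
  pose s3 := store (store s2 18 (size A) i) 0 15 (size A).+1.
  apply: (@wpg_wp _ _ _ _ _ _ 12 _ (fun s' => s' = s3)).
  + apply: (wp_seq M) => //=; rewrite G15 G1; split=> //.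
    * by split=> //; apply: (lt_S D); lia.
    * lia.
    rewrite /store /= G15 addn1; split=> //; lia.
  + by clear -pot0; rewrite /deg; lia.
  move=> s3' ag3' E3; rewrite {s3'}E3 in ag3' *.
  have H b k : (b == 18) || ((b == 0) && (k == 15)) = false -> s3 b k = s2 b k.
    move/negbT; rewrite negb_or /s3 /store => /andP[/negbTE n18 /negbTE ->].
    by rewrite n18.
  have H15 : s3 0 15 = (size A).+1 by [].
  have H18 k : k < (size A).+1 -> s3 18 k = nth 0 (rev (i :: A)) k.
    move=> kA; rewrite /s3 /store /= rev_cons nth_rcons size_rev.
    case: (ltngtP k (size A)) kA => // [kA _|]; last by lia.
    by rewrite ag2 // s18.
  have H1 : s3 0 1 = i by rewrite H.
  have st3 : state n okf (cov (i :: A)) (own (i :: A)) s3.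
    by apply: state_ext st2 => // b k; rewrite !inE => /or3P[]/eqP ->.
  have agS3 : agree search s0 s3.
    apply: agree_trans agS _ => b k nt; apply: H; apply: contraNF nt.
    by case/orP=> [/eqP ->|/andP[/eqP -> /eqP ->]].
  have H17 : s3 0 17 = 0 by rewrite H // ag2.
  have E9 : s3 9 i = skipf i by rewrite agS3 // s0skip.
  apply: (wpg_if M) => //=.
  + by rewrite H1; repeat split=> //; apply: (lt_S D).
  + by clear -pot0; rewrite /deg; lia.
  rewrite H15 H1 E9; have -> : ((size A).+1 == 1) * skipf i != 0 =
      (A == [::]) && skipf i by case: (A); case: (skipf i).
  case: ifP pot => isk pot.
    apply: (@wpg_wp _ _ _ _ _ _ 1 _ (fun s' => s' = s3)).
    * exact: (wp_seq M).
    * by clear -pot; rewrite /deg; lia.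
    move=> _ _ ->; apply: fin => //; first by rewrite /out isk.
    by clear -pot; rewrite /deg; lia.
  apply: (wpg_output (A := i :: A)) => //.
  + exact: leq_ltn_trans sA i_n.
  + by clear -pot; rewrite /deg; lia.
  move=> s4 ag4; apply: fin => //.
  + by rewrite /out isk.
  + by apply: agree_trans agS3 _; apply: agree_sub ag4; apply: sub_output.
  + by rewrite ag4.
  + by rewrite ag4.
  + by rewrite ag4.
  + by move=> k kA; rewrite ag4 // H18.
  + by apply: state_ext st3 => // [b k|]; [rewrite !inE => /or3P[]/eqP -> |]; rewrite ag4.
  + exact: potential_le.
- by rewrite s1; split=> //; apply: (lt_S D).
- by clear -pot0; lia.
Qed.


End Search.

(** * The members of the list produced by the search *)

Section Explore.
Variables (n : nat) (g okf : nat -> nat -> bool) (redf skipf : nat -> bool).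
Local Notation explore := (explore n g okf redf skipf).
Local Notation feasible := (feasible n g okf).
Local Notation admissible := (admissible n g okf redf).
Local Notation stack_ok := (stack_ok n g okf redf).

(** [B] holds the elements pushed above [A], largest first. If [i], the candidate decided first, is
    chosen, it is the last element of [B]; hence the case analysis through [rcons]. *)
Definition extends (A : seq nat) (i : nat) (B : seq nat) : bool :=
  [&& B != [::], sorted gtn B, all (fun x => i <= x < n) B, all redf B,
      feasible (B ++ A) &
      ~~ [&& A == [::], size B == 1 & skipf (head 0 B)]].

Lemma sorted_rcons_gtn B i : sorted gtn B -> all (fun x => i < x) B ->
  sorted gtn (rcons B i).
Proof.
case: B => //= b B; rewrite rcons_path => -> /andP[ib /allP H] /=.
by case/lastP: B H => // B x H; rewrite last_rcons H // mem_rcons mem_head.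
Qed.

Lemma extends_rcons A i B : B != [::] -> i < n ->
  extends A i (rcons B i) = redf i && extends (i :: A) i.+1 B.
Proof.
move=> B0 i_n; rewrite /extends B0 cat_rcons !all_rcons leqnn i_n /=.
have -> /= : rcons B i != [::] by case: (B).
rewrite size_rcons eqSS size_eq0 (negbTE B0) /= andbF !andbT.
have E : sorted gtn (rcons B i) && all (fun x => i <= x < n) B =
    sorted gtn B && all (fun x => i < x < n) B.
  apply/andP/andP => [[sB /allP aB]|[sB /allP aB]]; split.
  - by case: (B) sB => //= b B'; rewrite rcons_path => /andP[].
  - apply/allP => x xB; have /andP[_ ->] := aB x xB; rewrite andbT.
    have : pairwise gtn (rcons B i).
      by rewrite -sorted_pairwise //; move=> x' y' z' /=; lia.
    rewrite -cats1 pairwise_cat => /and3P[/allrelP H _ _].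
    by apply: (H x i); rewrite ?inE.
  - apply: sorted_rcons_gtn => //; apply/allP => x /aB; lia.
  - by apply/allP => x /aB /=; lia.
by rewrite [LHS]andbA E -!andbA; case: (redf i); rewrite ?andbT ?andbF.
Qed.

Lemma extends_rcons0 i A : i < n ->
  extends A i [:: i] = admissible A i && ~~ ((A == [::]) && skipf i).
Proof.
move=> i_n; rewrite /extends /admissible /= leqnn i_n.
by case: (redf i); case: (feasible (i :: A)).
Qed.

Lemma extendsS A i B : i < n -> i \notin B -> extends A i B = extends A i.+1 B.
Proof.
move=> i_n iB; rewrite /extends; congr [&& _, _, _ & _].
apply: eq_in_all => x xB; have : x != i by apply: contraNneq iB => <-.
by rewrite [i < x]ltn_neqAle eq_sym => ->.
Qed.

Lemma extends_mem_last A i B : extends A i B -> i \in B ->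
  exists B', B = rcons B' i.
Proof.
case/and5P=> B0 sB aB _ _; case/lastP: B sB aB B0 => // B x sB aB _.
rewrite mem_rcons inE => /predU1P[->|iB]; first by exists B.
have : pairwise gtn (rcons B x).
  by rewrite -sorted_pairwise //; move=> x' y' z' /=; lia.
rewrite -cats1 pairwise_cat => /and3P[/allrelP H _ _].
have := H i x iB; rewrite inE eqxx => /(_ isT) /=.
by move: aB; rewrite all_rcons => /andP[/andP[]]; lia.
Qed.

Lemma mem_explore d A i o : n - i = d -> i <= n ->
  reflect (exists2 B, o = rev (B ++ A) & extends A i B) (o \in explore d A i).
Proof.
elim: d A i o => [|d IH] A i o id i_n /=.
  apply: (iffP idP) => // -[B _ /and5P[B0 _ aB _ _]].
  by case: B B0 aB => //= x B _ /andP[]; lia.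
have iltn : i < n by lia.
have IH1 o' := IH A i.+1 o' ltac:(lia) iltn.
have IH2 o' := IH (i :: A) i.+1 o' ltac:(lia) iltn.
have noti A' B : extends A' i.+1 B -> i \notin B.
  by case/and5P=> _ _ /allP aB _ _; apply/negP => /aB; rewrite ltnn.
have [adm|nadm] := boolP (admissible A i); last first.
  apply: (iffP (IH1 o)) => -[B -> eB]; exists B => //.
    by rewrite extendsS // (noti _ _ eB).
  rewrite -extendsS //; apply: contra nadm => iB.
  have [B' EB] := extends_mem_last eB iB.
  move: eB; rewrite EB; have [->|B0] := eqVneq B' [::].
    by rewrite extends_rcons0 // => /andP[].
  rewrite extends_rcons // => /andP[ri /and5P[_ _ _ _ /andP[fB _]]].
  by rewrite /admissible ri (feasible_subseq _ fB) // suffix_subseq.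
have [ri _] := andP adm.
rewrite !mem_cat; apply: (iffP or3P) => [[H|H|H]|[B -> eB]].
- exists [:: i]; first by case: ifP H => // _; rewrite inE => /eqP.
  by rewrite extends_rcons0 // adm; case: ifP H.
- have /IH2[B -> eB] := H; exists (rcons B i); first by rewrite cat_rcons.
  by rewrite extends_rcons // ?ri //; case/and5P: eB.
- by have /IH1[B -> eB] := H; exists B; rewrite // extendsS // (noti _ _ eB).
have [iB|iB] := boolP (i \in B); last first.
  by apply: Or33; apply/IH1; exists B; rewrite // -extendsS.
have [B' EB] := extends_mem_last eB iB.
move: eB; rewrite EB; have [->|B0] := eqVneq B' [::].
  rewrite extends_rcons0 // => /andP[_ /negbTE nk]; apply: Or31.
  by rewrite nk mem_head.
rewrite extends_rcons // => /andP[_ eB]; apply: Or32.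
by apply/IH2; exists B'; rewrite // cat_rcons.
Qed.

(** The three parts are disjoint: outputs of the branch without [i] do not contain [i], and those
    above [i :: A] are longer than [rev (i :: A)]. *)
Lemma uniq_explore d A i : n - i = d -> i <= n -> all (gtn i) A ->
  uniq (explore d A i).
Proof.
elim: d A i => [//|d IH] A i id i_n aA /=.
have iltn : i < n by lia.
have aA1 : all (gtn i.+1) A by apply: sub_all aA => x /=; lia.
have U1 := IH A i.+1 ltac:(lia) iltn aA1.
case: ifP => // adm.
have U2 : uniq (explore d (i :: A) i.+1) by apply: IH; rewrite /= ?ltnSn //; lia.
have id1 : n - i.+1 = d by lia.
have M1 o := mem_explore A o id1 iltn.
have M2 o := mem_explore (i :: A) o id1 iltn.
have iA : i \notin A by apply/negP => /(allP aA) /=; rewrite ltnn.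
have nin o : o \in explore d A i.+1 -> i \notin o.
  case/M1 => B ->; case/and5P=> _ _ /allP aB _ _; rewrite mem_rev mem_cat negb_or iA andbT.
  by apply/negP => /aB; rewrite ltnn.
rewrite cat_uniq cat_uniq U1 U2 andbT /=; apply/and3P; split.
- by case: ifP.
- apply/hasP => -[o]; rewrite mem_cat => /orP[|H].
    case/M2 => B -> /and5P[B0 _ _ _ _].
    case: ifP => // _; rewrite inE => /eqP/(congr1 size).
    by rewrite !size_rev size_cat; case: B B0 => //= b B _; lia.
  case: ifP => // _; rewrite inE => /eqP E; have := nin _ H.
  by rewrite E mem_rev mem_head.
- apply/hasP => -[o H]; case/M2 => B E _.
  by have := nin _ H; rewrite E mem_rev mem_cat mem_head orbT.
Qed.

End Explore.

(** * From the program to the graph *)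

Section Enumeration.
Variables (n : nat) (g okf : nat -> nat -> bool) (redf skipf : nat -> bool).
Local Notation feasible := (feasible n g okf).

Definition node (C : seq nat) : bool :=
  [&& sorted gtn C, all (gtn n) C, all redf C & feasible C].

Definition all_outputs : seq (seq nat) :=
  [::] :: [seq [:: q] | q <- iota 0 n & skipf q] ++
          explore n g okf redf skipf n [::] 0.

Hypothesis feasible1 : forall i, i < n -> redf i -> feasible [:: i].
Hypothesis skip_red : forall i, i < n -> skipf i -> redf i.

Lemma mem_explore0 o :
  (o \in explore n g okf redf skipf n [::] 0) =
  [&& o != [::], node (rev o) & ~~ ((size o == 1) && skipf (head 0 o))].
Proof.
apply/mem_explore/idP => [||[B -> eB]|H]; rewrite ?subn0 //.
  rewrite cats0 revK size_rev; case/and5P: eB => B0 sB aB rB.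
  rewrite cats0 /node sB rB => /andP[-> nk].
  have -> : all (gtn n) B by apply: sub_all aB => x /=; lia.
  have -> /= : rev B != [::] by rewrite -size_eq0 size_rev size_eq0.
  by case: B nk {B0 sB aB rB} => [|b [|b' B]].
case/and3P: H => o0 /and4P[so ao ro fo] nk; exists (rev o).
  by rewrite cats0 revK.
rewrite /extends cats0 so ro fo size_rev /=.
have -> : rev o != [::] by rewrite -size_eq0 size_rev size_eq0.
have -> : all [eta gtn n] (rev o) by [].
by case: o nk {o0 so ao ro fo} => [|b [|b' o]].
Qed.

Lemma mem_all_outputs o : (o \in all_outputs) = node (rev o).
Proof.
rewrite inE mem_cat mem_explore0; have [->|o0] //= := eqVneq o [::].
case: (boolP ((size o == 1) && _)) => [/andP[so ko]|nk]; last first.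
  rewrite andbT; suff -> : (o \in [seq [:: q] | q <- iota 0 n & skipf q]) = false by [].
  apply/negbTE; apply: contra nk => /mapP[q]; rewrite mem_filter => /andP[kq _] ->.
  by rewrite /= kq.
rewrite andbF orbF; case: o so ko {o0} => [|q [|q' o]] //= _ kq.
rewrite /node /= !andbT; apply/mapP/idP => [[q']|/and3P[qn rq fq]].
  rewrite mem_filter mem_iota => /andP[_ /andP[_ qn]] [Eq]; subst q'.
  by rewrite qn skip_red // feasible1 // skip_red.
by exists q; rewrite // mem_filter kq mem_iota.
Qed.

Lemma uniq_all_outputs : uniq all_outputs.
Proof.
rewrite /all_outputs /= cat_uniq mem_cat mem_explore0 /= orbF.
apply/and3P; split.
- by apply/mapP => -[].
- by rewrite map_inj_uniq ?filter_uniq ?iota_uniq // => x y [].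
apply/andP; split; last by apply: uniq_explore; rewrite ?subn0.
apply/hasP => -[o]; rewrite mem_explore0 => /and3P[_ _ nk] /mapP[q].
by rewrite mem_filter => /andP[kq _] E; move: nk; rewrite E /= kq.
Qed.

End Enumeration.

(** * Labels and lists against vertices and sets *)

Section Bridge.
Variables (n : nat) (e : rel 'I_n).
Hypotheses (e_sym : symmetric e) (e_irr : irreflexive e).
Hypotheses (e_ch : chordal e) (p7 : path_free 7 e).
Local Notation N := (cnbhd e).

Definition nat_rel (i j : nat) : bool :=
  [exists x : 'I_n, exists y : 'I_n, [&& val x == i, val y == j & e x y]].

Local Notation g := nat_rel.
Local Notation nb := (nb n g).

Lemma nat_relE (x y : 'I_n) : g (val x) (val y) = e x y.
Proof.
apply/existsP/idP => [[x' /existsP[y' /and3P[/eqP/val_inj -> /eqP/val_inj ->]]]//|xy].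
by exists x; apply/existsP; exists y; rewrite !eqxx.
Qed.

Lemma nat_rel_sym : symmetric g.
Proof.
move=> i j; rewrite /g; apply/existsP/existsP => -[x /existsP[y /and3P[xi yj xy]]];
  by exists y; apply/existsP; exists x; rewrite xi yj e_sym.
Qed.

Lemma iota_enum : iota 0 n = [seq val x | x <- enum 'I_n].
Proof. by rewrite val_enum_ord. Qed.

Lemma has_iota (P : pred nat) : has P (iota 0 n) = [exists x : 'I_n, P (val x)].
Proof.
rewrite iota_enum has_map; apply/hasP/existsP => [[x _ Px]|[x Px]]; exists x => //.
exact: mem_enum.
Qed.

Lemma all_iota (P : pred nat) : all P (iota 0 n) = [forall x : 'I_n, P (val x)].
Proof. by rewrite -[LHS]negbK -has_predC has_iota negb_exists; apply: eq_forallb => x; rewrite /= negbK. Qed.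

Lemma count_iota (P : pred nat) :
  count P (iota 0 n) = #|[set x : 'I_n | P (val x)]|.
Proof.
rewrite iota_enum count_map cardE -size_filter; congr size.
by rewrite enumT /enum_mem; apply: eq_filter => x; rewrite !inE.
Qed.

Lemma count_nb (P : pred nat) (x : 'I_n) :
  count P (nb x) = #|[set y : 'I_n | e x y && P (val y)]|.
Proof.
rewrite count_filter count_iota; apply: eq_card => y.
by rewrite !inE /= nat_relE andbC.
Qed.

Lemma has_nb (P : pred nat) (x : 'I_n) :
  has P (nb x) = [exists y : 'I_n, e x y && P (val y)].
Proof.
rewrite has_filter -filter_predI -has_filter has_iota.
by apply: eq_existsb => y; rewrite /= nat_relE andbC.
Qed.

Lemma size_nbE (x : 'I_n) : size (nb x) = #|[set y | e x y]|.
Proof.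
by rewrite -(count_predT (nb x)) count_nb; apply: eq_card => y; rewrite !inE andbT.
Qed.

Lemma simpE (x : 'I_n) : simp n g x = simplicial e x.
Proof.
rewrite /simp all_iota; apply: eq_forallb => a; rewrite all_iota.
by apply: eq_forallb => b; rewrite !nat_relE.
Qed.

Lemma l1E (x : 'I_n) : l1 n g x = (x \in near_simplicial e).
Proof.
rewrite inE /l1 simpE has_iota; congr (_ && _); apply: eq_existsb => y.
by rewrite nat_relE simpE.
Qed.

Lemma badE (z x : 'I_n) : e x z -> bad n g z x =
  [exists q in near_simplicial e, e q z && (x \notin N q)].
Proof.
move=> xz; rewrite /bad has_iota; apply: eq_existsb => q.
by rewrite l1E /marks !nat_relE in_cnbhd negb_or [e z x]e_sym xz.
Qed.

Local Notation red := (red n g (bad n g)).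

Lemma skip_red i : skip n g i -> red i.
Proof. by case/andP=> li _; rewrite /red li. Qed.

(** Just after a skipped vertex the number of elements of L seen so far is odd. It stays odd while
    irredundant vertices are passed, as L contains only redundant ones, so the next redundant vertex
    is not skipped. *)
Lemma skip_unskipped i : i < n -> skip n g i -> unskipped n red (skip n g) i.+1.
Proof.
move=> i_n /andP[li ei]; rewrite /unskipped.
have [d Ed] : exists d, n - i.+1 = d by eexists.
have : odd (count (l1 n g) (iota 0 i.+1)).
  by rewrite iota0S -cats1 count_cat /= li oddD /= addbT.
elim: d i.+1 {i_n li ei} Ed => [|d IH] j Ed oj; rewrite Ed //=.
case: ifP => [_|nr]; first by rewrite /skip oj andbF.
rewrite (_ : d = n - j.+1); last lia.
apply: IH; first lia.
rewrite iota0S -cats1 count_cat /= oddD oj /= addn0.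
suff -> : l1 n g j = false by [].
by apply: contraFF nr; rewrite /red => ->.
Qed.

Section Rank.
Variable o : seq nat.
Hypotheses (o_uniq : uniq o) (o_size : size o = n) (o_lt : {subset o <= gtn n}).
Hypothesis o_greedy : greedy n g o.

Definition rank (x : 'I_n) : nat := index (val x) o.

Lemma mem_order (x : 'I_n) : val x \in o.
Proof.
have sub : {subset o <= iota 0 n} by move=> i /o_lt /=; rewrite mem_iota.
have [|_ ->] := uniq_min_size o_uniq sub; first by rewrite size_iota o_size.
by rewrite mem_iota /=.
Qed.

Lemma rank_inj : injective rank.
Proof.
move=> x y E; apply: val_inj; rewrite -(nth_index 0 (mem_order x)).
by rewrite -[index _ _]/(rank x) E nth_index // mem_order.
Qed.

Lemma rank_mcs b c : rank b < rank c ->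
  #|[set a | (rank a < rank b) && e c a]| <=
  #|[set a | (rank a < rank b) && e b a]|.
Proof.
move=> bc; pose p := take (rank b) o.
have b_o : rank b < size o by rewrite index_mem mem_order.
have mem_p (a : 'I_n) : (val a \in p) = (rank a < rank b).
  by rewrite in_take // mem_order.
have cnt x : #|[set a | (rank a < rank b) && e x a]| = count (g (val x)) p.
  have -> : #|[set a | (rank a < rank b) && e x a]| =
      count (fun i => (i \in p) && g (val x) i) (iota 0 n).
    by rewrite count_iota; apply: eq_card => a; rewrite !inE mem_p nat_relE.
  have /permP -> : perm_eq p [seq i <- iota 0 n | i \in p].
    apply: uniq_perm; rewrite ?filter_uniq ?iota_uniq ?take_uniq // => i.
    rewrite mem_filter mem_iota /=; have [ip|//] := boolP (i \in p).
    by have /= := o_lt (mem_take ip).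
  by rewrite count_filter; apply: eq_count => i; rewrite /= andbC.
rewrite !cnt; apply: (o_greedy (q := drop (rank b).+1 o)).
- by rewrite -{1}(nth_index 0 (mem_order b)) -drop_nth // cat_take_drop.
- exact: ltn_ord.
- by rewrite mem_p -leqNgt ltnW.
Qed.

Lemma order_elimination v a b : v < n -> a < n -> b < n ->
  index a o < index v o -> index b o < index v o ->
  g v a -> g v b -> a != b -> g a b.
Proof.
move=> vn an bn av bv va vb ab.
have := @mcs_elimination _ e e_sym e_irr e_ch rank rank_inj rank_mcs
  (Ordinal vn) (Ordinal an) (Ordinal bn) av bv.
by rewrite -!nat_relE /=; apply.
Qed.

Lemma redE (x : 'I_n) : red x = (x \in RN e).
Proof.
rewrite (in_RN_test e_sym e_irr e_ch p7 rank_inj rank_mcs) /red l1E has_nb.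
congr (_ || _); apply: eq_existsb => z; rewrite l1E !size_nbE.
by case xz: (e x z); rewrite //= badE.
Qed.

Local Notation irr := (irredundant e).
Local Notation component := (component e).
Local Notation rep := (rep n g (bad n g)).

Lemma redNE (x : 'I_n) : ~~ red x = irr x.
Proof. by rewrite redE inE negbK. Qed.

Lemma foldl_min (P : pred nat) y s (r := foldl (fun r z => if P z && (z < r) then z else r) y s) :
  (r \in y :: filter P s) /\ (forall z, z \in y :: filter P s -> r <= z).
Proof.
rewrite {}/r; elim: s y => [|z s IH] y /=.
  by split=> [|z]; rewrite inE // => /eqP ->.
case Pz: (P z) => /=; last exact: IH.
have [h1 h2] := IH (if z < y then z else y).
split; first by move: h1; case: ifP => _; rewrite !inE => /orP[->|->]; rewrite ?orbT.
move=> w; rewrite !inE => /or3P[/eqP ->|/eqP ->|ws].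
- by apply: leq_trans (h2 _ (mem_head _ _)) _; case: ltnP => //; lia.
- by apply: leq_trans (h2 _ (mem_head _ _)) _; case: ltnP => //; lia.
- by apply: h2; rewrite inE ws orbT.
Qed.

Lemma rep_component (y : 'I_n) : irr y -> exists2 w : 'I_n, w \in component y &
  rep y = val w /\ forall z : 'I_n, z \in component y -> val w <= val z.
Proof.
move=> iy; have [h1 h2] := foldl_min (fun z => ~~ red z) (val y) (nb y).
have memP (z : 'I_n) :
    (val z \in val y :: [seq i <- nb y | ~~ red i]) = (z \in component y).
  rewrite !inE mem_filter redNE mem_nb ltn_ord nat_relE /=.
  by rewrite -(inj_eq val_inj); case: eqP => [/val_inj ->|//]; rewrite iy.
have rn := rep_lt g (bad n g) (ltn_ord y).
exists (Ordinal rn); first by rewrite -memP.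
by split=> // z; rewrite -memP => /h2.
Qed.

Lemma repE (y z : 'I_n) : irr y -> irr z ->
  (rep z == rep y) = (z \in component y).
Proof.
move=> iy iz; have [w wy [-> wmin]] := rep_component iy.
have [w' wz [-> wmin']] := rep_component iz.
have CE := component_eq e_sym e_irr e_ch p7.
apply/eqP/idP => [/val_inj E|zy].
  by rewrite -(CE _ _ iy wy) -E (CE _ _ iz wz) inE iz cnbhd_refl.
by apply/eqP; rewrite eqn_leq wmin ?wmin' // ?(CE _ _ iy zy) // -(CE _ _ iy zy).
Qed.

(** Equal cardinalities mean that the clique lies in the open neighbourhood of [x]. The closed one
    gives the same condition because the redundant vertex [x] is not in the clique. *)
Lemma okE (x y : 'I_n) : x \in RN e ->
  ok n g (bad n g) x y = irr y && (component y \subset N x).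
Proof.
move=> rx; rewrite /ok nat_relE redNE.
have [iy|] := boolP (irr y); last by rewrite !andbF.
have E1 : count (fun z => ~~ red z && (rep z == rep y)) (nb x) =
    #|component y :&: [set z | e x z]|.
  rewrite count_nb; apply: eq_card => z; rewrite in_set in_setI in_set redNE andbC.
  congr (_ && _); have [iz|niz] /= := boolP (irr z); first exact: repE.
  by rewrite inE (negbTE niz).
have E2 : (count (predC red) (nb y)).+1 = #|component y|.
  rewrite count_nb (cardsD1 y (component y)) inE iy cnbhd_refl add1n; congr _.+1.
  apply: eq_card => z; rewrite !inE redNE; have [->|] //= := eqVneq z y.
    by rewrite e_irr.
  by rewrite andbC.
rewrite E1 E2 /= (subset_leqif_cards (subsetIl _ _)).
have xC : x \notin component y.
  by rewrite inE; move: rx; rewrite inE => /negbTE ->.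
apply/andP/subsetP => [[xy /eqP E] z|sub].
  by rewrite -E in_setI => /andP[_ xz]; rewrite inE in xz; apply: adj_cnbhd.
have adj z : z \in component y -> e x z.
  move=> zC; have := sub z zC; rewrite in_cnbhd.
  by case: eqP => // E; move: xC; rewrite -E zC.
split; first by rewrite adj // inE iy cnbhd_refl.
apply/eqP/setP => z; rewrite in_setI; have [zC|//] := boolP (z \in component y).
by rewrite inE adj.
Qed.

Definition vals (A : {set 'I_n}) : seq nat := [seq val x | x in A].

Lemma mem_vals (A : {set 'I_n}) (x : 'I_n) : (val x \in vals A) = (x \in A).
Proof. by rewrite /vals mem_image //; apply: val_inj. Qed.

Lemma uniq_vals (A : {set 'I_n}) : uniq (vals A).
Proof. by rewrite map_inj_uniq ?enum_uniq //; apply: val_inj. Qed.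

Lemma sorted_vals (A : {set 'I_n}) : sorted ltn (vals A).
Proof.
have -> : vals A = [seq i <- iota 0 n | i \in vals A].
  rewrite iota_enum filter_map; congr map.
  rewrite enumT /(enum_mem (mem A)); apply: eq_filter => x.
  by rewrite /= -[RHS]/(val x \in vals A) mem_vals.
by apply: sorted_filter (iota_ltn_sorted 0 n) => x y z; apply: ltn_trans.
Qed.

Lemma all_vals (A : {set 'I_n}) : all (gtn n) (vals A).
Proof. by apply/allP => i /imageP[x _ ->] /=. Qed.

(** Adjacency, which the program counts, and domination agree here: an element of [A] is redundant
    and hence differs from every irredundant [y]. *)
Lemma feasible_vals (A : {set 'I_n}) : A \subset RN e ->
  feasible n g (ok n g (bad n g)) (rev (vals A)) =
  [forall x in A, exists y, private_in e A x y].
Proof.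
move=> /subsetP AR; rewrite /feasible all_rev.
have priv (x y : 'I_n) : x \in A ->
    private g (ok n g (bad n g)) (rev (vals A)) x y = private_in e A x y.
  move=> xA; rewrite /private /private_in okE ?AR // [RHS]andbA andbC.
  have [/andP[iy sub]|//] /= := boolP (irr y && (component y \subset N x)).
  have mem_hits (z : 'I_n) :
      (val z \in hits g (rev (vals A)) y) = (z \in A) && (y \in N z).
    rewrite mem_filter mem_rev mem_vals nat_relE andbC in_cnbhd e_sym.
    have [zA|//] /= := boolP (z \in A); case: eqP => // yz.
    by have := AR z zA; rewrite inE -yz iy.
  have yx : y \in N x by rewrite (subsetP sub) // inE iy cnbhd_refl.
  have us : uniq (hits g (rev (vals A)) y).
    by rewrite filter_uniq // rev_uniq uniq_vals.
  apply/eqP/forall_inP => [E z zA|H].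
    apply/implyP => yz; have := mem_hits z.
    by rewrite zA yz E inE => /eqP/val_inj ->.
  have /perm_small_eq : perm_eq (hits g (rev (vals A)) y) [:: val x].
    apply: uniq_perm => // i; rewrite inE; apply/idP/eqP => [ih|->].
      have : i \in rev (vals A) by move: ih; rewrite mem_filter => /andP[].
      rewrite mem_rev => /imageP[z zA Ei]; move: ih; rewrite Ei mem_hits zA /=.
      by move=> yz; have := H z zA; rewrite yz => /eqP ->.
    by rewrite mem_hits xA.
  by apply.
apply/allP/forall_inP => [H x xA|H i].
  have /H : val x \in vals A by rewrite mem_vals.
  by rewrite has_iota => /existsP[y]; rewrite priv // => pxy; apply/existsP; exists y.
case/imageP=> x xA ->; rewrite has_iota; have /existsP[y pxy] := H x xA.
by apply/existsP; exists y; rewrite priv.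
Qed.

Lemma node_vals (A : {set 'I_n}) : node n g (ok n g (bad n g)) red (rev (vals A)) =
  independent e A.
Proof.
rewrite /node rev_sorted sorted_vals !all_rev all_vals /=.
have -> : all red (vals A) = (A \subset RN e).
  apply/allP/subsetP => [H x xA|H i /imageP[x xA ->]].
    by rewrite -redE H // mem_vals.
  by rewrite redE H.
rewrite /independent; case AR: (A \subset RN e) => //=.
exact: feasible_vals.
Qed.

Lemma feasible_red1 i : i < n -> red i -> feasible n g (ok n g (bad n g)) [:: i].
Proof.
move=> i_n ri; have := node_vals [set Ordinal i_n].
rewrite (independent1 (x := Ordinal i_n)) -?redE //.
have -> : vals [set Ordinal i_n] = [:: i] by rewrite /vals /image_mem enum_set1.
by case/and4P.
Qed.

Definition set_of (o : seq nat) : {set 'I_n} := [set x | val x \in o].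

Lemma enumerates_all u :
  written (last [::] (segments u)) = [::] ->
  outputs u = all_outputs n g (ok n g (bad n g)) red (skip n g) ->
  enumerates u (DRN e).
Proof.
move=> Hw Ho; split=> //; rewrite Ho.
set os := all_outputs _ _ _ _ _.
have mem_os o' : (o' \in os) = node n g (ok n g (bad n g)) red (rev o').
  apply: mem_all_outputs => [i|i _]; first exact: feasible_red1.
  exact: skip_red.
have os_nice o' : o' \in os -> sorted ltn o' /\ all (gtn n) o'.
  rewrite mem_os => /and4P[]; rewrite rev_sorted all_rev => so ao _ _.
  by split.
have vals_set o' : o' \in os -> vals (set_of o') = o'.
  move=> /os_nice[so /allP ao].
  apply: (irr_sorted_eq ltn_trans ltnn (sorted_vals _) so) => i.
  apply/imageP/idP => [[x]|io]; first by rewrite inE => xo ->.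
  have i_n := ao i io; exists (Ordinal i_n) => //.
  by rewrite inE.
exists [seq set_of o' | o' <- os]; split.
- rewrite map_inj_in_uniq; first by apply: uniq_all_outputs.
  by move=> o1 o2 h1 h2 E; rewrite -(vals_set o1) // E vals_set.
- move=> A; rewrite DRN_independent // -node_vals; apply/mapP/idP => [[o' ho ->]|nA].
    by rewrite vals_set // -mem_os.
  exists (vals A); first by rewrite mem_os.
  by apply/setP => x; rewrite inE mem_vals.
- elim: (os) vals_set => //= o' os' IH vs.
  rewrite -[X in perm_eq o' X]/(vals (set_of o')) vs ?mem_head // perm_refl.
  by apply: IH => o'' h; apply: vs; rewrite inE h orbT.
Qed.

End Rank.

(** [degree_sum] counts oriented edges, and forgetting the orientation has fibres of size at most
    two. *)
Lemma degree_sum_edges : degree_sum n g <= 2 * #|edges e|.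
Proof.
pose f (p : 'I_n * 'I_n) := [set p.1; p.2].
pose A := [set p : 'I_n * 'I_n | e p.1 p.2].
have -> : degree_sum n g = #|A|.
  rewrite /degree_sum -sum1_card.
  rewrite (eq_bigl (fun p : 'I_n * 'I_n => xpredT p.1 && e p.1 p.2)); last first.
    by move=> p; rewrite inE.
  rewrite -(pair_big_dep xpredT (fun x y => e x y) (fun _ _ => 1)) /=.
  apply: eq_bigr => x _; rewrite size_nbE -sum1_card; apply: eq_bigl => y.
  by rewrite inE.
rewrite -sum1_card (partition_big f (mem (edges e))) /=; last first.
  by move=> p; rewrite inE => ep; apply: imset_f; rewrite inE.
rewrite mulnC -sum_nat_const; apply: leq_sum => E /imsetP[q _ ->].
rewrite sum1_card; apply: leq_trans (_ : #|[set (q.1, q.2); (q.2, q.1)]| <= 2).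
  apply: subset_leq_card; apply/subsetP => p; rewrite !inE /f => /andP[ep /eqP E'].
  case: p ep E' => a b /= ep E'; case: q E' => c d /= E'.
  have := set21 a b; have := set22 a b; rewrite E' !inE !xpair_eqE.
  case/orP=> /eqP Eb; case/orP=> /eqP Ea; subst a b.
  - by rewrite inE e_irr in ep.
  - by rewrite !eqxx orbT.
  - by rewrite !eqxx.
  - by rewrite inE e_irr in ep.
by rewrite cards2; case: eqP.
Qed.

End Bridge.

(** * The complete program and its resource bounds *)

Definition preprocessing : cmd :=
  Comp build_lists
    (Comp visit_order (Comp simplicial_pass near_simplicial_pass)).

(** The initial [Emit] outputs the empty set, a member of the family; it ends the preprocessing
    segment and restores full credit for the first silent round. *)
Definition setup : cmd :=
  Comp Emit
    (Comp singletons
    (Comp (Comp redundant_pass (Comp leader_pass ok_pass))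
          (set_sc 1 (Const 0)))).

Definition program : cmd := Comp preprocessing (Comp setup search).

Section Correctness.
Variables (n : nat) (e : rel 'I_n).
Hypotheses (e_sym : symmetric e) (e_irr : irreflexive e).
Hypotheses (e_ch : chordal e) (p7 : path_free 7 e).
Variables (S W V : nat).
Hypothesis M : machine S W V.
Hypothesis D : n * n <= S /\ (n + 2) * (n + 2) <= V.
Local Notation g := (nat_rel e).
Local Notation l1 := (l1 n g).
Local Notation red := (red n g (bad n g)).
Local Notation ok := (ok n g (bad n g)).
Local Notation skip := (skip n g).
Local Notation degree_sum := (degree_sum n g).

Definition visit_order_of (o : seq nat) : Prop :=
  [/\ uniq o, size o = n, {subset o <= gtn n} & greedy n g o].

Lemma input_adjacency x y : x < n -> y < n -> input e 1 (x * n + y) = g x y.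
Proof.
move=> xn yn; rewrite /input; congr nat_of_bool; apply/existsP/existsP.
  case=> a /existsP[b /andP[/eqP E ab]]; exists a; apply/existsP; exists b.
  move/eqP: E; rewrite (idx_inj D) ?ltn_ord // => /andP[/eqP -> /eqP ->].
  by rewrite !eqxx.
case=> a /existsP[b /and3P[/eqP <- /eqP <- ab]]; exists a; apply/existsP.
by exists b; rewrite eqxx.
Qed.

Lemma bounded_input : bounded V (input e).
Proof.
have nV' := nV1 D; have V8 := V8 M.
by case=> [|[|b]] j //=; [case: ifP => _; lia|case: [exists _, _]; lia|lia].
Qed.

(** The visiting order survives only as an existence claim: later passes do not read it, but the
    correctness of the redundancy test rests on it. *)
Lemma wp_preprocessing :
  wp S W V preprocessing (input e) (800 * (n * n + n + 1)) (fun s =>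
    [/\ lists_ok n g s, forall x, x < n -> s 7 x = l1 x &
        exists o, visit_order_of o]).
Proof.
have gs := nat_rel_sym e_sym;
have adj := input_adjacency; pose K := n * n + n + 1.
apply: (@wp_then _ _ _ (100 * K) (700 * K)); first by rewrite /K; lia.
apply: (wp_build_lists (g := g) M D) => // s1 A1 L1.
apply: (@wp_then _ _ _ (200 * K) (500 * K)); first by rewrite /K; lia.
apply: (wp_visit_order gs M D (g := g)) => [|x y xn yn|x|x|s2 o A2 so vo].
- by rewrite A1.
- by rewrite A1 // adj.
- by rewrite A1.
- by rewrite A1.
case: (vo) => uo on go v5.
have adj2 x y : x < n -> y < n -> s2 1 (x * n + y) = g x y.
  by move=> xn yn; rewrite A2 // A1 // adj.
have s2n : s2 0 0 = n by rewrite A2 // A1.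
have mo x : x < n -> x \in o.
  by move=> xn; have := mem_order uo so on (Ordinal xn).
apply: (@wp_then _ _ _ (300 * K) (200 * K)); first by rewrite /K; lia.
apply: (wp_simplicial_pass gs M D (g := g)) => //.
- move=> x y xn yn; rewrite !v5 // !mo // => -[].
  by move/(congr1 (nth 0 o)); rewrite !nth_index ?mo.
- move=> v a b vn an bn; rewrite !v5 // !mo // !ltnS => av bv.
  exact: (order_elimination e_sym e_irr e_ch uo so on go).
move=> s3 A3 s36.
apply: (wp_near_simplicial_pass M D (g := g)) => //.
- by rewrite A3.
- by move=> x y xn yn; rewrite A3 // adj2.
move=> s4 A4 s47; split=> //; last by exists o.
move=> x xn; have [h1 h2] := L1 x xn.
by split=> [|k kn]; rewrite A4 // A3 // A2 // h2.
Qed.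

(** With [K = degree_sum + n + 1] this is [3000 * K]. The search demands [7 * spare + 6], where
    [spare] is at most [400 * K]; the singleton rounds with all that follows them need less. *)
Definition budget : nat := 50 * (60 * (degree_sum + n + 1)).

Lemma scan_cost0 : scan_cost n g 0 = 400 * degree_sum + 150 * n.
Proof.
rewrite /scan_cost big_mkord big_split sum_nat_const card_ord -big_distrr /=.
by rewrite -/degree_sum; lia.
Qed.

Section Order.
Variable o : seq nat.
Hypothesis o_ok : visit_order_of o.
Variable s0 : memory.
Hypotheses (s0_frame : agree preprocessing (input e) s0).
Hypotheses (s0_lists : lists_ok n g s0).
Hypothesis s0_l1 : forall x, x < n -> s0 7 x = l1 x.

Let o_uniq : uniq o. Proof. by case: o_ok. Qed.
Let o_size : size o = n. Proof. by case: o_ok. Qed.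
Let o_lt : {subset o <= gtn n}. Proof. by case: o_ok. Qed.
Let o_greedy : greedy n g o. Proof. by case: o_ok. Qed.

Lemma wpg_setup : wpg budget S W V setup s0 budget (fun os s r =>
  os = [::] :: [seq [:: q] | q <- iota 0 n & skip q] /\
  reach S W V budget s r (explore n g ok red skip n [::] 0)).
Proof.
have gs := nat_rel_sym e_sym;
have V8 := V8 M; have nV' := nV1 D.
have F b k : ~~ touches preprocessing b k -> s0 b k = input e b k by apply: s0_frame.
have s0n : s0 0 0 = n by rewrite F.
have adj x y : x < n -> y < n -> s0 1 (x * n + y) = g x y.
  by move=> xn yn; rewrite F // input_adjacency.
pose K := degree_sum + n + 1.
(* The last singleton may be followed by no further output before the search, so [T] covers the
   three passes, at [200 * K], [200 * K] and [400 * K], and the start of the search. *)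
pose T := 820 * K + potential n g ok red skip [::] 0.
have spareE : spare n g <= 400 * K.
  by rewrite /spare scan_cost0 /out_cost /pop_cost /K; lia.
have PE : 7 * spare n g + 6 <= budget by rewrite /budget -/K; lia.
have potE : potential n g ok red skip [::] 0 <= 800 * K.
  by have := potential_nil_le ok red skip D PE (leq0n n); lia.
apply: wpg_comp => bs; exists [:: Sep], s0, [:: [::]], budget; split=> //.
- exact: ExecEmit.
- by apply: (@gk_out budget budget [::]); rewrite //= /budget -/K; lia.
move: bs => _; apply: wpg_comp.
apply: (wpg_singletons M D (T := T) (g := g)) => //.
- by rewrite /round_cost /T /budget; rewrite /K in potE *; lia.
- by rewrite F.
- by move=> i; rewrite F.
- by move=> i; rewrite F.
move=> s1 r1 A1 Tr s18 s19; apply: wpg_comp.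
have F1 b k : ~~ touches singletons b k -> s1 b k = s0 b k by apply: A1.
have L1 : lists_ok n g s1.
  by move=> x xn; have [h1 h2] := s0_lists xn; split=> [|k kn]; rewrite F1 // h2.
apply: (@wpg_wp _ _ _ _ _ _ (800 * K) _ (fun s =>
  [/\ agree (Comp redundant_pass (Comp leader_pass ok_pass)) s1 s,
      forall x, x < n -> s 10 x = red x &
      forall x y, x < n -> y < n -> s 14 (x * n + y) = ok x y])).
- apply: (wp_mono (k := 800 * K) (Q := fun s =>
    (forall x, x < n -> s 10 x = red x) /\
    forall x y, x < n -> y < n -> s 14 (x * n + y) = ok x y)) => //.
    by move=> s A _ [h1 h2].
  apply: (@wp_then _ _ _ (200 * K) (600 * K)); first lia.
  apply: (wp_redundant_pass gs M D (g := g) (bad := bad n g)) => //.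
  + by rewrite F1.
  + by move=> x xn; rewrite F1 // s0_l1.
  + by move=> z x zn xn _; rewrite s18.
  move=> s2 A2 s210.
  have L2 : lists_ok n g s2.
    by move=> x xn; have [h1 h2] := L1 x xn; split=> [|k kn]; rewrite A2 // h2.
  apply: (@wp_then _ _ _ (200 * K) (400 * K)); first lia.
  apply: (wp_leader_pass M D (g := g) (bad := bad n g)) => //.
    by rewrite A2 // F1.
  move=> s3 A3 s311 s312.
  apply: (wp_ok_pass M D (g := g) (bad := bad n g)) => //.
  + by rewrite A3 // A2 // F1.
  + by move=> x xn; have [h1 h2] := L2 x xn; split=> [|k kn]; rewrite A3 // h2.
  + by move=> x xn; rewrite A3 // s210.
  + by move=> i; rewrite A3 // A2 // F1 // F.
  + by move=> i; rewrite A3 // A2 // F1 // F.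
  move=> s4 A4 s414; split=> // x xn.
  by rewrite A4 // A3 // s210.
- by rewrite /T in Tr; lia.
move=> s4 _ [A4 s410 s414].
pose s5 := store s4 0 1 0.
apply: (@wpg_wp _ _ _ _ _ _ 3 _ (fun s => s = s5)).
- by apply: (wp_seq M) => //=; split=> //; lia.
- by rewrite /T /K in Tr *; lia.
move=> _ _ ->; split; first by rewrite /= cats0.
have Z b k : ~~ touches preprocessing b k -> ~~ touches singletons b k ->
    ~~ touches (Comp redundant_pass (Comp leader_pass ok_pass)) b k ->
    (b != 0) || (k != 1) -> s5 b k = input e b k.
  move=> t1 t2 t3 nb1; rewrite /s5 /store -negb_and in nb1 *.
  by rewrite (negbTE nb1) A4 // F1 // F.
have C b k : b != 0 -> ~~ touches (Comp redundant_pass (Comp leader_pass ok_pass)) b k ->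
    s5 b k = s1 b k.
  by move=> b0 t; rewrite /s5 /store (negbTE b0) A4.
rewrite -[explore _ _ _ _ _ _ _ _]cats0.
have nd0 : at_node n g ok s5 [::] 0 s5.
  split=> //; [by rewrite Z|by rewrite Z|split=> //].
  split=> [y yn|y yn|]; [by rewrite Z|by rewrite Z|].
  have p0 x : privs n ok (cov g [::]) (own g [::]) x = 0.
    by rewrite /privs (eq_count (a2 := pred0)) ?count_pred0.
  split=> [x xn|]; rewrite Z // ?p0 // /npriv.
  by rewrite (eq_count (a2 := pred0)) ?count_pred0 // => x; rewrite p0.
have feas1 := feasible_red1 e_sym e_irr e_ch p7 o_uniq o_size o_lt o_greedy.
have skip1 := @skip_unskipped n e.
refine (@explore_reach _ _ _ _ _ _ _ _ _ gs M D feas1 skip1 PE s5 _ _ _ _ _ n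
  [::] 0 [::] (subn0 n) _ _ s5 _ nd0 _).
- by rewrite Z.
- move=> x xn; have [h1 h2] := s0_lists xn; split=> [|k kn].
    by rewrite C // F1.
  by rewrite C // F1 // h2.
- by move=> x xn; rewrite /s5 /store /= s410.
- by move=> x xn; rewrite C // s19.
- by move=> x y xn yn; rewrite /s5 /store /= s414.
- by [].
- move=> s r nd pr; apply: (search_exit M D PE (s0 := s5) _ nd).
    by rewrite Z.
  by apply: leq_trans pr; rewrite /= /pop_cost; lia.
- by rewrite /T in Tr; lia.
Qed.

End Order.

Lemma exec_program : exists k u s,
  [/\ exec S W program (input e) (ticks k ++ u) s,
      k <= 800 * (n * n + n + 1), enumerates u (DRN e) & delay u <= budget.+1].
Proof.
have [k [s0 [E0 kK b0 [L0 l10 [o oo]]]]] := wp_preprocessing bounded_input.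
have [u1 [s1 [os1 [r1 [E1 g1 b1 [Eos R]]]]]] :=
  wpg_setup oo (exec_agree E0) L0 l10 b0.
have [u2 [s2 [r2 [E2 g2]]]] := R b1.
exists k, (u1 ++ u2), s2.
have [Hout Hlast Hdelay] := gk_outputs (gk_cat g1 g2).
split=> //; first exact: ExecComp E0 (ExecComp E1 E2).
case: oo => uo so on go.
apply: (enumerates_all e_sym e_irr e_ch p7 uo so on go) => //.
by rewrite Hout Eos.
Qed.

End Correctness.

(* n ^ 2 + 1 and n + m + 1 instead of n ^ 2 and n + m only matter for the
   graph without vertices. The trace is [k] silent units of preprocessing
   followed by [u]. *)
Theorem theorem12 :
  exists (p : cmd) (c : nat),
    forall (n : nat) (e : rel 'I_n),
      simple_graph e -> path_free 7 e -> chordal e ->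
      exists (k : nat) (u : trace) (s : memory),
        [/\ exec (c * (n ^ 2 + 1)) ((n + 2) ^ c) p (input e) (ticks k ++ u) s,
            k <= c * (n ^ 2 + 1),
            enumerates u (DRN e) &
            delay u <= c * (n + #|edges e| + 1)].
Proof.
have main c : 100 * 100 <= c -> forall (n : nat) (e : rel 'I_n),
    simple_graph e -> path_free 7 e -> chordal e ->
    exists (k : nat) (u : trace) (s : memory),
      [/\ exec (c * (n ^ 2 + 1)) ((n + 2) ^ c) program (input e) (ticks k ++ u) s,
          k <= c * (n ^ 2 + 1),
          enumerates u (DRN e) &
          delay u <= c * (n + #|edges e| + 1)].
  move=> c_ge n e [e_sym e_irr] p7 e_ch.
  (* The values [own], sums of at most [n] labels, ask for a bound of order [n ^ 2] on cells; the
     cube is moreover at least 8 when [n = 0]. Intermediate values are then below [(n + 2) ^ 72]. *)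
  have M : machine (c * (n ^ 2 + 1)) ((n + 2) ^ c) ((n + 2) ^ 3).
    split.
    - by rewrite (@leq_exp2r 2 (n + 2) 3) // addn2.
    - by rewrite -expnM leq_exp2l ?addn2 //; lia.
    - by rewrite mulnDr muln1; apply: leq_trans (leq_addl _ _); lia.
  have D : n * n <= c * (n ^ 2 + 1) /\ (n + 2) * (n + 2) <= (n + 2) ^ 3.
    split; last by rewrite mulnn leq_exp2l ?addn2.
    rewrite mulnn; apply: leq_trans (leq_addr 1 _) _.
    by rewrite leq_pmull //; lia.
  have [k [u [s [E kK en du]]]] := exec_program e_sym e_irr e_ch p7 M D.
  exists k, u, s; split=> //.
  - apply: leq_trans kK _; rewrite -mulnn.
    have nn : n <= n * n by rewrite -{1}[n]mul1n leq_mul2r; case: (n).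
    apply: leq_trans (_ : 100 * 100 * (n * n + 1) <= _); first lia.
    by rewrite leq_mul2r c_ge orbT.
  - apply: leq_trans du _; rewrite /budget.
    have ds := degree_sum_edges e_irr.
    apply: leq_trans (_ : 100 * 100 * (n + #|edges e| + 1) <= _); first lia.
    by rewrite leq_mul2r c_ge orbT.
by exists program, (100 * 100); apply: main.
Qed.
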